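(* Let $\varepsilon\in(0,1)$ be any constant. There is a constant $C=C(\varepsilon)>0$ such that the following holds for every $n\in\mathbb{N}$ and every $p\in(4n^{-1/2},1/2)$. Let $X$ be the number of triangles in $G(n,p)$, let $\mu=\mathbb{E}(X)$, $\sigma^2=\mathrm{Var}(X)$ with $\sigma>0$, let $X^*=(X-\mu)/\sigma$, and let $\mathcal{L}$ be the support of $X^*$. Then $$\sup_{x\in\mathcal{L}}\left|\frac{1}{\sqrt{2\pi}}e^{-x^2/2}-\sigma\cdot\mathbb{P}(X^*=x)\right|\le C\,n^{-1/2+\varepsilon}p^{1/2}.$$
   Context: $G(n,p)$ is the Erdős–Rényi random graph on the vertex set $[n]=\{1,\dots,n\}$, in which each edge of the complete graph $K_n$ is included independently with probability $p$. The number of triangles is the number of (unlabelled) copies of $K_3$ in the graph. The support of the discrete random variable $X^*$ is the set of values it takes with positive probability. *)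

(* Defs.v *)
From HB Require Import structures.
From mathcomp Require Import all_boot all_order all_algebra.
From mathcomp Require Import all_classical all_reals all_analysis.

Set Implicit Arguments.
Unset Strict Implicit.
Unset Printing Implicit Defensive.

Import Order.TTheory GRing.Theory Num.Theory.

Local Open Scope classical_set_scope.
Local Open Scope ring_scope.

(* The edges of K_n are the 2-element subsets of the vertex set; the vertices
   1, ..., n are represented by the elements 0, ..., n - 1 of 'I_n. *)
Definition edge (n : nat) := {e : {set 'I_n} | #|e| == 2%N}.
HB.instance Definition _ (n : nat) :=
  Finite.copy (edge n) {e : {set 'I_n} | #|e| == 2%N}.

(* A graph on the vertex set 'I_n is identified with its set of edges. *)
Definition graph (n : nat) := {set edge n}.
HB.instance Definition _ (n : nat) := Finite.copy (graph n) {set edge n}.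
HB.instance Definition _ (n : nat) := isPointed.Build (graph n) finset.set0.

HB.instance Definition _ (n : nat) :=
  @isMeasurable.Build default_measure_display (graph n)
    discrete_measurable discrete_measurable0
    discrete_measurableC discrete_measurableU.

Definition gnp_pmf {R : realType} (n : nat) (p : R) (G : graph n) : R :=
  \prod_(e : edge n) bernoulli_pmf p (e \in G).

(* As for bernoulli_prob, a Dirac mass is used when p is not in [0, 1], so that
   gnp is a probability measure for every real p. *)
Definition gnp {R : realType} (n : nat) (p : R) : set (graph n) -> \bar R :=
  fun A => if 0 <= p <= 1 then
    (\sum_(G : graph n) (gnp_pmf p G)%:E * \d_G A)%E
  else \d_(finset.set0 : graph n) A.

Section gnp_probability.
Context {R : realType} (n : nat) (p : R).

Lemma gnp_pmf_ge0 (G : graph n) : 0 <= p <= 1 -> 0 <= gnp_pmf p G.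
Proof. by move=> p01; apply: prodr_ge0 => e _; exact: bernoulli_pmf_ge0. Qed.

Lemma sum_gnp_pmf : \sum_(G : graph n) gnp_pmf p G = 1.
Proof.
rewrite /gnp_pmf (reindex (fun f : {ffun edge n -> bool} =>
  [set e | f e]%SET : graph n)) /=; last first.
  exists (fun G : graph n => [ffun e => e \in G]).
    by move=> f _; apply/ffunP => e; rewrite ffunE inE.
  by move=> G _; apply/setP => e; rewrite inE ffunE.
under eq_bigr => f _ do under eq_bigr => e _ do rewrite inE.
rewrite -(bigA_distr_bigA (fun (_ : edge n) b => bernoulli_pmf p b)) /=.
by apply: big1 => e _; rewrite big_bool /bernoulli_pmf /= subrKC.
Qed.

Let gnp0 : gnp p (set0 : set (graph n)) = 0%E.
Proof.
rewrite /gnp measure0; case: ifP => // _.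
by apply: big1 => G _; rewrite measure0 mule0.
Qed.

Let gnp_ge0 (A : set (graph n)) : (0 <= gnp p A)%E.
Proof.
rewrite /gnp; case: ifP => // p01.
by apply: sume_ge0 => G _; rewrite mule_ge0 // lee_fin gnp_pmf_ge0.
Qed.

Let gnp_sigma_additive : semi_sigma_additive (@gnp R n p).
Proof.
move=> F mF tF mUF; rewrite /gnp; case: ifP => p01; last first.
  exact: measure_semi_sigma_additive.
apply: cvg_toP.
  apply: ereal_nondecreasing_is_cvgn => a b ab.
  apply: lee_sum_nneg_natr => // k _ _.
  by apply: sume_ge0 => G _; rewrite mule_ge0 // lee_fin gnp_pmf_ge0.
rewrite nneseries_sum; last first.
  by move=> G k _; rewrite mule_ge0 // lee_fin gnp_pmf_ge0.
apply: eq_bigr => G _.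
rewrite nneseriesZl //.
by congr (_ * _)%E; apply: cvg_lim => //; exact: measure_semi_sigma_additive.
Qed.

HB.instance Definition _ := isMeasure.Build _ _ _ (@gnp R n p)
  gnp0 gnp_ge0 gnp_sigma_additive.

Let gnp_setT : gnp p [set: graph n] = 1%E.
Proof.
rewrite /gnp diracT; case: ifP => // _.
under eq_bigr => G _ do rewrite diracT mule1.
by rewrite sumEFin sum_gnp_pmf.
Qed.

HB.instance Definition _ :=
  @Measure_isProbability.Build _ _ R (@gnp R n p) gnp_setT.

End gnp_probability.

(* A copy of K_3 is a 3-element set of vertices all of whose pairs are edges. *)
Definition num_triangles (n : nat) (G : graph n) : nat :=
  #|[set T : {set 'I_n} | (#|T| == 3%N) &&
      [forall e : edge n, (val e \subset T) ==> (e \in G)]]%SET|.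

(* Main.v *)
(* With D_A = X(G u A) - X(G), the identity E[1(T in G) g(G)] = p^3 E[g(G u T)]
   for each triangle T turns the derivative of the characteristic function phi
   of X - mu into averages of phi shifted by D_T.  Expanding to third order, and
   writing D_T again as a signed sum of monomials in the edge indicators, gives
   phi' = - th sigma^2 phi - i kappa th^2 phi + O(th^3 M), with kappa real, so
   that the cubic term only rotates phi; hence phi is within
   O(n^(-1 + eps) p^(-1/2)) of the Gaussian up to th = n^(1/2 + eps/4) p / sigma.

   For larger th, split the vertices into V1, V2, V3 and apply Cauchy-Schwarz in
   the edges between V1 and V3.  Only the triangles with one vertex in each part
   survive, and conditionally on the other edges their number is linear in the
   edges ab between V1 and V2, with coefficients that are sums of about n p
   independent signs; |phi|^2 is then smaller than any power of n.

   Fourier inversion on [-pi, pi] combines the two ranges. *)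

Require Import Defs.
From HB Require Import structures.
From mathcomp Require Import all_boot all_order all_algebra.
From mathcomp Require Import all_classical all_reals all_analysis.
From mathcomp Require Import measurable_realfun.
From mathcomp Require Import ring lra zify.

Set Implicit Arguments.
Unset Strict Implicit.
Unset Printing Implicit Defensive.

Import Order.TTheory GRing.Theory Num.Theory.
Import numFieldNormedType.Exports.

Local Open Scope ring_scope.

(** * Product Bernoulli measure on subsets of a finite set *)

(** The hypothesis $p>4n^{-1/2}$ enters as $np^2\ge16$: the triangles meeting a bounded edge set
    then have total weight $O(np^2)$. This gives $\sigma\asymp n^2p^{5/2}$,
    $\kappa/\sigma^3=O(n^{-1}p^{-1/2})$ and $M/\sigma^4=O(n^{-2}p^{-1})$.

    Write $w=n^{\varepsilon/4}$ and $T=n^{1/2}pw$, so that the cut is at $T/\sigma$. There the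
    decoupled bound is about $e^{-cw^2}$, and only the factor $w$ makes it smaller than any power of
    $n$. On the other side of the cut the remainder costs $T^3M/\sigma^4=O(n^{-1/2}p^2w^3)$.

    The obstacle is the term in $\kappa$. With $|\varphi|\le1$ alone it would cost
    $T^2\kappa/\sigma^3$, of order $p^{3/2}w^2$, which is far too much. As this term is a rotation,
    it drops out of the derivative of $|\varphi|^2$, so the decay of $|\varphi|$ is available
    beforehand; inserted into the system, it lowers the cost to
    $T\kappa/\sigma^3=O(n^{-1/2}p^{1/2}w)$.

    Expectations are finite sums over edge sets, and integrals in $\theta$ are replaced by explicit
    primitives, compared through their derivatives. *)

Section product_measure.
Context {R : realType} (I : finType).
Implicit Types (A B G H : {set I}) (p : R).

Definition wt p G : R := \prod_(e : I) (if e \in G then p else 1 - p).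
Definition Ex p (g : {set I} -> R) : R := \sum_(G : {set I}) wt p G * g G.
Definition mono A G : R := (A \subset G)%:R.
(** Resampling: the elements of [A] are decided by [G], all others by [H]. Independence of disjoint
    edge sets is expressed by averaging over such mixtures of two independent samples. *)
Definition mix A G H : {set I} := (A :&: G) :|: (H :\: A).

Lemma in_mix A G H e : (e \in mix A G H) = if e \in A then e \in G else e \in H.
Proof. by rewrite !inE; case: (e \in A); rewrite /= ?orbF ?andbF. Qed.

Lemma Ex_prod p (h : I -> bool -> R) :
  Ex p (fun G => \prod_e h e (e \in G)) =
  \prod_e (p * h e true + (1 - p) * h e false).
Proof.
rewrite /Ex (reindex (fun f : {ffun I -> bool} => [set e | f e]%SET)) /=; last first.
  exists (fun G : {set I} => [ffun e => e \in G]).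
    by move=> f _; apply/ffunP => e; rewrite ffunE inE.
  by move=> G _; apply/setP => e; rewrite inE ffunE.
under eq_bigr => f _ do rewrite /wt -big_split /=.
under eq_bigr => f _ do under eq_bigr => e _ do rewrite inE.
rewrite -(bigA_distr_bigA (fun e b => (if b then p else 1 - p) * h e b)) /=.
by apply: eq_bigr => e _; rewrite big_bool.
Qed.

Lemma sum_wt p : \sum_G wt p G = 1.
Proof.
have := Ex_prod p (fun _ _ => 1); rewrite /Ex /=.
under eq_bigr => G _ do rewrite big1_eq mulr1.
by move=> ->; apply: big1 => e _; rewrite !mulr1 addrC subrK.
Qed.

Lemma Ex_cst p c : Ex p (fun=> c) = c.
Proof. by rewrite /Ex -mulr_suml sum_wt mul1r. Qed.

Lemma eq_Ex p f g : f =1 g -> Ex p f = Ex p g.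
Proof. by move=> fg; apply: eq_bigr => G _; rewrite fg. Qed.

Lemma ExD p f g : Ex p (fun G => f G + g G) = Ex p f + Ex p g.
Proof. by rewrite /Ex -big_split; apply: eq_bigr => G _; rewrite mulrDr. Qed.

Lemma ExZ p c f : Ex p (fun G => c * f G) = c * Ex p f.
Proof. by rewrite /Ex mulr_sumr; apply: eq_bigr => G _; rewrite mulrCA. Qed.

Lemma ExZr p c f : Ex p (fun G => f G * c) = Ex p f * c.
Proof. by rewrite mulrC -ExZ; apply: eq_Ex => G; rewrite mulrC. Qed.

Lemma ExN p f : Ex p (fun G => - f G) = - Ex p f.
Proof. by rewrite -[RHS]mulN1r -ExZ; apply: eq_Ex => G; rewrite mulN1r. Qed.

Lemma ExB p f g : Ex p (fun G => f G - g G) = Ex p f - Ex p g.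
Proof. by rewrite ExD ExN. Qed.

Lemma Ex_sum p (J : Type) (s : seq J) (P : pred J) (f : J -> {set I} -> R) :
  Ex p (fun G => \sum_(j <- s | P j) f j G) = \sum_(j <- s | P j) Ex p (f j).
Proof.
by rewrite /Ex exchange_big; apply: eq_bigr => G _; rewrite mulr_sumr.
Qed.

Lemma Ex_swap p q (f : {set I} -> {set I} -> R) :
  Ex p (fun G => Ex q (f G)) = Ex q (fun H => Ex p (f^~ H)).
Proof.
rewrite /Ex; under eq_bigr => G _ do rewrite mulr_sumr.
rewrite exchange_big; apply: eq_bigr => H _; rewrite mulr_sumr.
by apply: eq_bigr => G _; rewrite mulrCA.
Qed.

Section p01.
Variable p : R.
Hypothesis p01 : 0 <= p <= 1.

Lemma wt_ge0 G : 0 <= wt p G.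
Proof. by move: p01 => /andP[p0 p1]; apply: prodr_ge0 => e _; case: ifP => _; lra. Qed.

Lemma ler_Ex f g : (forall G, f G <= g G) -> Ex p f <= Ex p g.
Proof. by move=> fg; apply: ler_sum => G _; rewrite ler_wpM2l ?wt_ge0. Qed.

Lemma Ex_ge0 f : (forall G, 0 <= f G) -> 0 <= Ex p f.
Proof. by move=> f0; rewrite -(Ex_cst p 0); apply: ler_Ex. Qed.

Lemma Ex_norm f : `|Ex p f| <= Ex p (fun G => `|f G|).
Proof.
apply: (le_trans (ler_norm_sum _ _ _)); apply: ler_sum => G _.
by rewrite normrM ger0_norm ?wt_ge0.
Qed.

Lemma Ex_norm_le f g : (forall G, `|f G| <= g G) -> `|Ex p f| <= Ex p g.
Proof. by move=> fg; apply: (le_trans (Ex_norm _)); apply: ler_Ex. Qed.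

Lemma Ex_sqr f : (Ex p f) ^+ 2 <= Ex p (fun G => f G ^+ 2).
Proof.
have : 0 <= Ex p (fun G => (f G - Ex p f) ^+ 2) by apply: Ex_ge0 => G; rewrite sqr_ge0.
under eq_Ex => G do rewrite sqrrB.
rewrite ExD ExB Ex_cst.
under [X in _ - X + _]eq_Ex => G do rewrite -mulrnAr.
rewrite ExZr; nra.
Qed.

End p01.

(** Exchanging the coordinates outside [A] between [G] and [H] is an involution on pairs that
    preserves the product weight; after it the second sample is free and sums to 1. *)
Lemma Ex_mix p A g : Ex p (fun G => Ex p (fun H => g (mix A G H))) = Ex p g.
Proof.
rewrite /Ex; under eq_bigr => G _ do rewrite mulr_sumr.
rewrite pair_bigA /=.
rewrite (reindex_inj (h := fun x : {set I} * {set I} =>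
   (mix A x.1 x.2, mix A x.2 x.1))) /=; last first.
  apply: inv_inj => -[G H] /=; congr pair; apply/setP => e;
    by rewrite !in_mix; case: (e \in A).
transitivity (\sum_(x : {set I} * {set I}) (wt p x.1 * g x.1) * wt p x.2).
  apply: eq_bigr => -[G H] _ /=.
  have -> : mix A (mix A G H) (mix A H G) = G.
    by apply/setP => e; rewrite !in_mix; case: (e \in A).
  rewrite mulrA [RHS]mulrAC; congr (_ * _).
  rewrite /wt -!big_split; apply: eq_bigr => e _ /=.
  by rewrite !in_mix; case: (e \in A) => //; rewrite mulrC.
rewrite -(pair_bigA _ (fun G H => wt p G * g G * wt p H)) /=.
by apply: eq_bigr => G _; rewrite -mulr_sumr sum_wt mulr1.
Qed.

Lemma Ex_mono p A : Ex p (mono A) = p ^+ #|A|.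
Proof.
have -> : Ex p (mono A) =
    Ex p (fun G => \prod_e (if e \in A then (e \in G)%:R else 1)).
  apply: eq_Ex => G; rewrite /mono; case: (boolP (A \subset G)) => [AG|/subsetPn[e eA eG]].
    by rewrite big1 // => e _; case: ifP => // /(fintype.subsetP AG) ->.
  by rewrite (bigD1 e) //= eA (negbTE eG) mul0r.
rewrite (Ex_prod p (fun e b => if e \in A then b%:R else 1)).
rewrite -prodr_const [RHS]big_mkcond /=; apply: eq_bigr => e _.
by case: ifP => _; rewrite ?mulr0 ?mulr1 ?addr0 // addrC subrK.
Qed.

(** With [A] sampled separately from the rest, the indicator sees only the first sample, and where
    it equals 1 the mixture is [H :|: A]. *)
Lemma Ex_monoM p A g :
  Ex p (fun G => mono A G * g G) = p ^+ #|A| * Ex p (fun G => g (G :|: A)).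
Proof.
rewrite -(Ex_mix p A) -Ex_mono -ExZr; apply: eq_Ex => G; rewrite -ExZ.
apply: eq_Ex => H.
have -> : mono A (mix A G H) = mono A G.
  rewrite /mono; congr (_%:R); congr nat_of_bool.
  apply/fintype.subsetP/fintype.subsetP => AG e eA; have := AG _ eA; by rewrite in_mix eA.
rewrite /mono; case: (boolP (A \subset G)) => AG; rewrite ?mul0r // !mul1r.
congr g; apply/setP => e; rewrite in_mix inE.
by case: ifPn => eA; rewrite ?orbT ?orbF // (fintype.subsetP AG).
Qed.

Lemma monoM A B G : mono A G * mono B G = mono (A :|: B) G.
Proof. by rewrite /mono finset.subUset -mulnb natrM. Qed.

Lemma mono_ge0 A G : 0 <= mono A G.
Proof. by rewrite /mono ler0n. Qed.

End product_measure.

(** * Derivatives and Taylor bounds for cos *)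

Section calculus.
Context {R : realType}.
Implicit Types (f g df dg : R -> R) (x y h a b c t : R).

Definition hasd f a t := is_derive t (1 : R) f a.

Lemma hasd_eq f a b t : hasd f a t -> a = b -> hasd f b t.
Proof. by move=> h <-. Qed.

Lemma hasd_cst c t : hasd (fun=> c) 0 t.
Proof. exact: is_derive_cst. Qed.

Lemma hasd_id t : hasd (fun x => x) 1 t.
Proof. exact: is_derive_id. Qed.

Lemma hasdD f g a b t :
  hasd f a t -> hasd g b t -> hasd (fun x => f x + g x) (a + b) t.
Proof. exact: is_deriveD. Qed.

Lemma hasdN f a t : hasd f a t -> hasd (fun x => - f x) (- a) t.
Proof. exact: is_deriveN. Qed.

Lemma hasdM f g a b t :
  hasd f a t -> hasd g b t -> hasd (fun x => f x * g x) (a * g t + f t * b) t.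
Proof.
move=> fa gb; apply: (@hasd_eq _ (f t *: b + g t *: a)); first exact: is_deriveM.
by rewrite addrC; congr (_ + _); rewrite [LHS]mulrC.
Qed.

Lemma hasdX f a n t :
  hasd f a t -> hasd (fun x => f x ^+ n.+1) (n.+1%:R * f t ^+ n * a) t.
Proof.
move=> fa; elim: n => [|n IH].
  by rewrite (_ : (fun x => _) = f) ?expr0 ?mul1r//; apply/funext => x; rewrite expr1.
rewrite (_ : (fun x => _) = fun x => f x * f x ^+ n.+1).
  by apply: (hasd_eq (hasdM fa IH)); rewrite !exprS -[n.+2%:R]natr1; ring.
by apply/funext => x; rewrite exprS.
Qed.

Lemma hasd_comp f g a b t :
  hasd f a (g t) -> hasd g b t -> hasd (fun x => f (g x)) (a * b) t.
Proof. by move=> fa gb; apply: is_derive1_comp. Qed.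

Lemma hasd_exp f a t : hasd f a t -> hasd (fun x => expR (f x)) (expR (f t) * a) t.
Proof. by move=> fa; apply: (hasd_comp _ fa); apply: is_derive_expR. Qed.

Lemma hasd_cos f a t : hasd f a t -> hasd (fun x => cos (f x)) (- sin (f t) * a) t.
Proof. by move=> fa; apply: (hasd_comp _ fa); apply: is_derive_cos. Qed.

Lemma hasd_sin f a t : hasd f a t -> hasd (fun x => sin (f x)) (cos (f t) * a) t.
Proof. by move=> fa; apply: (hasd_comp _ fa); apply: is_derive_sin. Qed.

Lemma hasd_sum (I : Type) (r : seq I) (P : pred I) (f : I -> R -> R) (d : I -> R) t :
  (forall i, hasd (f i) (d i) t) ->
  hasd (fun x => \sum_(i <- r | P i) f i x) (\sum_(i <- r | P i) d i) t.
Proof.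
move=> fd; elim: r => [|i r IH].
  rewrite big_nil (_ : (fun _ => _) = fun=> 0); first exact: hasd_cst.
  by apply/funext => x; rewrite big_nil.
rewrite big_cons (_ : (fun _ => _) = fun x =>
  if P i then f i x + \sum_(i <- r | P i) f i x else \sum_(i <- r | P i) f i x).
  by case: ifP => // _; apply: hasdD.
by apply/funext => x; rewrite big_cons.
Qed.

Lemma hasd_cont f df : (forall t, hasd f (df t) t) -> continuous f.
Proof.
by move=> fd t; apply: differentiable_continuous; apply/derivable1_diffP; case: (fd t).
Qed.

(** This comparison and the next one do the work of integration: an integral is estimated by pairing
    a primitive with an explicit majorant. *)
Lemma le_of_derive f g df dg x :
  (forall t, hasd f (df t) t) -> (forall t, hasd g (dg t) t) ->
  f 0 <= g 0 -> 0 <= x -> (forall t, 0 < t < x -> df t <= dg t) -> f x <= g x.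
Proof.
move=> fd gd fg0 x0 dfg.
have hd t : hasd (fun x => g x + - f x) (dg t - df t) t by apply: hasdD => //; apply: hasdN.
have : g 0 + - f 0 <= g x + - f x; last by lra.
apply: (@ger0_derive1_le_cc _ (fun x => g x + - f x) 0 x) => //; rewrite ?in_itv/= ?lexx ?x0 //.
- by move=> t _; case: (hd t).
- by move=> t; rewrite in_itv /= => t0x; rewrite derive1E; have [_ ->] := hd t; rewrite subr_ge0; apply: dfg.
- exact/continuous_subspaceT/(hasd_cont hd).
Qed.

Lemma norm_le_of_derive f g df dg x :
  (forall t, hasd f (df t) t) -> (forall t, hasd g (dg t) t) ->
  `|f 0| <= g 0 -> 0 <= x -> (forall t, 0 < t < x -> `|df t| <= dg t) ->
  `|f x| <= g x.
Proof.
move=> fd gd fg0 x0 dfg; rewrite ler_norml; apply/andP; split.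
  rewrite lerNl; apply: (@le_of_derive (fun x => - f x) g (fun t => - df t) dg) => //.
  - by move=> t; apply: hasdN.
  - by move: fg0; rewrite ler_norml; lra.
  - by move=> t /dfg; rewrite ler_norml; lra.
apply: (@le_of_derive f g df dg) => //; first by move: fg0; rewrite ler_norml; lra.
by move=> t /dfg; rewrite ler_norml; lra.
Qed.

(** Differentiation is a shift of the phase by [pi / 2]. Each Taylor bound below thus follows from
    the previous one at the shifted phase, without a separate treatment of the sine. *)
Lemma hasd_cosD y t : hasd (fun h => cos (y + h)) (cos (y + pi / 2 + t)) t.
Proof.
apply: (hasd_eq (hasd_cos (hasdD (hasd_cst y t) (hasd_id t)))).
by rewrite add0r mulr1 addrAC cosDpihalf.
Qed.

Lemma cos_taylor1 y h : 0 <= h -> `|cos (y + h) - cos y| <= h.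
Proof.
move=> h0.
apply: (@norm_le_of_derive (fun h => cos (y + h) + - cos y) (fun h => h)
  (fun h => cos (y + pi / 2 + h)) (fun=> 1)) => //.
- by move=> t; rewrite -[X in hasd _ X]addr0; apply: hasdD (hasd_cosD y t) (hasd_cst _ t).
- exact: hasd_id.
- by rewrite addr0 subrr normr0.
- by move=> t _; rewrite ler_norml cos_geN1 cos_le1.
Qed.

Lemma cos_taylor2 y h : 0 <= h ->
  `|cos (y + h) - cos y - h * cos (y + pi / 2)| <= h ^+ 2 / 2.
Proof.
move=> h0.
apply: (@norm_le_of_derive (fun h => (cos (y + h) + - cos y) + - (h * cos (y + pi / 2)))
  (fun h => h ^+ 2 * 2^-1)
  (fun h => cos (y + pi / 2 + h) - cos (y + pi / 2)) (fun h => h)) => //.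
- move=> t; apply: (hasd_eq (hasdD (hasdD (hasd_cosD y t) (hasd_cst _ t))
    (hasdN (hasdM (hasd_id t) (hasd_cst _ t))))).
  by ring.
- move=> t; apply: (hasd_eq (hasdM (hasdX 1 (hasd_id t)) (hasd_cst _ t))).
  by field.
- by rewrite addr0 subrr mul0r subrr normr0 expr0n mul0r.
- by move=> t /andP[t0 _]; apply: cos_taylor1; apply: ltW.
Qed.

Lemma cos_taylor3 y h : 0 <= h ->
  `|cos (y + h) - cos y - h * cos (y + pi / 2) + h ^+ 2 / 2 * cos y| <= h ^+ 3 / 6.
Proof.
move=> h0; rewrite -[_ / 2 * _]mulrA.
apply: (@norm_le_of_derive (fun h => ((cos (y + h) + - cos y) + - (h * cos (y + pi / 2)))
    + h ^+ 2 * (2^-1 * cos y))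
  (fun h => h ^+ 3 * 6^-1)
  (fun h => cos (y + pi / 2 + h) - cos (y + pi / 2) - h * cos (y + pi / 2 + pi / 2))
  (fun h => h ^+ 2 / 2)) => //; last 1 first.
- by move=> t /andP[t0 _]; apply: cos_taylor2; apply: ltW.
- move=> t; apply: (hasd_eq (hasdD (hasdD (hasdD (hasd_cosD y t) (hasd_cst _ t))
    (hasdN (hasdM (hasd_id t) (hasd_cst _ t))))
    (hasdM (hasdX 1 (hasd_id t)) (hasd_cst _ t)))).
  by rewrite (_ : y + pi / 2 + pi / 2 = y + pi) ?cosDpi; field.
- move=> t; apply: (hasd_eq (hasdM (hasdX 2 (hasd_id t)) (hasd_cst _ t))).
  by field.
- by rewrite addr0 subrr mul0r subrr !expr0n /= !mul0r addr0 normr0.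
Qed.
End calculus.

(** * Expansion of the characteristic function for copies of a hypergraph *)

Lemma norm_le_eq (R : realType) (x x' y y' : R) :
  x = x' -> y = y' -> `|x'| <= y' -> `|x| <= y.
Proof. by move=> -> ->. Qed.

Section hypergraph.
Context {R : realType} (I J : finType) (tri : J -> {set I}).
Implicit Types (A B G H : {set I}) (T S : J).

Definition copies G : R := \sum_T mono (tri T) G.
Definition gain A G : R := copies (G :|: A) - copies G.
Definition meets A T := ~~ [disjoint A & tri T].
(** A majorant of [gain] with nonnegative terms only, so that its powers expand into monomials
    without signs. *)
Definition gainU A G : R := \sum_(T | meets A T) mono (tri T :\: A) G.

Lemma monoU A B G : mono (R := R) B (G :|: A) = mono (B :\: A) G.
Proof. by rewrite /mono subDset finset.setUC. Qed.

Lemma setD_nmeets A T : ~~ meets A T -> tri T :\: A = tri T.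
Proof. by rewrite negbK disjoint_sym => /finset.setDidPl. Qed.

Lemma gainE A G :
  gain A G = \sum_(T | meets A T) (mono (tri T :\: A) G - mono (tri T) G).
Proof.
rewrite /gain /copies -sumrB [RHS]big_mkcond /=; apply: eq_bigr => T _.
rewrite monoU; case: ifPn => // /setD_nmeets ->; exact: subrr.
Qed.

Lemma le_mono A B G : A \subset B -> mono (R := R) B G <= mono A G.
Proof.
move=> AB; rewrite /mono ler_nat; case: (boolP (B \subset G)) => // BG.
by rewrite (fintype.subset_trans AB BG).
Qed.

Lemma gain_ge0 A G : 0 <= gain A G.
Proof.
by rewrite gainE; apply: sumr_ge0 => T _; rewrite subr_ge0 le_mono // finset.subsetDl.
Qed.

Lemma gain_leU A G : gain A G <= gainU A G.
Proof. by rewrite gainE; apply: ler_sum => T _; rewrite gerBl mono_ge0. Qed.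

Section stein.
Variables (p b : R).
Hypothesis p01 : 0 <= p <= 1.
Hypothesis tri3 : forall T, (#|tri T| <= 3)%N.
(** Moments of order 1, 2, 3 of the gain are needed for sets of at most 12, 9, 6 edges. With 3 edges
    for each copy, 15 edges occur in all, and the last copy is summed against at most 12. *)
Hypothesis hb : forall A, (#|A| <= 12)%N ->
  \sum_(T | meets A T) p ^+ #|tri T :\: A| <= b.

Local Notation E := (@Ex R I p).

Let p0 k : 0 <= p ^+ k.
Proof. by apply: exprn_ge0; case/andP: p01. Qed.

Let b0 : 0 <= b.
Proof.
apply: le_trans (hb (A := finset.set0) _); last by rewrite cards0.
by apply: sumr_ge0.
Qed.

Lemma meetsS A B T : A \subset B -> meets A T -> meets B T.
Proof. by move=> AB; apply: contra; apply: disjointWl. Qed.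

(** Expanding one factor [gainU] enlarges [B] by a copy [tri T] and multiplies the weight by
    $p^{|T\setminus B|}$. Since [T] meets [A], it meets [B], so the sum over [T] costs one factor
    [b]. *)
Lemma Ex_mono_gainU k A B : A \subset B -> (#|B| + 3 * k <= 15)%N ->
  E (fun G => mono (B :\: A) G * gainU A G ^+ k) <= p ^+ #|B :\: A| * b ^+ k.
Proof.
elim: k B => [|k IH] B AB cB.
  rewrite expr0 mulr1 -Ex_mono le_eqVlt; apply/orP; left; apply/eqP.
  by apply: eq_Ex => G; rewrite expr0 mulr1.
have -> : E (fun G => mono (B :\: A) G * gainU A G ^+ k.+1) =
    \sum_(T | meets A T) E (fun G => mono ((B :|: tri T) :\: A) G * gainU A G ^+ k).
  rewrite -Ex_sum; apply: eq_Ex => G; rewrite exprS {1}/gainU mulrA mulr_sumr mulr_suml.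
  by apply: eq_bigr => T _; rewrite monoM -finset.setDUl.
have cU T : (#|B :|: tri T| + 3 * k <= 15)%N.
  by have [+ _] := leq_card_setU B (tri T); have := tri3 T; lia.
apply: (le_trans (ler_sum _ (fun T _ => IH _ (fintype.subset_trans AB (finset.subsetUl _ _)) (cU T)))).
apply: (@le_trans _ _ (\sum_(T | meets A T)
   p ^+ #|B :\: A| * b ^+ k * p ^+ #|tri T :\: B|)).
  apply: ler_sum => T _; rewrite [leRHS]mulrAC -exprD.
  rewrite (_ : #|(B :|: tri T) :\: A| = (#|B :\: A| + #|tri T :\: B|)%N) //.
  rewrite -cardsUI [X in (_ + X)%N](_ : _ = 0)%N ?addn0.
    apply: eq_card => e; rewrite !inE.
    have := fintype.subsetP AB e; case: (e \in A) => /=; first by move=> ->.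
    by move=> _; case: (e \in B).
  by apply: eq_card0 => e; rewrite !inE; case: (e \in B); rewrite /= ?andbF.
rewrite -mulr_sumr exprSr mulrA ler_wpM2l ?mulr_ge0 ?exprn_ge0 ?(andP p01).1 //.
apply: le_trans (hb (A := B) _); last by move: cB; lia.
rewrite big_mkcond [leRHS]big_mkcond /=; apply: ler_sum => T _.
case: ifPn => [/(meetsS AB) -> //|_]; by case: ifP.
Qed.

Lemma Ex_gainU k A : (#|A| + 3 * k <= 15)%N -> E (fun G => gainU A G ^+ k) <= b ^+ k.
Proof.
move=> cA; have := Ex_mono_gainU (fintype.subxx A) cA.
rewrite finset.setDv cards0 expr0 mul1r; apply: le_trans; rewrite le_eqVlt; apply/orP; left.
by apply/eqP/eq_Ex => G; rewrite /mono finset.sub0set mul1r.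
Qed.

Lemma Ex_gain k A : (#|A| + 3 * k <= 15)%N -> E (fun G => gain A G ^+ k) <= b ^+ k.
Proof.
move=> cA; apply: le_trans (Ex_gainU cA); apply: ler_Ex => // G.
by rewrite lerXn2r ?nnegrE ?gain_ge0 ?gain_leU // (le_trans (gain_ge0 _ _) (gain_leU _ _)).
Qed.

Lemma Ex_gain1 A : (#|A| <= 12)%N -> E (gain A) <= b.
Proof. by move=> cA; have := @Ex_gain 1 A; rewrite expr1; apply; lia. Qed.

Lemma Ex_gain_ge0 A : 0 <= E (gain A).
Proof. by apply: Ex_ge0 => // G; exact: gain_ge0. Qed.

Lemma le_ptri A T : p ^+ #|tri T| <= p ^+ #|tri T :\: A|.
Proof.
by case/andP: p01 => ? ?; rewrite ler_wiXn2l // subset_leq_card // finset.subsetDl.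
Qed.

Let cD A T : (#|tri T :\: A| <= 3)%N.
Proof. by apply: leq_trans (tri3 T); rewrite subset_leq_card // finset.subsetDl. Qed.

Lemma sum_ptri (a : R) A : (#|A| <= 12)%N -> 0 <= a ->
  \sum_(T | meets A T) (p ^+ #|tri T :\: A| * a + p ^+ #|tri T| * a) <= 2 * a * b.
Proof.
move=> cA a0; apply: (@le_trans _ _ (\sum_(T | meets A T) (2 * a) * p ^+ #|tri T :\: A|)).
  apply: ler_sum => T _; have := ler_wpM2r a0 (le_ptri A T); lra.
by rewrite -mulr_sumr ler_wpM2l ?hb // mulr_ge0.
Qed.

Lemma Ex_gainM A f : E (fun G => gain A G * f G) =
  \sum_(T | meets A T) (E (fun G => mono (tri T :\: A) G * f G) - E (fun G => mono (tri T) G * f G)).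
Proof.
under [RHS]eq_bigr => T _ do rewrite -ExB.
rewrite -Ex_sum; apply: eq_Ex => G; rewrite gainE mulr_suml.
by apply: eq_bigr => T _; rewrite mulrBl.
Qed.

Lemma Ex_gainE A : E (gain A) =
  \sum_(T | meets A T) (p ^+ #|tri T :\: A| - p ^+ #|tri T|).
Proof.
have := Ex_gainM A (fun=> 1).
rewrite (_ : E _ = E (gain A)); last by apply: eq_Ex => G; rewrite mulr1.
move=> ->; apply: eq_bigr => T _; rewrite -!Ex_mono.
by congr (_ - _); apply: eq_Ex => G; rewrite mulr1.
Qed.

(** The covariance of [gain A] with [copies]: a monomial on [B] has covariance $p^{|B|}$ times the
    mean of [gain B] with [copies], and [gain A] is a signed sum of monomials. *)
Definition zeta A : R := \sum_(T | meets A T)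
  (p ^+ #|tri T :\: A| * E (gain (tri T :\: A)) - p ^+ #|tri T| * E (gain (tri T))).

Lemma zeta_le A : (#|A| <= 12)%N -> `|zeta A| <= 2 * b ^+ 2.
Proof.
move=> cA; rewrite (_ : 2 * b ^+ 2 = 2 * b * b); last by ring.
apply: le_trans (sum_ptri cA b0); apply: (le_trans (ler_norm_sum _ _ _)).
apply: ler_sum => T _; apply: (le_trans (ler_normB _ _)).
have h1 := @Ex_gain1 (tri T :\: A) (leq_trans (cD A T) (isT : 3 <= 12)%N).
have h2 := @Ex_gain1 (tri T) (leq_trans (tri3 T) (isT : 3 <= 12)%N).
by rewrite !ger0_norm ?mulr_ge0 ?Ex_gain_ge0 //; apply: lerD; rewrite ler_wpM2l.
Qed.

(** The coefficient of $-\theta^2$ when a monomial on [A] is averaged against [chi]. The part in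
    [zeta] arrives with the phase shifted by pi, hence with the same sign as the Taylor term. *)
Definition kap A : R := zeta A + E (fun G => gain A G ^+ 2) / 2.

Definition hmu : R := \sum_T p ^+ #|tri T|.
Definition hvar : R := \sum_T p ^+ #|tri T| * E (gain (tri T)).
(** Half the third central moment of $X$ = [copies], because $E[X(X-\mu)^2]=\sum_T
    p^{|T|}E[(X-\mu+D_T)^2]$ with $D_T$ the gain of $T$. *)
Definition hkap : R := \sum_T p ^+ #|tri T| * kap (tri T).

Lemma Ex_copies : E copies = hmu.
Proof. by rewrite /copies Ex_sum; apply: eq_bigr => T _; rewrite Ex_mono. Qed.

Lemma hmu_ge0 : 0 <= hmu.
Proof. by apply: sumr_ge0. Qed.

Lemma hvar_le : hvar <= hmu * b.
Proof.
rewrite /hmu mulr_suml; apply: ler_sum => T _; rewrite ler_wpM2l //.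
by rewrite Ex_gain1 // (leq_trans (tri3 T)).
Qed.

Lemma hkap_le : `|hkap| <= 3 * b ^+ 2 * hmu.
Proof.
rewrite /hmu mulr_sumr; apply: (le_trans (ler_norm_sum _ _ _)); apply: ler_sum => T _.
rewrite normrM ger0_norm // mulrC ler_wpM2r // /kap.
apply: (le_trans (ler_normD _ _)).
have h1 := @zeta_le (tri T) (leq_trans (tri3 T) (isT : 3 <= 12)%N).
have h2 : E (fun G => gain (tri T) G ^+ 2) <= b ^+ 2.
  by apply: Ex_gain; have := tri3 T; lia.
have h3 : 0 <= E (fun G => gain (tri T) G ^+ 2) by apply: Ex_ge0 => // G; rewrite sqr_ge0.
rewrite [X in _ + X]ger0_norm ?divr_ge0 //; nra.
Qed.

(** One factor of $X^2$ is expanded into copies; conditioning on a copy shifts the other factor by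
    the gain of that copy. *)
Lemma Ex_copies2 : E (fun G => (copies G - hmu) ^+ 2) = hvar.
Proof.
have -> : hvar = E (fun G => copies G ^+ 2) - hmu * hmu.
  have -> : E (fun G => copies G ^+ 2) = \sum_T p ^+ #|tri T| * E (fun G => copies (G :|: tri T)).
    transitivity (\sum_T E (fun G => mono (tri T) G * copies G)); last by apply: eq_bigr => T _; rewrite Ex_monoM.
    by rewrite -Ex_sum; apply: eq_Ex => G; rewrite expr2 {1}/copies mulr_suml.
  rewrite {1}/hmu mulr_suml -sumrB; apply: eq_bigr => T _.
  by rewrite -mulrBr -[X in _ - X]Ex_copies -ExB.
under eq_Ex => G do rewrite sqrrB.
rewrite ExD ExB Ex_cst.
under [X in _ - X + _]eq_Ex => G do rewrite -mulrnAr.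
rewrite ExZr Ex_copies; ring.
Qed.

Section charfun.
Variable th : R.
Hypothesis th0 : 0 <= th.

(** The phase [c] carries both parts of the characteristic function: at $c=-\theta\mu$ the mean is
    its real part, and a further [pi / 2] gives minus its imaginary part. *)
Definition chi c G : R := cos (th * copies G + c).
Definition psi c : R := E (chi c).

Lemma chiU A c G : chi c (G :|: A) = cos (th * copies G + c + th * gain A G).
Proof. by rewrite /chi /gain; congr cos; ring. Qed.

Lemma Ex_mono_chi1 A c : (#|A| <= 12)%N ->
  `|E (fun G => mono A G * chi c G) - p ^+ #|A| * psi c| <= p ^+ #|A| * (th * b).
Proof.
move=> cA; rewrite Ex_monoM -mulrBr normrM ger0_norm // ler_wpM2l // -ExB.
apply: (@le_trans _ _ (E (fun G => th * gain A G))).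
  apply: Ex_norm_le => // G; rewrite chiU; apply: cos_taylor1.
  by rewrite mulr_ge0 // gain_ge0.
by rewrite ExZ ler_wpM2l // Ex_gain1.
Qed.

(** Each order of the expansion is obtained for monomials and then transferred to gains. The
    transfer multiplies the error by [2 * b]: two monomials for each copy, and [b] from the sum over
    copies. *)
Lemma Ex_gain_chi1 A c : (#|A| <= 12)%N ->
  `|E (fun G => gain A G * chi c G) - E (gain A) * psi c| <= 2 * th * b ^+ 2.
Proof.
move=> cA; rewrite Ex_gainM Ex_gainE mulr_suml -sumrB.
apply: (le_trans (ler_norm_sum _ _ _)).
have tb : 0 <= th * b by rewrite mulr_ge0.
rewrite (_ : 2 * th * b ^+ 2 = 2 * (th * b) * b); last by ring.
apply: le_trans (sum_ptri cA tb); apply: ler_sum => T _.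
have h1 := @Ex_mono_chi1 (tri T :\: A) c (leq_trans (cD A T) (isT : 3 <= 12)%N).
have h2 := @Ex_mono_chi1 (tri T) c (leq_trans (tri3 T) (isT : 3 <= 12)%N).
rewrite (_ : _ - _ = (E (fun G => mono (tri T :\: A) G * chi c G) - p ^+ #|tri T :\: A| * psi c)
  - (E (fun G => mono (tri T) G * chi c G) - p ^+ #|tri T| * psi c)); last by ring.
by apply: (le_trans (ler_normB _ _)); apply: lerD.
Qed.

(** The constant is 5/2 = 1/2 + 2: the Taylor remainder, and [th] times the error of the first-order
    estimate for the gain. *)
Lemma Ex_mono_chi2 A c : (#|A| <= 9)%N ->
  `|E (fun G => mono A G * chi c G)
    - p ^+ #|A| * (psi c + th * E (gain A) * psi (c + pi / 2))|
  <= p ^+ #|A| * (5 / 2 * th ^+ 2 * b ^+ 2).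
Proof.
move=> cA; rewrite Ex_monoM -mulrBr normrM ger0_norm // ler_wpM2l //.
have h1 : `|E (fun G => chi c (G :|: A)) - psi c - th * E (fun G => gain A G * chi (c + pi / 2) G)|
    <= th ^+ 2 / 2 * b ^+ 2.
  rewrite -ExZ /psi -!ExB.
  apply: (@le_trans _ _ (E (fun G => th ^+ 2 / 2 * gain A G ^+ 2))).
    apply: Ex_norm_le => // G; rewrite chiU.
    apply: norm_le_eq (cos_taylor2 (th * copies G + c) (mulr_ge0 th0 (gain_ge0 A G))).
      by rewrite /chi addrA; ring.
    by ring.
  rewrite ExZ ler_wpM2l ?divr_ge0 ?exprn_ge0 // Ex_gain //; lia.
have h2 := @Ex_gain_chi1 A (c + pi / 2) (leq_trans cA (isT : 9 <= 12)%N).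
have h3 : th * `|E (fun G => gain A G * chi (c + pi / 2) G) - E (gain A) * psi (c + pi / 2)| <= th * (2 * th * b ^+ 2) by rewrite ler_wpM2l.
rewrite -(ger0_norm th0) -normrM (ger0_norm th0) in h3.
apply: norm_le_eq (le_trans (ler_normD _ _) (lerD h1 h3)); first by ring.
by field.
Qed.

Lemma Ex_gain_chi2 A c : (#|A| <= 12)%N ->
  `|E (fun G => gain A G * chi c G) - E (gain A) * psi c - th * zeta A * psi (c + pi / 2)|
  <= 5 * th ^+ 2 * b ^+ 3.
Proof.
move=> cA; rewrite Ex_gainM Ex_gainE /zeta mulr_suml mulr_sumr mulr_suml -!sumrB.
apply: (le_trans (ler_norm_sum _ _ _)).
have tb : 0 <= 5 / 2 * th ^+ 2 * b ^+ 2 by rewrite !mulr_ge0 ?exprn_ge0 ?invr_ge0.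
rewrite (_ : 5 * th ^+ 2 * b ^+ 3 = 2 * (5 / 2 * th ^+ 2 * b ^+ 2) * b); last by field.
apply: le_trans (sum_ptri cA tb); apply: ler_sum => T _.
have h1 := @Ex_mono_chi2 (tri T :\: A) c (leq_trans (cD A T) (isT : 3 <= 9)%N).
have h2 := @Ex_mono_chi2 (tri T) c (leq_trans (tri3 T) (isT : 3 <= 9)%N).
by apply: norm_le_eq (le_trans (ler_normB _ _) (lerD h1 h2)) => //; ring.
Qed.

(** For each pair [T], [S] the square of the gain contributes four monomials, whose sets all contain
    $(T\setminus A)\cup(S\setminus A)$. Their common bound sums to the second moment of [gainU]. *)
Lemma Ex_gain2_chi1 A c : (#|A| <= 6)%N ->
  `|E (fun G => gain A G ^+ 2 * chi c G) - E (fun G => gain A G ^+ 2) * psi c|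
  <= 4 * th * b ^+ 3.
Proof.
move=> cA.
pose e B := E (fun G => mono B G * chi c G) - p ^+ #|B| * psi c.
have eE B : e B = E (fun G => mono B G * (chi c G - psi c)).
  rewrite /e -Ex_mono -ExZr -ExB; apply: eq_Ex => G; ring.
have -> : E (fun G => gain A G ^+ 2 * chi c G) - E (fun G => gain A G ^+ 2) * psi c =
  \sum_(T | meets A T) \sum_(S | meets A S)
   (e ((tri T :\: A) :|: (tri S :\: A)) - e (tri T :\: A :|: tri S) -
    (e (tri T :|: (tri S :\: A)) - e (tri T :|: tri S))).
  rewrite -ExZr -ExB.
  under [RHS]eq_bigr => T _ do under eq_bigr => S _ do rewrite !eE -!ExB.
  under [RHS]eq_bigr => T _ do rewrite -Ex_sum.
  rewrite -Ex_sum; apply: eq_Ex => G; rewrite expr2 gainE mulr_suml -mulrBr mulr_suml.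
  apply: eq_bigr => T _; rewrite mulr_sumr mulr_suml; apply: eq_bigr => S _.
  rewrite -!monoM; ring.
have eb B T S : tri T :\: A :|: tri S :\: A \subset B -> (#|B| <= 12)%N ->
   `|e B| <= p ^+ #|tri T :\: A :|: tri S :\: A| * (th * b).
  move=> sB cB; apply: (le_trans (Ex_mono_chi1 c cB)).
  rewrite ler_wpM2r ?mulr_ge0 //.
  by case/andP: p01 => ? ?; rewrite ler_wiXn2l // subset_leq_card.
apply: (@le_trans _ _ (4 * (th * b) * E (fun G => gainU A G ^+ 2))); last first.
  rewrite (_ : 4 * th * b ^+ 3 = 4 * (th * b) * b ^+ 2); last by ring.
  rewrite ler_wpM2l ?mulr_ge0 // Ex_gainU //; lia.
have -> : E (fun G => gainU A G ^+ 2) = \sum_(T | meets A T) \sum_(S | meets A S)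
    p ^+ #|tri T :\: A :|: tri S :\: A|.
  under [RHS]eq_bigr => T _ do under eq_bigr => S _ do rewrite -Ex_mono.
  under [RHS]eq_bigr => T _ do rewrite -Ex_sum.
  rewrite -Ex_sum; apply: eq_Ex => G; rewrite expr2 mulr_suml; apply: eq_bigr => T _.
  by rewrite mulr_sumr; apply: eq_bigr => S _; rewrite monoM.
rewrite mulr_sumr; apply: (le_trans (ler_norm_sum _ _ _)); apply: ler_sum => T _.
rewrite mulr_sumr; apply: (le_trans (ler_norm_sum _ _ _)); apply: ler_sum => S _.
have cT B1 B2 : (#|B1| <= 3)%N -> (#|B2| <= 3)%N -> (#|B1 :|: B2 : {set I}| <= 12)%N.
  by move=> ? ?; have [+ _] := leq_card_setU B1 B2; lia.
have h1 := eb ((tri T :\: A) :|: (tri S :\: A)) T S (fintype.subxx _) (cT _ _ (cD _ _) (cD _ _)).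
have h2 := eb ((tri T :\: A) :|: tri S) T S (finset.setUS _ (finset.subsetDl _ _)) (cT _ _ (cD _ _) (tri3 _)).
have h3 := eb (tri T :|: (tri S :\: A)) T S (finset.setSU _ (finset.subsetDl _ _)) (cT _ _ (tri3 _) (cD _ _)).
have h4 := eb (tri T :|: tri S) T S (finset.setUSS (finset.subsetDl _ _) (finset.subsetDl _ _)) (cT _ _ (tri3 _) (tri3 _)).
have := le_trans (ler_normB _ _) (lerD (le_trans (ler_normB _ _) (lerD h1 h2)) (le_trans (ler_normB _ _) (lerD h3 h4))).
by move/le_trans; apply; rewrite le_eqVlt; apply/orP; left; apply/eqP; ring.
Qed.

(** The constant 8 exceeds 1/6 + 5 + 2: the Taylor remainder, the error in the gain at second order,
    and the error in its square at first order. *)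
Lemma Ex_mono_chi3 A c : (#|A| <= 6)%N ->
  `|E (fun G => mono A G * chi c G)
    - p ^+ #|A| * (psi c + th * E (gain A) * psi (c + pi / 2) - th ^+ 2 * kap A * psi c)|
  <= p ^+ #|A| * (8 * th ^+ 3 * b ^+ 3).
Proof.
move=> cA; rewrite Ex_monoM -mulrBr normrM ger0_norm // ler_wpM2l //.
have h1 : `|E (fun G => chi c (G :|: A)) - psi c - th * E (fun G => gain A G * chi (c + pi / 2) G)
     + th ^+ 2 / 2 * E (fun G => gain A G ^+ 2 * chi c G)|
    <= th ^+ 3 / 6 * b ^+ 3.
  rewrite -!ExZ /psi -!ExB -ExD.
  apply: (@le_trans _ _ (E (fun G => th ^+ 3 / 6 * gain A G ^+ 3))).
    apply: Ex_norm_le => // G; rewrite chiU.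
    apply: norm_le_eq (cos_taylor3 (th * copies G + c) (mulr_ge0 th0 (gain_ge0 A G))).
      by rewrite /chi addrA; field.
    by field.
  rewrite ExZ ler_wpM2l ?divr_ge0 ?exprn_ge0 // Ex_gain //; lia.
have h2 := @Ex_gain_chi2 A (c + pi / 2) (leq_trans cA (isT : 6 <= 12)%N).
have h3 : `|th * (E (fun G => gain A G * chi (c + pi / 2) G) - E (gain A) * psi (c + pi / 2)
  - th * zeta A * psi (c + pi / 2 + pi / 2))| <= th * (5 * th ^+ 2 * b ^+ 3).
  by rewrite normrM (ger0_norm th0) ler_wpM2l.
have h4 := @Ex_gain2_chi1 A c cA.
have h5 : `|th ^+ 2 / 2 * (E (fun G => gain A G ^+ 2 * chi c G) - E (fun G => gain A G ^+ 2) * psi c)| <= th ^+ 2 / 2 * (4 * th * b ^+ 3).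
  by rewrite normrM ger0_norm ?ler_wpM2l // divr_ge0 ?exprn_ge0.
have psipi : psi (c + pi / 2 + pi / 2) = - psi c.
  rewrite /psi -ExN; apply: eq_Ex => G; rewrite /chi -cosDpi; congr cos; by field.
rewrite psipi in h3.
have := le_trans (ler_normB _ _) (lerD (le_trans (ler_normD _ _) (lerD h1 h3)) h5).
move=> h; apply: (@le_trans _ _ (th ^+ 3 / 6 * b ^+ 3 + th * (5 * th ^+ 2 * b ^+ 3) + th ^+ 2 / 2 * (4 * th * b ^+ 3))).
  by apply: norm_le_eq h => //; rewrite /kap; field.
have : 0 <= th ^+ 3 * b ^+ 3 by rewrite mulr_ge0 // exprn_ge0.
nra.
Qed.

Lemma Ex_copies_chi c :
  `|E (fun G => copies G * chi c G) - hmu * psi c - th * hvar * psi (c + pi / 2)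
    + th ^+ 2 * hkap * psi c|
  <= 8 * th ^+ 3 * b ^+ 3 * hmu.
Proof.
have -> : E (fun G => copies G * chi c G) = \sum_T E (fun G => mono (tri T) G * chi c G).
  by rewrite -Ex_sum; apply: eq_Ex => G; rewrite mulr_suml.
have h T := @Ex_mono_chi3 (tri T) c (leq_trans (tri3 T) (isT : 3 <= 6)%N).
move: (psi c) (psi (c + pi / 2)) h => x y h.
rewrite /hmu /hvar /hkap !mulr_sumr !mulr_suml -!sumrB -big_split /=.
apply: (le_trans (ler_norm_sum _ _ _)); apply: ler_sum => T _.
by apply: norm_le_eq (h T); ring.
Qed.

End charfun.
End stein.
End hypergraph.

(** * The perturbed Gaussian differential system *)

Section ode.
Context {R : realType}.
Variables (C S dC dS : R -> R) (v kappa K M : R).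
Hypothesis hC : forall t, hasd C (dC t) t.
Hypothesis hS : forall t, hasd S (dS t) t.
Hypothesis C0 : C 0 = 1.
Hypothesis S0 : S 0 = 0.
Hypothesis v0 : 0 < v.
Hypothesis M0 : 0 <= M.
Hypothesis kK : `|kappa| <= K.
Hypothesis eC : forall t, 0 <= t ->
  `|dC t + t * v * C t - t ^+ 2 * kappa * S t| <= t ^+ 3 * M.
Hypothesis eS : forall t, 0 <= t ->
  `|dS t + t * v * S t + t ^+ 2 * kappa * C t| <= t ^+ 3 * M.

Let g t := expR (t ^+ 2 * (v / 2)).

Let hg t : hasd g (g t * (t * v)) t.
Proof.
apply: hasd_eq (hasd_exp (hasdM (hasdX 1 (hasd_id t)) (hasd_cst _ t))) _.
by rewrite /g; congr (_ * _); field.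
Qed.

Let g0 t : 0 < g t. Proof. exact: expR_gt0. Qed.

Let g1 : g 0 = 1. Proof. by rewrite /g expr0n mul0r expR0. Qed.

(* The [kappa] terms cancel in the derivative of [C ^ 2 + S ^ 2]. *)
Lemma ode_energy x : 0 <= x ->
  C x ^+ 2 + S x ^+ 2 <= expR (- (x ^+ 2 * (v / 2))) + 2 * x ^+ 4 * M ^+ 2 / v ^+ 2.
Proof.
move=> x0; set B := 2 * x ^+ 4 * M ^+ 2 / v ^+ 2.
have B0 : 0 <= B by rewrite /B divr_ge0 ?mulr_ge0 ?exprn_ge0 // ltW.
(* The factor [g] has half the exponent that would cancel the decay of $C^2+S^2$. The remaining
   $-tv(C^2+S^2)$ absorbs the errors by completing the square. *)
have h : g x * (C x ^+ 2 + S x ^+ 2) <= 1 + B * (g x + - 1).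
  apply: (@le_of_derive _ (fun t => g t * (C t ^+ 2 + S t ^+ 2))
    (fun t => 1 + B * (g t + - 1))
    (fun t => g t * (t * v) * (C t ^+ 2 + S t ^+ 2) + g t * (2 * C t * dC t + 2 * S t * dS t))
    (fun t => B * (g t * (t * v)))) => //.
  - move=> t; apply: (hasd_eq (hasdM (hg t) (hasdD (hasdX 1 (hC t)) (hasdX 1 (hS t))))).
    by rewrite !expr1.
  - move=> t; apply: (hasd_eq (hasdD (hasd_cst 1 t)
      (hasdM (hasd_cst B t) (hasdD (hg t) (hasd_cst _ t))))).
    by ring.
  - by rewrite C0 S0 g1 !expr0n expr1n /= !addr0 mulr1 subrr mulr0 addr0.
  - move=> t /andP[t0 tx].
    rewrite (_ : _ + _ = g t * (t * v * (C t ^+ 2 + S t ^+ 2) +  (2 * C t * dC t + 2 * S t * dS t))); last by ring.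
    rewrite (_ : B * _ = g t * (t * v * B)); last by ring.
    rewrite ler_pM2l //.
    set e1 := dC t + t * v * C t - t ^+ 2 * kappa * S t.
    set e2 := dS t + t * v * S t + t ^+ 2 * kappa * C t.
    have h1 : `|e1| <= t ^+ 3 * M by apply: eC; apply: ltW.
    have h2 : `|e2| <= t ^+ 3 * M by apply: eS; apply: ltW.
    rewrite (_ : _ + _ = 2 * (C t * e1 + S t * e2) - t * v * (C t ^+ 2 + S t ^+ 2)); last first.
      by rewrite /e1 /e2; ring.
    have tv0 : 0 < t * v by rewrite mulr_gt0.
    have key z e : `|e| <= t ^+ 3 * M -> 2 * (z * e) - t * v * z ^+ 2 <= t * v * (t ^+ 4 * M ^+ 2 / v ^+ 2).
      move=> he.
      have e2le : e ^+ 2 <= (t ^+ 3 * M) ^+ 2.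
        by rewrite -(real_normK (num_real e)) lerXn2r // nnegrE mulr_ge0 // exprn_ge0 // ltW.
      rewrite [leRHS](_ : _ = (t ^+ 3 * M) ^+ 2 / (t * v)); last by field; rewrite !gt_eqF.
      rewrite ler_pdivlMr //.
      have : 0 <= (e - t * v * z) ^+ 2 by rewrite sqr_ge0.
      nra.
    have k1 := key (C t) e1 h1; have k2 := key (S t) e2 h2.
    have tx4 : t ^+ 4 <= x ^+ 4 by rewrite lerXn2r // ?nnegrE // ltW.
    have : t * v * (2 * (t ^+ 4 * M ^+ 2 / v ^+ 2)) <= t * v * B.
      rewrite ler_pM2l //.
      have c0 : 0 <= 2 * M ^+ 2 / v ^+ 2 by rewrite divr_ge0 ?mulr_ge0 ?exprn_ge0 // ltW.
      by have := ler_wpM2l c0 tx4; rewrite /B; lra.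
    lra.
rewrite expRN -/(g x) -[leLHS]mul1r -(mulVf (lt0r_neq0 (g0 x))) -mulrA.
apply: (@le_trans _ _ ((g x)^-1 * (1 + B * g x))).
  by rewrite ler_pM2l ?invr_gt0 //; apply: le_trans h _; nra.
by rewrite mulrDr mulr1 mulrCA mulVf ?mulr1 // lt0r_neq0.
Qed.

Let h1 t := expR (- (t ^+ 2 * (v / 4))).

Let h1sqr t : h1 t ^+ 2 = expR (- (t ^+ 2 * (v / 2))).
Proof. by rewrite /h1 -expRM_natl; congr expR; field. Qed.

Lemma ode_bound x z : 0 <= x -> z ^+ 2 <= C x ^+ 2 + S x ^+ 2 ->
  `|z| <= h1 x + 2 * (x ^+ 2 * M / v).
Proof.
move=> x0 hz.
have w0 : 0 <= x ^+ 2 * M / v by rewrite divr_ge0 ?mulr_ge0 ?exprn_ge0 // ltW.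
have h0 : 0 < h1 x by exact: expR_gt0.
have W0 : 0 <= h1 x + 2 * (x ^+ 2 * M / v) by apply: addr_ge0; [exact: expR_ge0 | exact: mulr_ge0].
rewrite -(@ler_pXn2r _ 2%N) ?nnegrE //.
rewrite real_normK ?num_real //.
apply: (le_trans hz); apply: (le_trans (ode_energy x0)).
rewrite -h1sqr (_ : 2 * x ^+ 4 * M ^+ 2 / v ^+ 2 = 2 * (x ^+ 2 * M / v) ^+ 2); last first.
  by field; rewrite gt_eqF.
move: (x ^+ 2 * M / v) (h1 x) w0 h0 => w h w0 h0; nra.
Qed.

Lemma mul_expRNsqr (y : R) : y * expR (- y ^+ 2) <= 1.
Proof.
rewrite expRN ler_pdivrMr ?expR_gt0 // mul1r.
have := expR_ge1Dx (y ^+ 2); have : 0 <= (y - 1) ^+ 2 by rewrite sqr_ge0.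
nra.
Qed.

Let th1 t : 0 <= t -> t * h1 t <= 2 / Num.sqrt v.
Proof.
move=> t0; have s0 : 0 < Num.sqrt v by rewrite sqrtr_gt0.
have := mul_expRNsqr (t * Num.sqrt v / 2).
rewrite (_ : - _ = - (t ^+ 2 * (v / 4))).
  rewrite -/(h1 t) => h; rewrite ler_pdivlMr //; move: h; lra.
by rewrite !exprMn sqr_sqrtr ?(ltW v0) //; field.
Qed.

(** [K] times a bound for $t|Z(t)|$, plus $x^2M$, where $Z$ is either component. Its decay makes the
    leading term independent of [x]; the trivial bound on $Z$ would give $Kx$ instead. *)
Definition ode_err x := 2 * K / Num.sqrt v + 2 * x ^+ 3 * K * M / v + x ^+ 2 * M.

(** The rotation term is now treated as a forcing term, its size being known from the energy bound
    on the other component [Z]; [g] is the integrating factor of the Gaussian equation. *)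
Let gapprox (F dF Z : R -> R) (c : R) x : 0 <= x ->
  (forall t, hasd F (dF t) t) -> F 0 = c ->
  (forall t, 0 <= t -> `|dF t + t * v * F t| <= t ^+ 2 * K * `|Z t| + t ^+ 3 * M) ->
  (forall t, Z t ^+ 2 <= C t ^+ 2 + S t ^+ 2) ->
  `|F x - c * expR (- (x ^+ 2 * (v / 2)))| <= ode_err x / v.
Proof.
move=> x0 hF F0 eF hZ; set A := ode_err x.
have K0 : 0 <= K by apply: le_trans kK.
have A0 : 0 <= A.
  by rewrite /A /ode_err !addr_ge0 ?divr_ge0 ?mulr_ge0 ?exprn_ge0 ?sqrtr_ge0 // ltW.
have h : `|g x * F x + - c| <= A / v * (g x + - 1).
  apply: (@norm_le_of_derive _ (fun t => g t * F t + - c) (fun t => A / v * (g t + - 1))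
   (fun t => g t * (t * v) * F t + g t * dF t) (fun t => A / v * (g t * (t * v)))) => //.
  - move=> t; rewrite -[X in hasd _ X]addr0; apply: hasdD (hasd_cst _ t); exact: hasdM.
  - move=> t; apply: hasd_eq (hasdM (hasd_cst _ t) (hasdD (hg t) (hasd_cst _ t))) _; by ring.
  - by rewrite F0 g1 mul1r !subrr mulr0 normr0.
  - move=> t /andP[t0 tx].
    rewrite (_ : _ + _ = g t * (dF t + t * v * F t)); last by ring.
    rewrite (_ : A / v * _ = g t * (t * A)); last by field; rewrite gt_eqF.
    rewrite normrM (ger0_norm (ltW (g0 t))) ler_pM2l //.
    apply: (le_trans (eF t (ltW t0))).
    rewrite (_ : _ + _ = t * (K * (t * `|Z t|) + t ^+ 2 * M)); last by ring.
    rewrite ler_pM2l //.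
    have hz : t * `|Z t| <= t * (h1 t + 2 * (t ^+ 2 * M / v)).
      by rewrite ler_pM2l //; apply: ode_bound => //; apply: ltW.
    have h2 := th1 (ltW t0).
    have t3 : t ^+ 3 <= x ^+ 3 by rewrite lerXn2r // ?nnegrE // ltW.
    have t2 : t ^+ 2 <= x ^+ 2 by rewrite lerXn2r // ?nnegrE // ltW.
    have h3 : t ^+ 3 * (M / v) <= x ^+ 3 * (M / v) by rewrite ler_wpM2r // divr_ge0 // ltW.
    have h4 : t * `|Z t| <= 2 / Num.sqrt v + 2 * (x ^+ 3 * (M / v)).
      apply: (le_trans hz); rewrite mulrDr; apply: lerD => //.
      rewrite (_ : t * _ = 2 * (t ^+ 3 * (M / v))); last by field; rewrite gt_eqF.
      by rewrite ler_pM2l.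
    have h5 := ler_wpM2l K0 h4; have h6 := ler_wpM2r M0 t2.
    apply: le_trans (lerD h5 h6) _; rewrite /A /ode_err.
    by rewrite le_eqVlt; apply/orP; left; apply/eqP; ring.
have -> : F x - c * expR (- (x ^+ 2 * (v / 2))) = (g x)^-1 * (g x * F x + - c).
  by rewrite expRN -/(g x); field; rewrite gt_eqF.
rewrite normrM ger0_norm ?invr_ge0 ?(ltW (g0 x)) // mulrC ler_pdivrMr //.
apply: (le_trans h); have : 0 <= A / v by rewrite divr_ge0 // ltW.
nra.
Qed.

Lemma ode_cos x : 0 <= x ->
  `|C x - expR (- (x ^+ 2 * (v / 2)))| <= ode_err x / v.
Proof.
move=> x0; rewrite -[expR _]mul1r; apply: (gapprox (Z := S) x0 hC C0).
- move=> t t0; rewrite (_ : _ + _ = (dC t + t * v * C t - t ^+ 2 * kappa * S t) + t ^+ 2 * kappa * S t); last by ring.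
  apply: (le_trans (ler_normD _ _)); rewrite addrC; apply: lerD (eC t0).
  by rewrite 2!normrM ler_wpM2r // (ger0_norm (exprn_ge0 _ t0)) ler_wpM2l ?exprn_ge0.
- by move=> t; rewrite lerDr sqr_ge0.
Qed.

Lemma ode_sin x : 0 <= x -> `|S x| <= ode_err x / v.
Proof.
move=> x0; have -> : S x = S x - 0 * expR (- (x ^+ 2 * (v / 2))) by rewrite mul0r subr0.
apply: (gapprox (Z := C) x0 hS S0).
- move=> t t0; rewrite (_ : _ + _ = (dS t + t * v * S t + t ^+ 2 * kappa * C t) - t ^+ 2 * kappa * C t); last by ring.
  apply: (le_trans (ler_normB _ _)); rewrite addrC; apply: lerD (eS t0).
  by rewrite 2!normrM ler_wpM2r // (ger0_norm (exprn_ge0 _ t0)) ler_wpM2l ?exprn_ge0.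
- by move=> t; rewrite lerDl sqr_ge0.
Qed.

End ode.

(** * Fourier transform of the Gaussian *)

Section gauss_fourier.
Local Open Scope classical_set_scope.
Context {R : realType}.
Implicit Types x y t : R.
Let mu := @lebesgue_measure R.

Definition gcos x t : R := expR (- t ^+ 2) * cos (t * x).

Lemma continuous_gcos x : continuous (gcos x).
Proof.
apply: (@hasd_cont _ _ (fun t => expR (- t ^+ 2) * (- (2 * t ^+ 1 * 1)) * cos (t * x)
  + expR (- t ^+ 2) * (- sin (t * x) * (1 * x + t * 0)))) => t.
apply: hasdM; first exact: (hasd_exp (hasdN (hasdX 1 (hasd_id t)))).
exact: (hasd_cos (hasdM (hasd_id t) (hasd_cst x t))).
Qed.

Lemma integrable_gcos x : mu.-integrable [set: R] (EFin \o gcos x).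
Proof.
apply: (le_integrable _ _ _ (@integrableT_gauss R)) => //.
- apply/measurable_EFinP; apply: continuous_measurable_fun; exact: continuous_gcos.
- move=> t _ /=; rewrite lee_fin /gcos /gauss_fun normrM ler_piMr //.
  by rewrite ler_norml cos_geN1 cos_le1.
Qed.

Let F x y := (\int[mu]_(t in `]-oo, y]) gcos x t)%R.

(** This is $\int_0^y e^{-t^2}\cos(tx)\,dt$, taken as a difference of improper integrals so that it
    is differentiable at every real [y]. *)
Definition Gcos x y : R := F x y - F x 0.

Lemma Gcos0 x : Gcos x 0 = 0. Proof. exact: subrr. Qed.

Lemma hasd_Gcos x y : hasd (Gcos x) (gcos x y) y.
Proof.
rewrite -[gcos x y]addr0; apply: (hasdD (f := F x)) (hasd_cst _ y).
have [| | | |dF <-] := @continuous_FTC1 R (gcos x) -oo%O y (y + 1).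
- by rewrite ltrDl.
- by apply: integrableS (integrable_gcos x).
- by rewrite /= ltNyr.
- exact: continuous_gcos.
by rewrite derive1E; apply: derivableP.
Qed.


Lemma gcosN x : gcos (- x) = gcos x.
Proof. by apply/funext => t; rewrite /gcos mulrN cosN. Qed.

Lemma GcosN x y : Gcos (- x) y = Gcos x y.
Proof. by rewrite /Gcos /F gcosN. Qed.

(** The derivative in [x], namely $-\int_0^T te^{-t^2}\sin(tx)\,dt$, after integration by parts. *)
Let dGx T x := expR (- T ^+ 2) * sin (T * x) / 2 - x / 2 * Gcos x T.

(** Differentiation under the integral sign with an explicit remainder: both sides vanish at
    [T = 0], and their derivatives in [T] are compared by [cos_taylor2]. *)
Let Gcos_incr T x h : 0 <= T -> 0 <= h ->
  `|Gcos (x + h) T - Gcos x T - h * dGx T x| <= h ^+ 2 * T ^+ 3 / 6.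
Proof.
move=> T0 h0.
apply: (@norm_le_of_derive _
  (fun t => Gcos (x + h) t + - Gcos x t + - (h * (expR (- t ^+ 2) * sin (t * x) * 2^-1 + - (x / 2 * Gcos x t))))
  (fun t => h ^+ 2 * t ^+ 3 * 6^-1)
  (fun t => expR (- t ^+ 2) * (cos (t * x + t * h) - cos (t * x) - (t * h) * cos (t * x + pi / 2)))
  (fun t => h ^+ 2 * t ^+ 2 / 2)) => //.
- move=> t; apply: (hasd_eq (hasdD (hasdD (hasd_Gcos (x + h) t) (hasdN (hasd_Gcos x t)))
    (hasdN (hasdM (hasd_cst h t) (hasdD (hasdM (hasdM (hasd_exp (hasdN (hasdX 1 (hasd_id t))))
       (hasd_sin (hasdM (hasd_id t) (hasd_cst x t)))) (hasd_cst 2^-1 t))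
      (hasdN (hasdM (hasd_cst (x / 2) t) (hasd_Gcos x t)))))))).
  by rewrite /gcos cosDpihalf mulrDr; field.
- move=> t; apply: (hasd_eq (hasdM (hasdM (hasd_cst (h ^+ 2) t) (hasdX 2 (hasd_id t))) (hasd_cst 6^-1 t))).
  by field.
- by rewrite !Gcos0 mul0r sin0 !expr0n /= !(mulr0, mul0r, subr0, addr0, oppr0) normr0.
- move=> t /andP[t0 _].
  have th0 : 0 <= t * h by rewrite mulr_ge0 // ltW.
  rewrite normrM ger0_norm ?expR_ge0 //.
  apply: (@le_trans _ _ (1 * ((t * h) ^+ 2 / 2))); last by rewrite le_eqVlt; apply/orP; left; apply/eqP; ring.
  apply: ler_pM; rewrite ?expR_ge0 ?normr_ge0 //.
    by rewrite -expR0 ler_expR oppr_le0 sqr_ge0.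
  exact: cos_taylor2.
Qed.

Lemma hasd_Gcos_param T x : 0 <= T -> hasd (Gcos ^~ T) (dGx T x) x.
Proof.
move=> T0.
have bnd h : `|Gcos (x + h) T - Gcos x T - h * dGx T x| <= h ^+ 2 * (T ^+ 3 / 6).
  case: (leP 0 h) => [h0|h0]; first by rewrite mulrA; apply: Gcos_incr.
  have hN0 : 0 <= - h by rewrite oppr_ge0 ltW.
  rewrite -[x + h]opprK GcosN -(GcosN x) (_ : - (x + h) = - x + - h); last by ring.
  rewrite (_ : h * dGx T x = - h * dGx T (- x)); last first.
    by rewrite /dGx mulrN sinN GcosN; ring.
  by have := Gcos_incr (- x) T0 hN0; rewrite sqrrN -mulrA.
suff H : (fun h => h^-1 *: (Gcos (h *: (1 : R) + x) T - Gcos x T)) h @[h --> 0^'] --> dGx T x.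
  split; first by apply/cvg_ex; exists (dGx T x).
  by apply/cvg_lim.
apply/cvgrPdist_le => e e0.
near=> h.
have h0 : h != 0 by near: h; exact: nbhs_dnbhs_neq.
have -> : dGx T x - h^-1 *: (Gcos (h%:A + x) T - Gcos x T) =
    - (h^-1 * (Gcos (x + h) T - Gcos x T - h * dGx T x)).
  rewrite (_ : h%:A + x = x + h); last by rewrite addrC; congr (_ + _); exact: mulr1.
  by rewrite /GRing.scale /=; field.
rewrite normrN normrM normfV; apply: (@le_trans _ _ (`|h|^-1 * (h ^+ 2 * (T ^+ 3 / 6)))).
  by rewrite ler_wpM2l // invr_ge0.
rewrite (_ : _ * _ = `|h| * (T ^+ 3 / 6)); last first.
  by rewrite -(real_normK (num_real h)); field; rewrite normr_eq0.
have T6 : 0 <= T ^+ 3 / 6 by rewrite divr_ge0 ?exprn_ge0.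
apply: (@le_trans _ _ (`|h| * (T ^+ 3 / 6 + 1))); first by rewrite ler_wpM2l // lerDl.
have T61 : 0 < T ^+ 3 / 6 + 1 by rewrite ltr_wpDl.
rewrite -ler_pdivlMr //.
near: h; apply: dnbhs0_le.
by rewrite divr_gt0 // ltr_wpDl // divr_ge0 ?exprn_ge0.
Unshelve. all: by end_near. Qed.

Let mulexp4 x : x * expR (- (x ^+ 2 / 4)) <= 2.
Proof.
rewrite expRN ler_pdivrMr ?expR_gt0 //.
have := expR_ge1Dx (x ^+ 2 / 4); have : 0 <= (x - 2) ^+ 2 by rewrite sqr_ge0.
nra.
Qed.

(** As a function of [x], [Gcos x T] solves $G'=-\frac x2G$ up to a boundary term of size at most
    $e^{-T^2}/2$, so that $e^{x^2/4}G$ is nearly constant. *)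
Lemma Gcos_gauss x T : 0 <= T ->
  `|Gcos x T - expR (- (x ^+ 2 / 4)) * Gcos 0 T| <= (1 + 2 * expR 1) * expR (- T ^+ 2).
Proof.
move=> T0; wlog x0 : x / 0 <= x.
  move=> H; case: (leP 0 x) => [|x0]; first exact: H.
  by rewrite -GcosN -sqrrN; apply: H; rewrite oppr_ge0 ltW.
pose g x := expR (x ^+ 2 * 4^-1).
have hg t : hasd g (g t * (t / 2)) t.
  apply: hasd_eq (hasd_exp (hasdM (hasdX 1 (hasd_id t)) (hasd_cst _ t))) _.
  by rewrite /g; congr (_ * _); field.
have g0 t : 0 < g t by exact: expR_gt0.
have e0 : 0 <= expR (- T ^+ 2) by exact: expR_ge0.
have h : `|g x * Gcos x T + - Gcos 0 T| <= expR (- T ^+ 2) * (g x + expR 1 * x).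
  apply: (@norm_le_of_derive _ (fun t => g t * Gcos t T + - Gcos 0 T)
     (fun t => expR (- T ^+ 2) * (g t + expR 1 * t))
     (fun t => g t * (expR (- T ^+ 2) * sin (T * t) / 2))
     (fun t => expR (- T ^+ 2) * (g t * (t / 2) + expR 1))) => //.
  - move=> t; apply: hasd_eq (hasdD (hasdM (hg t) (hasd_Gcos_param t T0)) (hasd_cst _ t)) _.
    by rewrite /dGx; field.
  - move=> t; apply: hasd_eq (hasdM (hasd_cst _ t) (hasdD (hg t) (hasdM (hasd_cst _ t) (hasd_id t)))) _.
    by ring.
  - by rewrite /g expr0n /= mul0r expR0 mul1r subrr normr0 mulr0 addr0 mulr1.
  - move=> t /andP[t0 _].
    rewrite (_ : g t * _ = expR (- T ^+ 2) * (g t * (sin (T * t) / 2))); last by ring.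
    rewrite normrM ger0_norm // ler_wpM2l // normrM (ger0_norm (ltW (g0 t))).
    have hs : `|sin (T * t) / 2| <= 2^-1.
      rewrite normrM [X in _ * X]ger0_norm ?invr_ge0 // ler_piMl ?invr_ge0 //.
      by rewrite ler_norml sin_geN1 sin_le1.
    apply: (@le_trans _ _ (g t * 2^-1)); first by rewrite ler_wpM2l // ltW.
    (* The majorant is built for two ranges: $g(t)\le t\,g(t)$ for $t\ge1$, and $g(t)\le e$ for
       $t<1$. *)
    case: (leP 1 t) => t1.
      have : 0 <= g t * (t - 1) by rewrite mulr_ge0 ?subr_ge0 // ltW.
      have := expR_ge0 (1 : R); lra.
    have ge : g t <= expR 1 by rewrite ler_expR; nra.
    have : 0 <= g t * (t / 2) by rewrite mulr_ge0 ?divr_ge0 // ltW.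
    have := expR_ge0 (1 : R); lra.
have gN : expR (- (x ^+ 2 / 4)) = (g x)^-1 by rewrite expRN.
have := mulexp4 x; rewrite gN => hx.
rewrite (_ : _ - _ = (g x)^-1 * (g x * Gcos x T + - Gcos 0 T)); last first.
  by field; rewrite gt_eqF.
rewrite normrM ger0_norm ?invr_ge0 ?(ltW (g0 x)) //.
apply: (le_trans (ler_wpM2l _ h)); first by rewrite invr_ge0 ltW.
rewrite [leLHS](_ : _ = (1 + expR 1 * (x * (g x)^-1)) * expR (- T ^+ 2)); last first.
  by field; rewrite gt_eqF.
rewrite ler_wpM2r // lerD2l [2 * _]mulrC ler_wpM2l ?expR_ge0 //.
Qed.

Let G0E t : gcos 0 t = expR (- t ^+ 2).
Proof. by rewrite /gcos mulr0 cos0 mulr1. Qed.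

Let G0_homo : {homo (Gcos 0) : x y / x <= y}.
Proof.
move=> a b ab; rewrite -(subrK a b).
apply: (@le_of_derive _ (fun=> Gcos 0 a) (fun t => Gcos 0 (t + a)) (fun=> 0) (fun t => gcos 0 (t + a) * (1 + 0))).
- by move=> t; apply: hasd_cst.
- by move=> t; apply: hasd_comp (hasd_Gcos _ _) (hasdD (hasd_id t) (hasd_cst a t)).
- by rewrite add0r.
- by rewrite subr_ge0.
- by move=> t _; rewrite addr0 mulr1 G0E expR_ge0.
Qed.

(** On $t\ge1$ the integrand $e^{-t^2}$ is at most $te^{-t^2}$, which is the derivative of
    $-e^{-t^2}/2$. *)
Let G0_tail a b : 1 <= a -> a <= b -> Gcos 0 b <= Gcos 0 a + expR (- a ^+ 2) / 2.
Proof.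
move=> a1 ab; rewrite -(subrK a b).
suff : Gcos 0 (b - a + a) + expR (- (b - a + a) ^+ 2) * 2^-1 <= Gcos 0 a + expR (- a ^+ 2) / 2.
  by have := expR_ge0 (- (b - a + a) ^+ 2); lra.
apply: (@le_of_derive _ (fun t => Gcos 0 (t + a) + expR (- (t + a) ^+ 2) * 2^-1) (fun=> Gcos 0 a + expR (- a ^+ 2) / 2)
   (fun t => gcos 0 (t + a) - expR (- (t + a) ^+ 2) * (t + a)) (fun=> 0)).
- move=> t; apply: hasd_eq (hasdD (hasd_comp (hasd_Gcos _ _) (hasdD (hasd_id t) (hasd_cst a t))) (hasdM (hasd_exp (hasdN (hasdX 1 (hasdD (hasd_id t) (hasd_cst a t))))) (hasd_cst _ t))) _.
  by field.
- by move=> t; apply: hasd_cst.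
- by rewrite add0r.
- by rewrite subr_ge0.
- move=> t /andP[t0 _]; rewrite G0E subr_le0 ler_peMr ?expR_ge0 //; lra.
Qed.

Lemma Gcos0_lim T : 1 <= T ->
  Gcos 0 T <= Num.sqrt pi / 2 <= Gcos 0 T + expR (- T ^+ 2) / 2.
Proof.
move=> T1.
have ub : has_ubound (range (Gcos 0)).
  exists (Gcos 0 1 + expR (- 1 ^+ 2) / 2) => _ [t _ <-].
  case: (leP 1 t) => t1; first exact: G0_tail.
  have := G0_homo (ltW t1); have := expR_ge0 (- 1 ^+ 2 : R); lra.
have cv := nondecreasing_cvgr G0_homo ub.
set l := sup _ in cv.
have lE : l = Num.sqrt pi / 2.
  have := @ge0_continuous_FTC2y R (gcos 0) (Gcos 0) 0 l _ _ cv _ _ _.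
  rewrite Gcos0 sube0 (_ : (fun x => (gcos 0 x)%:E) = (fun x => (gauss_fun x)%:E)); last first.
    by apply/funext => x; rewrite G0E.
  rewrite integral0y_gauss => h; apply/esym; apply: EFin_inj; apply: h.
  - by move=> x _; rewrite G0E expR_ge0.
  - exact/continuous_subspaceT/continuous_gcos.
  - by move=> x _; case: (hasd_Gcos 0 x).
  - apply: cvg_at_right_filter; have := @hasd_cont _ _ _ (hasd_Gcos 0) 0.
    by rewrite /continuous_at Gcos0.
  - by move=> x _; rewrite derive1E; case: (hasd_Gcos 0 x).
rewrite -lE; apply/andP; split.
  by apply: ub_le_sup => //; exists T.
apply: ge_sup; first by exists (Gcos 0 0), 0.
move=> _ [t _ <-]; case: (leP T t) => tT; first exact: G0_tail.
have := G0_homo (ltW tT); have := expR_ge0 (- T ^+ 2); lra.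
Qed.

Lemma Gcos_lim x T : 1 <= T ->
  `|Gcos x T - Num.sqrt pi / 2 * expR (- (x ^+ 2 / 4))| <= (2 + 2 * expR 1) * expR (- T ^+ 2).
Proof.
move=> T1.
have h1 := Gcos_gauss x (le_trans ler01 T1); have /andP[h2 h3] := Gcos0_lim T1.
have e1 : 0 <= expR (- (x ^+ 2 / 4)) <= 1.
  by rewrite expR_ge0 /= -expR0 ler_expR oppr_le0 divr_ge0 // sqr_ge0.
have e2 := expR_ge0 (- T ^+ 2).
move: h1; rewrite !ler_norml; move: (expR (- (x ^+ 2 / 4))) e1 => e /andP[e0 e1].
have h4 : 0 <= e * (Num.sqrt pi / 2 - Gcos 0 T) by rewrite mulr_ge0 // subr_ge0.
have h5 : e * (Num.sqrt pi / 2 - Gcos 0 T) <= 1 * (expR (- T ^+ 2) / 2).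
  by apply: ler_pM => //; rewrite ?subr_ge0 //; lra.
lra.
Qed.

End gauss_fourier.

(** * Fourier inversion for integer-valued variables *)

Section inversion.
Context {R : realType} (I : finType) (p : R) (N : {set I} -> nat).
Local Notation E := (@Ex R I p).

Lemma hasd_Ex (f : {set I} -> R -> R) (df : {set I} -> R) (t : R) :
  (forall G, hasd (f G) (df G) t) -> hasd (fun x => E (fun G => f G x)) (E df) t.
Proof.
move=> fd; apply: hasd_sum => G.
by apply: hasd_eq (hasdM (hasd_cst _ t) (fd G)) _; rewrite mul0r add0r.
Qed.

Lemma sin_natpi (n : nat) : sin (pi * n%:R) = 0 :> R.
Proof.
elim: n => [|n IH]; first by rewrite mulr0 sin0.
by rewrite -natr1 mulrDr mulr1 sinDpi IH oppr0.
Qed.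

Definition cosE (mu : R) t := E (fun G => cos (t * ((N G)%:R - mu))).
Definition sinE (mu : R) t := E (fun G => sin (t * ((N G)%:R - mu))).

(** The primitive, vanishing at 0, of the mean of $\cos(t(N-k))$. As $N-k$ is an integer, at [pi]
    only the event $N=k$ contributes. *)
Definition primE (k : nat) t : R :=
  E (fun G => if N G == k then t else sin (t * ((N G)%:R - k%:R)) / ((N G)%:R - k%:R)).

Lemma primE0 k : primE k 0 = 0.
Proof.
rewrite /primE -[RHS](Ex_cst I p 0); apply: eq_Ex => G.
by case: ifP => // _; rewrite mul0r sin0 mul0r.
Qed.

Lemma primE_pi k : primE k pi = pi * E (fun G => (N G == k)%:R).
Proof.
rewrite /primE -ExZ; apply: eq_Ex => G; case: ifPn => [_|nk]; first by rewrite mulr1.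
rewrite mulr0; case: (leqP k (N G)) => kN.
  by rewrite -natrB // sin_natpi mul0r.
by rewrite -opprB mulrN sinN -natrB ?(ltnW kN) // sin_natpi oppr0 mul0r.
Qed.

Lemma hasd_primE k mu t : hasd (primE k)
  (cosE mu t * cos (t * (k%:R - mu)) + sinE mu t * sin (t * (k%:R - mu))) t.
Proof.
rewrite /cosE /sinE -!ExZr -ExD; apply: hasd_Ex => G; rewrite -cosB -mulrBr.
have [<-|nk] := eqVneq (N G) k.
  by rewrite subrr mulr0 cos0; exact: hasd_id.
have d0 : (N G)%:R - k%:R != 0 :> R by rewrite subr_eq0 eqr_nat.
apply: hasd_eq (hasdM (hasd_sin (hasdM (hasd_id t) (hasd_cst _ t))) (hasd_cst _ t)) _.
rewrite (_ : (N G)%:R - mu - (k%:R - mu) = (N G)%:R - k%:R); last by ring.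
by field.
Qed.

(* [field] unfolds the library's [pi], hence the abstract constant [c]. *)
Let aux1 (r q s c e P : R) : r ^+ 2 = 2 -> q ^+ 2 = c ->
  r != 0 -> q != 0 -> s != 0 -> c != 0 ->
  (r * q)^-1 * e - s * P = - (s / c * (c * P - r / s * (q / 2 * e))).
Proof.
move=> rv qv rn qn sn cn.
transitivity ((r * q)^-1 * e * ((r ^+ 2 / 2) * (q ^+ 2 / c)) - s * P).
  by rewrite rv qv !divff ?mulr1.
by field; rewrite ?rn ?qn ?sn ?cn.
Qed.

Let aux2 (r s c w : R) : s != 0 -> c != 0 -> s / c * (r / s * w) = (r / c) * w.
Proof. by move=> sn cn; field; rewrite ?sn ?cn. Qed.

(** The integrand is even, so $[0,\pi]$ suffices. Up to [th1] the primitive stays close to its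
    Gaussian counterpart, which by [Gcos_lim] has almost reached the full Gaussian integral there;
    beyond [th1] it moves by at most [B] times the length. *)
Lemma fourier_inversion (k : nat) (mu v A B th1 : R) :
  0 < v -> 0 <= A -> 0 <= B -> 0 <= th1 <= pi -> 1 <= th1 ^+ 2 * (v / 2) ->
  (forall t, 0 <= t <= th1 ->
    `|cosE mu t - expR (- (t ^+ 2 * (v / 2)))| <= A /\ `|sinE mu t| <= A) ->
  (forall t, th1 <= t <= pi -> cosE mu t ^+ 2 + sinE mu t ^+ 2 <= B ^+ 2) ->
  forall x, x = (k%:R - mu) / Num.sqrt v ->
  `|(Num.sqrt (2 * pi))^-1 * expR (- x ^+ 2 / 2) - Num.sqrt v * E (fun G => (N G == k)%:R)|
  <= Num.sqrt v * (A * th1 + 2 * B) + (2 + 2 * expR 1) * expR (- (th1 ^+ 2 * (v / 2))).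
Proof.
move=> v0 A0 B0 /andP[t10 t1pi] T1 hA hB.
have pi2 : 2 <= pi :> R := pi_ge2 R; have pi4 : pi <= 4 :> R by have := pihalf_lt2 R; lra.
have s0 : 0 < Num.sqrt v by rewrite sqrtr_gt0.
have sv : Num.sqrt v ^+ 2 = v by rewrite sqr_sqrtr // ltW.
set s := Num.sqrt v in s0 sv *.
have r0 : 0 < Num.sqrt 2 :> R by rewrite sqrtr_gt0.
have rv : Num.sqrt 2 ^+ 2 = 2 :> R by rewrite sqr_sqrtr.
pose r := Num.sqrt 2 : R; rewrite -/r in r0 rv.
pose y : R := k%:R - mu; rewrite -/y => x xE.
(* The Gaussian primitive, after the substitution $t\mapsto t\sqrt{v/2}$. *)
pose K t := r / s * Gcos (y * (r / s)) (t * (s / r)).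
have hK t : hasd K (expR (- (t ^+ 2 * (v / 2))) * cos (t * y)) t.
  apply: hasd_eq (hasdM (hasd_cst _ t) (hasd_comp (hasd_Gcos _ _) (hasdM (hasd_id t) (hasd_cst _ t)))) _.
  rewrite /gcos (_ : t * (s / r) * _ = t * y); last by field; rewrite !gt_eqF.
  rewrite (_ : (t * (s / r)) ^+ 2 = t ^+ 2 * (v / 2)); last by rewrite -sv -rv; field; rewrite gt_eqF.
  by field; rewrite !gt_eqF.
have K0 : K 0 = 0 by rewrite /K mul0r Gcos0 mulr0.
pose dH t := cosE mu t * cos (t * y) + sinE mu t * sin (t * y).
have hH t : hasd (primE k) (dH t) t by exact: hasd_primE.
have b1 : `|primE k th1 + - K th1| <= 2 * A * th1.
  apply: (@norm_le_of_derive _ (fun t => primE k t + - K t) (fun t => 2 * A * t)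
    (fun t => dH t + - (expR (- (t ^+ 2 * (v / 2))) * cos (t * y))) (fun=> 2 * A)) => //.
  - by move=> t; exact: hasdD (hH t) (hasdN (hK t)).
  - move=> t; apply: hasd_eq (hasdM (hasd_cst _ t) (hasd_id t)) _; by ring.
  - by rewrite primE0 K0 subrr normr0 mulr0.
  - move=> t /andP[t0 tt1]; rewrite /dH.
    have /hA[h1 h2] : 0 <= t <= th1 by rewrite !ltW.
    rewrite (_ : _ + _ = (cosE mu t - expR (- (t ^+ 2 * (v / 2)))) * cos (t * y) + sinE mu t * sin (t * y)); last by ring.
    apply: (le_trans (ler_normD _ _)); rewrite (_ : 2 * A = A + A) ?normrM; last by ring.
    have c1 : `|cos (t * y)| <= 1 by rewrite ler_norml cos_geN1 cos_le1.
    have s1 : `|sin (t * y)| <= 1 by rewrite ler_norml sin_geN1 sin_le1.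
    by apply: lerD; rewrite -[leRHS]mulr1; apply: ler_pM.
have b2 : `|primE k pi + - primE k th1| <= B * (pi - th1).
  have := @norm_le_of_derive _ (fun t => primE k (t + th1) + - primE k th1) (fun t => B * t)
    (fun t => dH (t + th1)) (fun=> B) (pi - th1).
  rewrite subrK; apply.
  - move=> t; apply: hasd_eq (hasdD (hasd_comp (hH _) (hasdD (hasd_id t) (hasd_cst th1 t))) (hasd_cst _ t)) _.
    by ring.
  - move=> t; apply: hasd_eq (hasdM (hasd_cst _ t) (hasd_id t)) _; by ring.
  - by rewrite add0r subrr normr0 mulr0.
  - by rewrite subr_ge0.
  - move=> t /andP[t0 tt1].
    have h1 : cosE mu (t + th1) ^+ 2 + sinE mu (t + th1) ^+ 2 <= B ^+ 2 by apply: hB; lra.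
    rewrite -(@ler_pXn2r _ 2%N) ?nnegrE // real_normK ?num_real //.
    apply: le_trans h1; rewrite /dH.
    move: (cosE mu _) (sinE mu _) => c d.
    have := cos2Dsin2 ((t + th1) * y).
    move: (cos _) (sin _) => a b ab.
    have : 0 <= (c * b - d * a) ^+ 2 by rewrite sqr_ge0.
    have -> : c ^+ 2 + d ^+ 2 = (a ^+ 2 + b ^+ 2) * (c ^+ 2 + d ^+ 2) by rewrite ab mul1r.
    lra.
have sp : Num.sqrt (2 * pi) = r * Num.sqrt pi :> R by rewrite sqrtrM.
have q0 : 0 < Num.sqrt pi :> R by rewrite sqrtr_gt0 pi_gt0.
have qv : Num.sqrt pi ^+ 2 = pi :> R by rewrite sqr_sqrtr // pi_ge0.
rewrite sp; set q := Num.sqrt pi in q0 qv *.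
have T2 : (th1 * (s / r)) ^+ 2 = th1 ^+ 2 * (v / 2).
  by rewrite -sv -rv; field; rewrite gt_eqF.
have T1' : 1 <= th1 * (s / r).
  have : 1 ^+ 2 <= (th1 * (s / r)) ^+ 2 by rewrite expr1n T2.
  have tsr0 : 0 <= th1 * (s / r) by rewrite mulr_ge0 // divr_ge0 // ltW.
  by rewrite ler_pXn2r // nnegrE.
have b3 := Gcos_lim (y * (r / s)) T1'.
rewrite T2 (_ : - ((y * (r / s)) ^+ 2 / 4) = - x ^+ 2 / 2) in b3; last first.
  rewrite xE; transitivity (- (y ^+ 2 * r ^+ 2 / s ^+ 2 / 4)); first by field; rewrite gt_eqF.
  by rewrite rv; field; rewrite gt_eqF.
rewrite -/q in b3.
set P := E _; set e := expR (- x ^+ 2 / 2) in b3 *; set g := expR (- _) in b3 *.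
have hP : primE k pi = pi * P by exact: primE_pi.
have b3' : `|K th1 - r / s * (q / 2 * e)| <= r / s * ((2 + 2 * expR 1) * g).
  rewrite /K -mulrBr normrM gtr0_norm ?divr_gt0 // ler_wpM2l // ltW // divr_gt0 //.
have b4 : `|pi * P - r / s * (q / 2 * e)| <= 2 * A * th1 + B * (pi - th1) + r / s * ((2 + 2 * expR 1) * g).
  rewrite -hP (_ : _ - _ = (primE k th1 + - K th1) + (primE k pi + - primE k th1) + (K th1 - r / s * (q / 2 * e))); last by ring.
  apply: (le_trans (ler_normD _ _)); apply: lerD => //.
  by apply: (le_trans (ler_normD _ _)); apply: lerD.
have [rn qn sn pn] : [/\ r != 0, q != 0, s != 0 & pi != 0 :> R].
  by split; rewrite gt_eqF // pi_gt0.
have -> : (r * q)^-1 * e - s * P = - (s / pi * (pi * P - r / s * (q / 2 * e))).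
  exact: aux1.
rewrite normrN normrM gtr0_norm ?divr_gt0 ?pi_gt0 //.
apply: (le_trans (ler_wpM2l _ b4)); first by rewrite ltW // divr_gt0 ?pi_gt0.
have e1 : 0 < expR 1 :> R := expR_gt0 1.
have g0 : 0 < g := expR_gt0 _.
rewrite [s / pi * _]mulrDr; apply: lerD.
  rewrite -mulrA ler_pM2l // ler_pdivrMl ?pi_gt0 //.
  have := mulr_ge0 A0 t10; have := mulr_ge0 B0 t10; have hBp : B * 2 <= B * pi by rewrite ler_wpM2l.
  have : A * th1 * 2 <= A * th1 * pi by rewrite ler_wpM2l // mulr_ge0.
  have : 0 <= B * pi by rewrite mulr_ge0 // pi_ge0.
  lra.
rewrite aux2 //.
rewrite -[leRHS]mul1r ler_wpM2r //; first by rewrite mulr_ge0 ?addr_ge0 ?mulr_ge0 // ltW.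
rewrite ler_pdivrMr ?pi_gt0 // mul1r; apply: le_trans pi2.
by rewrite -(@ler_pXn2r _ 2%N) ?nnegrE // ?ltW // rv; lra.
Qed.

End inversion.

(** * Independence, decoupling and concentration *)

Section independence.
Context {R : realType} (I : finType) (p : R).
Hypothesis p01 : 0 <= p <= 1.
Implicit Types (A G H : {set I}) (e : I).
Local Notation E := (@Ex R I p).
Local Notation E2 f := (E (fun G => E (fun G' => f G G'))).

Lemma Ex_indep A (f h : {set I} -> R) :
  (forall G H, f (mix A G H) = f G) -> (forall G H, h (mix A G H) = h H) ->
  E (fun G => f G * h G) = E f * E h.
Proof.
move=> fA hA; rewrite -(Ex_mix p A) -ExZr; apply: eq_Ex => G.
by rewrite -ExZ; apply: eq_Ex => H; rewrite fA hA.
Qed.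

Lemma Ex2_indep A (f h : {set I} -> {set I} -> R) :
  (forall G G' H H', f (mix A G H) (mix A G' H') = f G G') ->
  (forall G G' H H', h (mix A G H) (mix A G' H') = h H H') ->
  E2 (fun G G' => f G G' * h G G') = E2 f * E2 h.
Proof.
move=> fA hA.
transitivity (E (fun G => E (fun H => E (fun G' => E (fun H' =>
    f (mix A G H) (mix A G' H') * h (mix A G H) (mix A G' H')))))).
  rewrite -(Ex_mix p A); apply: eq_Ex => G; apply: eq_Ex => H.
  by rewrite -(Ex_mix p A).
rewrite -ExZr; apply: eq_Ex => G; rewrite -ExZ; apply: eq_Ex => H.
rewrite -ExZr; apply: eq_Ex => G'; rewrite -ExZ; apply: eq_Ex => H'.
by rewrite fA hA.
Qed.

Lemma Ex2_prod_le (J : eqType) (s : seq J) (A : J -> {set I})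
    (h : J -> {set I} -> {set I} -> R) (r : R) :
  uniq s -> {in s &, forall i j, i != j -> [disjoint A i & A j]} ->
  (forall j G G', 0 <= h j G G') ->
  (forall j G G' H H', (forall e, e \in A j -> (e \in G) = (e \in H)) ->
     (forall e, e \in A j -> (e \in G') = (e \in H')) -> h j G G' = h j H H') ->
  (forall j, j \in s -> E2 (h j) <= r) ->
  E2 (fun G G' => \prod_(j <- s) h j G G') <= r ^+ size s.
Proof.
move=> us dA h0 hA hr.
have r0 j : j \in s -> 0 <= r.
  by move=> /hr; apply: le_trans; apply: Ex_ge0 => // G; apply: Ex_ge0.
elim: s us dA hr r0 => [|a s IH] /=.
  move=> _ _ _ _; rewrite expr0 (_ : E _ = 1) // -[RHS](Ex_cst I p 1).
  by apply: eq_Ex => G; rewrite -[RHS](Ex_cst I p 1); apply: eq_Ex => G'; rewrite big_nil.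
move=> /andP[nas us] dA hr r0.
have -> : E2 (fun G G' => \prod_(j <- a :: s) h j G G') =
    E2 (fun G G' => h a G G' * \prod_(j <- s) h j G G').
  by apply: eq_Ex => G; apply: eq_Ex => G'; rewrite big_cons.
rewrite (@Ex2_indep (A a)); first last.
- move=> G G' H H'; apply: eq_big_seq => j js; apply: hA => e ej.
  + have jna : j != a by apply: contraNneq nas => <-.
    have ea : (e \in A a) = false.
      by apply: disjointFr ej; apply: dA => //; rewrite inE ?js ?eqxx ?orbT.
    by rewrite in_mix ea.
  + have jna : j != a by apply: contraNneq nas => <-.
    have ea : (e \in A a) = false.
      by apply: disjointFr ej; apply: dA => //; rewrite inE ?js ?eqxx ?orbT.
    by rewrite in_mix ea.
- by move=> G G' H H'; apply: hA => e ea; rewrite in_mix ea.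
rewrite exprS; apply: ler_pM.
- by apply: Ex_ge0 => // G; apply: Ex_ge0.
- by apply: Ex_ge0 => // G; apply: Ex_ge0 => // G'; apply: prodr_ge0.
- by apply: hr; rewrite inE eqxx.
- apply: IH => //.
  + by move=> i j is_ js; apply: dA; rewrite inE ?is_ ?js orbT.
  + by move=> j js; apply: hr; rewrite inE js orbT.
  + by move=> j js; apply: (r0 j); rewrite inE js orbT.
Qed.

Definition lin (s : seq I) (w : I -> R) G : R := \sum_(e <- s) (e \in G)%:R * w e.

(** The squared modulus of the characteristic function is multiplicative over edges, and
    $|1-p+pe^{iw}|^2=1-2p(1-p)(1-\cos w)$. *)
Lemma lin_charfun s w : uniq s ->
  E (fun G => cos (lin s w G)) ^+ 2 + E (fun G => sin (lin s w G)) ^+ 2 =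
  \prod_(e <- s) (1 - 2 * p * (1 - p) * (1 - cos (w e))).
Proof.
elim: s => [|e s IH] /=.
  move=> _; rewrite big_nil.
  have -> : E (fun G => cos (lin [::] w G)) = 1.
    by rewrite -[RHS](Ex_cst I p 1); apply: eq_Ex => G; rewrite /lin big_nil cos0.
  have -> : E (fun G => sin (lin [::] w G)) = 0.
    by rewrite -[RHS](Ex_cst I p 0); apply: eq_Ex => G; rewrite /lin big_nil sin0.
  by rewrite expr1n expr0n addr0.
move=> /andP[nes us]; rewrite big_cons -(IH us).
have linS G : lin (e :: s) w G = (e \in G)%:R * w e + lin s w G by rewrite /lin big_cons.
have fi (f : R -> R) (g : bool -> R) :
   E (fun G => g (e \in G) * f (lin s w G)) = (p * g true + (1 - p) * g false) * E (fun G => f (lin s w G)).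
  rewrite (@Ex_indep [set e]%SET (fun G => g (e \in G)) (fun G => f (lin s w G))).
  - congr (_ * _).
    have := Ex_prod p (fun i b => if i == e then g b else 1).
    rewrite (bigD1 e) //= eqxx big1 ?mulr1 => [<-|i /negbTE ->]; last by rewrite !mulr1 addrC subrK.
    apply: eq_Ex => G; rewrite (bigD1 e) //= eqxx big1 ?mulr1 // => i /negbTE -> //.
  - by move=> G H; rewrite in_mix inE eqxx.
  - move=> G H; congr f; apply: eq_big_seq => i si; rewrite in_mix inE.
    by case: eqP => // ie; move: nes; rewrite -ie si.
have -> : E (fun G => cos (lin (e :: s) w G)) =
   (p * cos (w e) + (1 - p)) * E (fun G => cos (lin s w G)) - p * sin (w e) * E (fun G => sin (lin s w G)).
  transitivity (E (fun G => cos ((e \in G)%:R * w e) * cos (lin s w G)) - E (fun G => sin ((e \in G)%:R * w e) * sin (lin s w G))).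
    by rewrite -ExB; apply: eq_Ex => G; rewrite linS cosD.
  rewrite (fi cos (fun b => cos (b%:R * w e))) (fi sin (fun b => sin (b%:R * w e))).
  by rewrite !mul1r !mul0r cos0 sin0 mulr1 mulr0 addr0.
have -> : E (fun G => sin (lin (e :: s) w G)) =
   p * sin (w e) * E (fun G => cos (lin s w G)) + (p * cos (w e) + (1 - p)) * E (fun G => sin (lin s w G)).
  transitivity (E (fun G => sin ((e \in G)%:R * w e) * cos (lin s w G)) + E (fun G => cos ((e \in G)%:R * w e) * sin (lin s w G))).
    by rewrite -ExD; apply: eq_Ex => G; rewrite linS sinD.
  rewrite (fi cos (fun b => sin (b%:R * w e))) (fi sin (fun b => cos (b%:R * w e))).
  by rewrite !mul1r !mul0r cos0 sin0 mulr1 mulr0 addr0.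
have := cos2Dsin2 (w e); move: (cos (w e)) (sin (w e)) => c d cd.
have -> : 1 - 2 * p * (1 - p) * (1 - c) = (p * c + (1 - p)) ^+ 2 + (p * d) ^+ 2.
  by transitivity ((p * c + (1 - p)) ^+ 2 + p ^+ 2 * (c ^+ 2 + d ^+ 2 - c ^+ 2)); [rewrite cd; ring | ring].
ring.
Qed.

Lemma lin_cos_le s w a : uniq s ->
  E (fun G => cos (a + lin s w G)) <=
  expR (- (p * (1 - p) * \sum_(e <- s) (1 - cos (w e)))).
Proof.
move=> us; set y := p * (1 - p) * _.
have [p0 p1] : 0 <= p /\ p <= 1 by apply/andP.
have pq : 0 <= p * (1 - p) by rewrite mulr_ge0 // subr_ge0.
have pq4 : 4 * (p * (1 - p)) <= 1 by have := sqr_ge0 (1 - 2 * p); nra.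
have h : E (fun G => cos (a + lin s w G)) ^+ 2 <= expR (- y) ^+ 2.
  apply: (@le_trans _ _ (\prod_(e <- s) (1 - 2 * p * (1 - p) * (1 - cos (w e))))).
    rewrite -lin_charfun //.
    have -> : E (fun G => cos (a + lin s w G)) =
        cos a * E (fun G => cos (lin s w G)) - sin a * E (fun G => sin (lin s w G)).
      by rewrite -!ExZ -ExB; apply: eq_Ex => G; rewrite cosD.
    have := cos2Dsin2 a; move: (cos a) (sin a) (E _) (E _) => c d S C cd.
    rewrite -[leRHS]mul1r -cd; have : 0 <= (c * S + d * C) ^+ 2 by rewrite sqr_ge0.
    lra.
  rewrite -expRM_natl /y mulr_sumr -sumrN mulr_sumr expR_sum.
  rewrite big_seq [leRHS]big_seq; apply: ler_prod => e _; apply/andP; split.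
    have := cos_le1 (w e); have := cos_geN1 (w e); nra.
  apply: le_trans (expR_ge1Dx _) => //; first by lra.
have [h0|h0] := leP 0 (E (fun G => cos (a + lin s w G))).
  by rewrite -(@ler_pXn2r _ 2%N) ?nnegrE // expR_ge0.
by apply: le_trans (expR_ge0 _); apply: ltW.
Qed.

Lemma lin_cos2 s w : uniq s ->
  E2 (fun G G' => cos (lin s w G - lin s w G')) =
  \prod_(e <- s) (1 - 2 * p * (1 - p) * (1 - cos (w e))).
Proof.
move=> us; rewrite -lin_charfun // !expr2 -!ExZr -ExD; apply: eq_Ex => G.
by rewrite -!ExZ -ExD; apply: eq_Ex => G'; rewrite cosB.
Qed.

Lemma cauchy_schwarz_decoupling (F : {set I} -> {set I} -> R) :
  E (fun H => E (fun G => cos (F G H))) ^+ 2 + E (fun H => E (fun G => sin (F G H))) ^+ 2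
  <= E (fun H => E2 (fun G G' => cos (F G H - F G' H))).
Proof.
apply: (le_trans (lerD (Ex_sqr p01 _) (Ex_sqr p01 _))); rewrite -ExD.
apply: ler_Ex => // H; rewrite !expr2 -!ExZr -ExD; apply: ler_Ex => // G.
by rewrite -!ExZ -ExD; apply: ler_Ex => // G'; rewrite cosB.
Qed.

(* Second moment method: [1 - exp (- y) >= (a * y - (a * y) ^ 2 / 4) / 2] for
   [0 <= a <= 1], with [y = K * s] and [a = 1 / (1 + 10 * K * h)]. *)
Lemma Ex2_exp_le (s : {set I} -> {set I} -> R) (K h : R) :
  0 <= K -> (forall G G', 0 <= s G G') -> E2 s = h ->
  E2 (fun G G' => s G G' ^+ 2) <= 20 * h ^+ 2 ->
  E2 (fun G G' => expR (- (K * s G G'))) <= 1 - K * h / (4 + 40 * (K * h)).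
Proof.
move=> K0 s0 sh s2; set z := K * h.
have h0 : 0 <= h by rewrite -sh; apply: Ex_ge0 => // G; apply: Ex_ge0.
have z0 : 0 <= z by rewrite mulr_ge0.
have d0 : 0 < 1 + 10 * z by lra.
(* With [a * z] at most 1/10, the second-moment term $\frac52(az)^2$ is at most half of the linear
   gain $az/2$. *)
pose a := (1 + 10 * z)^-1.
have a0 : 0 < a by rewrite invr_gt0.
have a1 : a <= 1 by rewrite invf_le1 //; lra.
have az : a * z <= 10^-1 by rewrite mulrC ler_pdivrMr //; lra.
(* Indeed $1-e^{-y}\ge y/(1+y)\ge\min(1,y)/2$, and $ay-a^2y^2/4=1-(1-ay/2)^2$ is at most 1 and at
   most [y]. *)
have pt y : 0 <= y -> expR (- y) <= 1 - 2^-1 * (a * y - a ^+ 2 * y ^+ 2 / 4).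
  move=> y0; apply: (@le_trans _ _ (1 + y)^-1).
    by rewrite expRN lef_pV2 ?posrE ?expR_gt0 ?expR_ge1Dx //; lra.
  have ay0 : 0 <= a * y by rewrite mulr_ge0 // ltW.
  have ay1 : a * y <= y by rewrite ler_piMl.
  have q1 : a * y - a ^+ 2 * y ^+ 2 / 4 <= 1.
    have : 0 <= (a * y / 2 - 1) ^+ 2 by rewrite sqr_ge0.
    lra.
  have q2 : a * y - a ^+ 2 * y ^+ 2 / 4 <= y.
    have : 0 <= (a * y) ^+ 2 by rewrite sqr_ge0.
    lra.
  rewrite -[leLHS]mul1r ler_pdivrMr; last by lra.
  move: q1 q2; move: (a * y - _) => w q1 q2.
  have [y1|y1] := leP y 1; nra.
apply: (@le_trans _ _ (E2 (fun G G' => 1 - 2^-1 * (a * (K * s G G') - a ^+ 2 * (K * s G G') ^+ 2 / 4)))).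
  by apply: ler_Ex => // G; apply: ler_Ex => // G'; apply: pt; rewrite mulr_ge0.
have -> : E2 (fun G G' => 1 - 2^-1 * (a * (K * s G G') - a ^+ 2 * (K * s G G') ^+ 2 / 4)) =
   1 - 2^-1 * (a * K) * h + (a ^+ 2 * K ^+ 2 / 8) * E2 (fun G G' => s G G' ^+ 2).
  rewrite -sh -!ExZ -[X in X - _ + _](Ex_cst I p 1) -ExB -ExD; apply: eq_Ex => G.
  rewrite -!ExZ -[X in X - _ + _](Ex_cst I p 1) -ExB -ExD; apply: eq_Ex => G'.
  by field.
have c0 : 0 <= a ^+ 2 * K ^+ 2 / 8 by rewrite divr_ge0 ?mulr_ge0 ?exprn_ge0 // ltW.
have := ler_wpM2l c0 s2.
have -> : a ^+ 2 * K ^+ 2 / 8 * (20 * h ^+ 2) = 5 / 2 * (a * z) ^+ 2 by rewrite /z; field.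
have -> : z / (4 + 40 * z) = a * z / 4 by rewrite /a; field; rewrite !gt_eqF //; lra.
have -> : 2^-1 * (a * K) * h = 2^-1 * (a * z) by rewrite /z; ring.
have az0 : 0 <= a * z by rewrite mulr_ge0 // ltW.
move: (a * z) az0 az (_ * E _) => w w0 w1 X; nra.
Qed.

(** Exponential tilting with parameter 1/2: since $e^{-1/2}\le2/3$, the exponent is
    $\frac14-\frac13=-\frac1{12}$ times $p|Q|$. *)
Lemma chernoff_lower (Q : {set I}) (f : {set I} -> R) (B : R) :
  (forall H, f H <= 1) -> 0 <= B ->
  (forall H, p * #|Q|%:R / 2 <= #|H :&: Q|%:R -> f H <= B) ->
  E f <= expR (- (p * #|Q|%:R / 12)) + B.
Proof.
move=> f1 B0 fB; set k := #|Q|%:R.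
have [p0 p1] : 0 <= p /\ p <= 1 by apply/andP.
have k0 : 0 <= k by rewrite ler0n.
pose g H : R := \prod_(e : I) (if e \in Q then (if e \in H then expR (- 2^-1) else 1) else 1).
have gE H : g H = expR (- (#|H :&: Q|%:R / 2)).
  rewrite /g (_ : - (_ / 2) = #|H :&: Q|%:R * - 2^-1); last by ring.
  rewrite expRM_natl -prodr_const [RHS]big_mkcond.
  apply: eq_bigr => e _; rewrite inE; case: (e \in Q) => /=; rewrite ?andbT ?andbF //.
apply: (@le_trans _ _ (E (fun H => expR (p * k / 4) * g H + B))).
  apply: ler_Ex => // H; have [hQ|hQ] := leP (p * k / 2) #|H :&: Q|%:R.
    apply: (le_trans (fB _ hQ)); rewrite lerDr mulr_ge0 ?expR_ge0 // gE expR_ge0 //.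
  apply: (le_trans (f1 H)); rewrite -[leLHS]addr0; apply: lerD => //.
  by rewrite gE -expRD -[leLHS]expR0 ler_expR; lra.
rewrite ExD Ex_cst ExZ lerD2r.
rewrite (Ex_prod p (fun e b => if e \in Q then if b then expR (- 2^-1) else 1 else 1)).
have -> : \prod_e (p * (if e \in Q then expR (- 2^-1) else 1) + (1 - p) * (if e \in Q then 1 else 1)) =
   (1 - p * (1 - expR (- 2^-1))) ^+ #|Q|.
  rewrite -prodr_const [RHS]big_mkcond; apply: eq_bigr => e _.
  by case: ifP => _; ring.
have e23 : expR (- 2^-1) <= 2 / 3 :> R.
  rewrite expRN -[2 / 3]invrK lef_pV2 ?posrE ?expR_gt0 ?invr_gt0 ?divr_gt0 //.
  by apply: le_trans (expR_ge1Dx _); rewrite le_eqVlt; apply/orP; left; apply/eqP; field.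
have e0 := expR_gt0 (- 2^-1 : R).
have h : (1 - p * (1 - expR (- 2^-1))) ^+ #|Q| <= expR (- (p / 3)) ^+ #|Q|.
  rewrite lerXn2r ?nnegrE ?expR_ge0 //; first by nra.
  apply: le_trans (expR_ge1Dx _); nra.
apply: (le_trans (ler_wpM2l (expR_ge0 _) h)).
rewrite -expRM_natl -expRD ler_expR -/k; lra.
Qed.

End independence.

(** * Stars from a vertex of the first part into the third part *)

Section star.
Context {R : realType}.

Section power_bounds.
Variable x : R.
Hypothesis x01 : 0 <= x <= 1.

Lemma onem_expr_ge n : 1 - n%:R * x <= (1 - x) ^+ n.
Proof.
have /andP[x0 x1] := x01.
elim: n => [|n IH]; first by rewrite mul0r subr0 expr0.
have n0 : 0 <= n%:R :> R by [].
rewrite exprS -natr1; apply: (@le_trans _ _ ((1 - x) * (1 - n%:R * x))).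
  by have := mulr_ge0 n0 (mulr_ge0 x0 x0); nra.
by rewrite ler_wpM2l // subr_ge0.
Qed.

Lemma onem_expr_le n : (1 - x) ^+ n <= 1 - n%:R * x + n%:R ^+ 2 * x ^+ 2 / 2.
Proof.
have /andP[x0 x1] := x01.
elim: n => [|n IH]; first by rewrite expr0; lra.
have n0 : 0 <= n%:R :> R by [].
rewrite exprS -natr1; apply: (@le_trans _ _ ((1 - x) * (1 - n%:R * x + n%:R ^+ 2 * x ^+ 2 / 2))).
  by rewrite ler_wpM2l // subr_ge0.
have := exprn_ge0 2 n0; have := exprn_ge0 2 x0; have := exprn_ge0 3 x0 => a b c.
have := mulr_ge0 c a; lra.
Qed.

Lemma onem_expr_inv n (y : R) : 0 <= y <= n%:R * x -> (1 - x) ^+ n <= (1 + y)^-1.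
Proof.
have /andP[x0 x1] := x01; move=> /andP[y0 yn].
apply: (@le_trans _ _ (expR (- x) ^+ n)).
  by rewrite lerXn2r ?nnegrE ?expR_ge0 ?subr_ge0 // expR_ge1Dx.
rewrite -expRM_natl mulrN expRN lef_pV2 ?posrE ?expR_gt0 //; last by lra.
by apply: le_trans (expR_ge1Dx _); lra.
Qed.

End power_bounds.

Lemma ratio_mono (c d x y : R) : 0 < c -> 0 <= d -> 0 <= x -> x <= y ->
  x / (c + d * x) <= y / (c + d * y).
Proof.
move=> c0 d0 x0 xy.
have p1 : 0 < c + d * x by rewrite ltr_wpDr // mulr_ge0.
have p2 : 0 < c + d * y by rewrite ltr_wpDr // mulr_ge0 // (le_trans x0).
rewrite ler_pdivrMr // mulrAC ler_pdivlMr //; nra.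
Qed.

Context (I : finType) (p : R).
Hypothesis p01 : 0 <= p <= 1.
Local Notation E := (@Ex R I p).
Local Notation E2 f := (E (fun G => E (fun G' => f G G'))).

Let p0 : 0 <= p. Proof. by case/andP: p01. Qed.
Let p1 : p <= 1. Proof. by case/andP: p01. Qed.

(** The second moment needed is explicit, by $(1-\cos a)^2=2(1-\cos a)-\frac12(1-\cos2a)$. The
    resulting bound is monotone in the number of leaves, so a lower bound [y] for it may be
    inserted. *)
Lemma star_one (Q : seq I) (th K y : R) : uniq Q -> 0 <= K ->
  1 <= 2 * p * (1 - p) * (size Q)%:R -> 0 <= y <= (size Q)%:R ->
  let z0 := 2 * p * (1 - p) * (1 - cos th) * y in
  let z := K * (z0 / (1 + z0)) in
  E2 (fun G G' => expR (- (K * (1 - cos (lin Q (fun=> th) G - lin Q (fun=> th) G')))))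
  <= 1 - z / (4 + 40 * z).
Proof.
move=> uQ K0 rS /andP[y0 yS]; cbv zeta.
set S := size Q in rS yS; set r := 2 * p * (1 - p); set u := 1 - cos th.
have u0 : 0 <= u by rewrite subr_ge0 cos_le1.
have u2 : u <= 2 by have := cos_geN1 th; rewrite /u; lra.
have r0 : 0 <= r by rewrite /r !mulr_ge0 // subr_ge0.
have r2 : r <= 2^-1 by rewrite /r; have := sqr_ge0 (1 - 2 * p); nra.
pose s G G' := 1 - cos (lin Q (fun=> th) G - lin Q (fun=> th) G').
have gE t : E2 (fun G G' => cos (lin Q (fun=> t) G - lin Q (fun=> t) G')) = (1 - r * (1 - cos t)) ^+ S.
  rewrite lin_cos2 // /S; elim: (Q) => [|e q IH]; first by rewrite big_nil expr0.
  by rewrite big_cons IH /= exprS.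
pose h := 1 - (1 - r * u) ^+ S.
have sE : E2 s = h.
  rewrite /h -gE -[X in X - _](Ex_cst I p 1) -ExB; apply: eq_Ex => G.
  by rewrite -[X in X - _](Ex_cst I p 1) -ExB.
pose u' := 4 * u - 2 * u ^+ 2.
have u'E : 1 - cos (2 * th) = u'.
  rewrite mulrDl mul1r cosD -!expr2 [sin _ ^+ 2](_ : _ = 1 - cos th ^+ 2); last by have := cos2Dsin2 th; lra.
  by rewrite /u' /u; ring.
have linZ G : lin Q (fun=> 2 * th) G = 2 * lin Q (fun=> th) G.
  by rewrite /lin mulr_sumr; apply: eq_bigr => e _; ring.
have s2E : E2 (fun G G' => s G G' ^+ 2) = 2 * h - 2^-1 * (1 - (1 - r * u') ^+ S).
  rewrite -sE -u'E -gE -[X in X - E _](Ex_cst I p 1) -ExB -!ExZ -ExB; apply: eq_Ex => G.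
  rewrite -[X in X - E _](Ex_cst I p 1) -ExB -!ExZ -ExB; apply: eq_Ex => G'.
  rewrite /s !linZ -mulrBr; move: (lin Q _ G - lin Q _ G') => a.
  rewrite (_ : 2 * a = a + a) ?cosD; last by ring.
  have := cos2Dsin2 a => ca.
  have -> : sin a * sin a = 1 - cos a ^+ 2 by move: ca; lra.
  by field.
have S0 : 0 <= S%:R :> R by [].
have ru : 0 <= r * u <= 1 by rewrite mulr_ge0 //=; nra.
have ru' : 0 <= r * u' <= 1.
  have u'0 : 0 <= u' by have := mulr_ge0 u0 (_ : 0 <= 2 - u); rewrite subr_ge0 u2 /u' => /(_ isT); lra.
  have u'2 : u' <= 2 by have := sqr_ge0 (u - 1); rewrite /u'; lra.
  by rewrite mulr_ge0 //=; apply: (le_trans (ler_wpM2l r0 u'2)); lra.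
pose z0 := r * u * S%:R.
have z00 : 0 <= z0 by rewrite /z0 mulr_ge0 // mulr_ge0.
have hz w : 0 <= w <= z0 -> w / (1 + w) <= h.
  move=> /andP[w0 wz]; rewrite /h.
  have := onem_expr_inv ru (n := S) (y := w); rewrite w0 mulrC -/z0 wz => /(_ isT) H.
  rewrite lerBrDr addrC -lerBrDr; apply: (le_trans H).
  by rewrite le_eqVlt; apply/orP; left; apply/eqP; field; rewrite gt_eqF //; lra.
have s2 : E2 (fun G G' => s G G' ^+ 2) <= 20 * h ^+ 2.
  rewrite s2E.
  have q0 : 0 <= (1 - r * u') ^+ S <= 1.
    by rewrite exprn_ge0 ?exprn_ile1 //; case/andP: ru' => ? ?; lra.
  have [z01|z01] := leP z0 1.
    have h1 : z0 / 2 <= h.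
      have := hz z0; rewrite z00 lexx => /(_ isT); apply: le_trans.
      by rewrite ler_wpM2l // lef_pV2 ?posrE //; lra.
    have h2 : h <= z0.
      by have := onem_expr_ge ru S; rewrite /h /z0; lra.
    have h3 := onem_expr_le ru' S.
    have h4 : S%:R ^+ 2 * (r * u') ^+ 2 <= 16 * z0 ^+ 2.
      have -> : 16 * z0 ^+ 2 = S%:R ^+ 2 * (r * (4 * u)) ^+ 2 by rewrite /z0; ring.
      have ru'0 : 0 <= r * u' by case/andP: ru'.
      have r4u : 0 <= r * (4 * u) by rewrite mulr_ge0 // mulr_ge0.
      rewrite ler_wpM2l ?exprn_ge0 // lerXn2r ?nnegrE //.
      by rewrite ler_wpM2l // /u'; have := sqr_ge0 u; lra.
    have h5 : S%:R * r * u ^+ 2 <= z0 ^+ 2.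
      rewrite /z0; have : 0 <= (S%:R * r * u ^+ 2) * (r * S%:R - 1).
        by rewrite mulr_ge0 ?mulr_ge0 ?exprn_ge0 // subr_ge0.
      lra.
    have h6 : S%:R * (r * u') = 4 * z0 - 2 * (S%:R * r * u ^+ 2) by rewrite /u' /z0; ring.
    have h7 : z0 ^+ 2 <= 4 * h ^+ 2 by nra.
    lra.
  have h1 : 2^-1 <= h.
    have := hz 1; rewrite ler01 (ltW z01) => /(_ isT); apply: le_trans.
    by rewrite mul1r lef_pV2 ?posrE //; lra.
  case/andP: q0 => q0 q1; nra.
have := Ex2_exp_le p01 K0 (s := s) (h := h) _ sE s2.
move=> H; apply: le_trans (H _) _.
  by move=> G G'; rewrite /s subr_ge0 cos_le1.
rewrite lerD2l lerN2.
have w0 : 0 <= r * u * y by rewrite mulr_ge0 // mulr_ge0.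
have wz : r * u * y <= z0 by rewrite /z0 ler_wpM2l // mulr_ge0.
apply: ratio_mono => //.
  by rewrite mulr_ge0 // divr_ge0 // addr_ge0.
by rewrite ler_wpM2l // hz // w0.
Qed.

(** Given [H], only the vertices [c] with [eb c] in [H] are leaves; by Chernoff there are at least
    half of the expected number, except with small probability. Stars at distinct [a] use disjoint
    edges, so their factors are independent. *)
Lemma star_bound (V : finType) (V3 : {set V}) (ea : V -> V -> I) (eb : V -> I)
    (s : seq V) (K th : R) :
  uniq s -> 0 <= K -> {in V3 &, injective eb} ->
  (forall a a' c c', a \in s -> a' \in s -> c \in V3 -> c' \in V3 ->
     ea a c = ea a' c' -> a = a' /\ c = c') ->
  1 <= p ^+ 2 * (1 - p) * #|V3|%:R ->
  forall z0 z, z0 = p ^+ 2 * (1 - p) * (1 - cos th) * #|V3|%:R ->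
  z = K * (z0 / (1 + z0)) ->
  E (fun H => E2 (fun G G' => \prod_(a <- s) expR (- (K * (1 - cos
    (th * \sum_(c in V3) ((ea a c \in G)%:R - (ea a c \in G')%:R) * (eb c \in H)%:R))))))
  <= expR (- (p * #|V3|%:R / 12)) + (1 - z / (4 + 40 * z)) ^+ size s.
Proof.
move=> us K0 ebi eai k1 z0 z z0E zE.
have z00 : 0 <= z0 by rewrite z0E !mulr_ge0 ?exprn_ge0 // ?subr_ge0 // cos_le1.
have z0' : 0 <= z by rewrite zE mulr_ge0 // divr_ge0 // addr_ge0.
have r1 : 0 <= 1 - z / (4 + 40 * z).
  by rewrite subr_ge0 ler_pdivrMr; lra.
have cQ : #|eb @: V3| = #|V3| by apply: card_in_imset.
rewrite -cQ.
apply: chernoff_lower => //; first last.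
- move=> H; rewrite cQ => hH.
  pose Q : seq V := enum [set c in V3 | eb c \in H]%SET.
  have sQ : (size Q)%:R = #|H :&: eb @: V3|%:R :> R.
    congr (_%:R); rewrite /Q -cardE -(card_in_imset (f := eb)).
      apply: eq_card => e; rewrite !inE; apply/imsetP/andP => [[c]|[eH /imsetP[c cV ec]]].
        by rewrite inE => /andP[cV cH] ->; rewrite cH imset_f.
      by exists c => //; rewrite inE cV -ec.
    by move=> c c'; rewrite !inE => /andP[cV _] /andP[cV' _]; apply: ebi.
  have linE a (G : {set I}) : a \in s -> th * (\sum_(c in V3) (ea a c \in G)%:R * (eb c \in H)%:R) = lin (map (ea a) Q) (fun=> th) G.
    move=> _; rewrite /lin big_map mulrC mulr_suml /Q big_enum /=.
    rewrite [RHS](eq_bigl (fun c => (c \in V3) && (eb c \in H))); last by move=> c; rewrite inE.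
    rewrite [RHS]big_mkcondr /=; apply: eq_bigr => c _.
    by case: (eb c \in H); rewrite ?mulr1 ?mulr0 ?mul0r.
  have uQ a : a \in s -> uniq (map (ea a) Q).
    move=> sa; rewrite map_inj_in_uniq ?enum_uniq // => c c'.
    by rewrite !mem_enum !inE => /andP[cV _] /andP[cV' _] /(eai _ _ _ _ sa sa cV cV')[].
  apply: (@Ex2_prod_le R I p p01 _ s (fun a => [set ea a c | c in V3]%SET)) => //.
  + move=> a a' sa sa' aa'; rewrite -setI_eq0; apply/eqP/setP => e; rewrite !inE.
    apply/negP => /andP[/imsetP[c cV ->] /imsetP[c' cV' /(eai _ _ _ _ sa sa' cV cV')[E _]]].
    by rewrite E eqxx in aa'.
  + move=> a G G' H1 H2 h1 h2; congr (expR (- (K * (1 - cos (th * _))))).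
    by apply: eq_bigr => c cV; rewrite h1 ?h2 // imset_f.
  + move=> a sa.
    have hE : E2 (fun G G' => expR (- (K * (1 - cos (th * \sum_(c in V3) ((ea a c \in G)%:R - (ea a c \in G')%:R) * (eb c \in H)%:R))))) =
      E2 (fun G G' => expR (- (K * (1 - cos (lin (map (ea a) Q) (fun=> th) G - lin (map (ea a) Q) (fun=> th) G'))))).
      apply: eq_Ex => G; apply: eq_Ex => G'; rewrite -!linE // -mulrBr -sumrB.
      by congr (expR (- (K * (1 - cos (th * _))))); apply: eq_bigr => c _; rewrite mulrBl.
    rewrite hE.
    have := @star_one (map (ea a) Q) th K (p * #|V3|%:R / 2) (uQ a sa) K0.
    rewrite size_map sQ => S1.
    rewrite (_ : z = K * (2 * p * (1 - p) * (1 - cos th) * (p * #|V3|%:R / 2) / (1 + 2 * p * (1 - p) * (1 - cos th) * (p * #|V3|%:R / 2)))); last first.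
      by rewrite zE (_ : 2 * p * (1 - p) * (1 - cos th) * (p * #|V3|%:R / 2) = z0) // z0E; field.
    apply: S1; last by rewrite hH divr_ge0 // mulr_ge0.
    apply: (le_trans k1); rewrite [leLHS](_ : _ = 2 * p * (1 - p) * (p * #|V3|%:R / 2)); last by field.
    by rewrite ler_wpM2l // !mulr_ge0 // subr_ge0.
- exact: exprn_ge0.
- move=> H; rewrite -[leRHS](Ex_cst I p 1); apply: ler_Ex => // G.
  rewrite -[leRHS](Ex_cst I p 1); apply: ler_Ex => // G'.
  elim: s {us eai} => [|a s IH]; first by rewrite big_nil.
  rewrite big_cons mulr_ile1 ?expR_ge0 ?prodr_ge0 //.
  by rewrite -[leRHS]expR0 ler_expR oppr_le0 mulr_ge0 // subr_ge0 cos_le1.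
Qed.

End star.

(** * Triangles of the complete graph *)

Section triangles.
Context {R : realType} (n : nat).
Local Notation V := ('I_n).

Definition triple := {T : {set V} | #|T| == 3%N}.
HB.instance Definition _ := Finite.copy triple {T : {set V} | #|T| == 3%N}.

Definition tri (T : triple) : {set edge n} := [set e : edge n | val e \subset val T]%SET.

Lemma card_triple (T : triple) : #|val T| = 3%N.
Proof. exact/eqP/(valP T). Qed.

Lemma card_edge (e : edge n) : #|val e| = 2%N.
Proof. exact/eqP/(valP e). Qed.

Lemma card_tri T : #|tri T| = 3%N.
Proof.
rewrite -(card_imset (mem (tri T)) val_inj).
transitivity #|[set A : {set V} | A \subset val T & #|A| == 2%N]|; last first.
  by rewrite cards_draws card_triple.
apply: eq_card => A; rewrite inE; apply/imsetP/andP => [[e]|[AT cA]].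
  by rewrite inE => eT ->; rewrite eT (valP e).
by exists (exist _ A cA : edge n); rewrite ?inE.
Qed.

Lemma num_trianglesE (G : graph n) : (num_triangles G)%:R = copies (R := R) tri G.
Proof.
rewrite /copies /num_triangles.
have -> : #|[set T : {set V} | (#|T| == 3%N) && [forall e : edge n, (val e \subset T) ==> (e \in G)]]%SET|
   = #|[set T : triple | tri T \subset G]%SET|.
  rewrite -(card_imset _ (val_inj : injective (val : triple -> {set V}))).
  apply: eq_card => A; rewrite !inE; apply/andP/imsetP => [[cA /forallP hA]|[T]].
    exists (exist _ A cA : triple) => //; rewrite inE; apply/fintype.subsetP => e.
    by rewrite inE => eA; have := hA e; rewrite eA.
  rewrite inE => /fintype.subsetP TG ->; split; first exact: valP T.
  by apply/forallP => e; apply/implyP => eT; apply: TG; rewrite inE.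
by rewrite -sum1_card natr_sum big_mkcond; apply: eq_bigr => T _; rewrite inE /mono; case: ifP.
Qed.

Lemma edge_eqU (T : triple) (e f : edge n) :
  e \in tri T -> f \in tri T -> e != f -> val T = val e :|: val f.
Proof.
rewrite !inE => eT fT ef; apply/esym/eqP; rewrite eqEcard finset.subUset eT fT card_triple.
rewrite ltnNge; apply: contraNN ef => cU.
have eU : val e = val e :|: val f.
  by apply/eqP; rewrite eqEcard finset.subsetUl card_edge -ltnS.
have fU : val f = val e :|: val f.
  by apply/eqP; rewrite eqEcard finset.subsetUr card_edge -ltnS.
by apply/eqP/val_inj; rewrite eU -fU.
Qed.

Lemma edge_eqU1 (T : triple) (e : edge n) :
  e \in tri T -> exists2 w, w \notin val e & val T = val e :|: [set w]%SET.
Proof.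
rewrite inE => eT; have cD : #|val T :\: val e| = 1%N.
  by rewrite cardsDS // card_triple card_edge.
have /cards1P[w wE] : #|val T :\: val e| == 1%N by rewrite cD.
exists w.
  have : w \in val T :\: val e by rewrite wE inE.
  by rewrite inE => /andP[].
rewrite -wE; apply/setP => x; rewrite !inE; have := fintype.subsetP eT x.
by case: (x \in val e) => //= ->.
Qed.

Lemma triple_sum_le1 (B : {set V}) :
  \sum_(T : triple) (val T == B)%:R <= 1 :> R.
Proof.
case: (pickP (fun T : triple => val T == B)) => [T0 T0B|noT].
  rewrite (bigD1 T0) //= T0B big1 ?addr0 // => T TT0.
  case: eqP => // TB; move: TT0; rewrite -(inj_eq val_inj) /= TB.
  by rewrite (eqP T0B) eqxx.
by rewrite big1 // => T _; rewrite noT.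
Qed.

Section weights.
Variable p : R.
Hypothesis p01 : 0 <= p <= 1.

(** A triangle with exactly one edge in [A] has weight $p^2$ and is given by that edge and a third
    vertex ([f1]). One with at least two edges in [A] has weight at most 1 and is given by two of
    them ([f2]). *)
Lemma triple_weight (A : {set edge n}) :
  \sum_(T | meets tri A T) p ^+ #|tri T :\: A| <= #|A|%:R * n%:R * p ^+ 2 + #|A|%:R ^+ 2.
Proof.
have [p0 p1] : 0 <= p /\ p <= 1 by apply/andP.
pose f1 (T : triple) := \sum_(e in A) \sum_(w : V) (val T == val e :|: [set w]%SET)%:R * p ^+ 2.
pose f2 (T : triple) : R := \sum_(e in A) \sum_(f in A) (val T == val e :|: val f)%:R.
apply: (@le_trans _ _ (\sum_T (f1 T + f2 T))).
  rewrite big_mkcond; apply: ler_sum => T _.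
  have f10 : 0 <= f1 T by rewrite /f1 !sumr_ge0 // => e _; apply: sumr_ge0 => w _; rewrite mulr_ge0 // exprn_ge0.
  have f20 : 0 <= f2 T by rewrite /f2 !sumr_ge0 // => e _; apply: sumr_ge0.
  case: ifP => [mT|_]; last by rewrite addr_ge0.
  have [e eA eT] : exists2 e, e \in A & e \in tri T.
    by move: mT; rewrite /meets -setI_eq0 => /set0Pn[e]; rewrite inE => /andP[]; exists e.
  have [|hA] := leqP #|tri T :&: A| 1.
    move=> hA; apply: (@le_trans _ _ (p ^+ 2)).
      rewrite ler_wiXn2l //; have := cardsID A (tri T); rewrite card_tri; lia.
    apply: (@le_trans _ _ (f1 T)); last by rewrite lerDl.
    have [w _ Tw] := edge_eqU1 eT.
    rewrite /f1 (bigD1 e) //= (bigD1 w) //= Tw eqxx mul1r -addrA lerDl addr_ge0 //.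
      by apply: sumr_ge0 => ? _; rewrite mulr_ge0 // exprn_ge0.
    by apply: sumr_ge0 => ? _; apply: sumr_ge0 => ? _; rewrite mulr_ge0 // exprn_ge0.
  apply: (@le_trans _ _ 1); first by rewrite exprn_ile1.
  apply: (@le_trans _ _ (f2 T)); last by rewrite lerDr.
  have /card_gt1P[e1 [e2 [he1 he2 ne]]] := hA.
  move: he1 he2; rewrite !finset.in_setI => /andP[e1T e1A] /andP[e2T e2A].
  rewrite /f2 (bigD1 e1) //= (bigD1 e2) //= (edge_eqU e1T e2T ne) eqxx -addrA lerDl addr_ge0 //.
    by apply: sumr_ge0.
  by apply: sumr_ge0 => ? _; apply: sumr_ge0.
rewrite big_split /=; apply: lerD.
  rewrite /f1 exchange_big /= (_ : #|A|%:R * _ * _ = \sum_(e in A) \sum_(w : V) p ^+ 2); last first.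
    by rewrite !sumr_const card_ord -[RHS]mulr_natl -[p ^+ 2 *+ n]mulr_natl mulrA.
  apply: ler_sum => e _; rewrite exchange_big /=; apply: ler_sum => w _.
  by rewrite -mulr_suml ler_piMl ?exprn_ge0 // triple_sum_le1.
rewrite /f2 exchange_big /= (_ : #|A|%:R ^+ 2 = \sum_(e in A) \sum_(f in A) 1); last first.
  by rewrite !sumr_const -[RHS]mulr_natl expr2.
by apply: ler_sum => e _; rewrite exchange_big /=; apply: ler_sum => f _; exact: triple_sum_le1.
Qed.

Lemma triple_weight12 (A : {set edge n}) : (#|A| <= 12)%N ->
  \sum_(T | meets tri A T) p ^+ #|tri T :\: A| <= 12 * n%:R * p ^+ 2 + 144.
Proof.
move=> cA; apply: (le_trans (triple_weight A)).
have c12 : #|A|%:R <= 12 :> R by rewrite (ler_nat R _ 12).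
have c0 : 0 <= #|A|%:R :> R by [].
have := ler_wpM2r (mulr_ge0 (ler0n R n) (exprn_ge0 2 (andP p01).1)) c12.
nra.
Qed.

(** All terms being nonnegative, it suffices to keep the $n-3$ triangles formed by one fixed edge of
    [T] and a vertex outside [T]. *)
Lemma Ex_gain_tri_ge (T : triple) :
  (n%:R - 3) * (p ^+ 2 - p ^+ 3) <= Ex p (gain tri (tri T)).
Proof.
have [p0 p1] : 0 <= p /\ p <= 1 by apply/andP.
rewrite (Ex_gainE tri p).
have [e eT] : exists e, e \in tri T by apply/set0Pn; rewrite -card_gt0 card_tri.
have eT' := eT; rewrite inE in eT'.
pose W := [set w | w \notin val T]%SET.
have cS w : w \in W -> #|val e :|: [set w]| == 3%N.
  rewrite inE => wT; rewrite finset.setUC cardsU1 card_edge.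
  by rewrite (contra (fintype.subsetP eT' w) wT).
pose f w : triple := insubd T (val e :|: [set w]%SET).
have fE w : w \in W -> val (f w) = val e :|: [set w]%SET.
  by move=> wW; rewrite /f val_insubd cS.
have fi : {in W &, injective f}.
  move=> w w' wW wW' /(congr1 val); rewrite !fE // => /setP/(_ w).
  rewrite !inE eqxx orbT => /esym/orP[we|/eqP //].
  by move: wW; rewrite inE (fintype.subsetP eT' _ we).
have cW : #|W| = (n - 3)%N.
  have := cardsC (val T); rewrite card_ord card_triple (_ : ~: val T = W); first by lia.
  by apply/setP => w; rewrite !inE.
have n3 : (3 <= n)%N.
  by have := max_card (mem (val T)); rewrite card_ord card_triple.
have -> : (n%:R - 3) * (p ^+ 2 - p ^+ 3) = \sum_(S in f @: W) (p ^+ 2 - p ^+ 3).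
  by rewrite big_imset //= sumr_const cW -[RHS]mulr_natl natrB.
rewrite big_mkcond [leRHS]big_mkcond /=; apply: ler_sum => S _.
case: ifP => [/imsetP[w wW ->]|_]; last first.
  by case: ifP => // _; rewrite subr_ge0 le_ptri.
have eS : e \in tri (f w) by rewrite inE fE // finset.subsetUl.
have mS : e \in tri T :&: tri (f w) by rewrite finset.in_setI eT eS.
have -> : meets tri (tri T) (f w).
  by rewrite /meets -setI_eq0; apply/set0Pn; exists e.
rewrite card_tri lerD2r ler_wiXn2l //.
have := cardsID (tri T) (tri (f w)); rewrite card_tri.
have : (0 < #|tri (f w) :&: tri T|)%N by rewrite card_gt0 finset.setIC; apply/set0Pn; exists e.
by move=> h1 h2; rewrite -ltnS -h2 -[X in (X < _)%N]add0n ltn_add2r.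
Qed.

End weights.

Lemma card_triples : #|{: triple}| = 'C(n, 3).
Proof.
rewrite -[in RHS](card_ord n) -card_draws -(card_imset _ (val_inj : injective (val : triple -> _))).
apply: eq_card => A; rewrite [RHS]inE; apply/imsetP/idP => [[T _ ->]|cA]; first exact: valP T.
by exists (exist _ A cA : triple).
Qed.

End triangles.

(** * Decoupling triangles along a vertex tripartition *)

Section decoupling.
Context {R : realType} (n : nat) (V1 V2 V3 : {set 'I_n}).
Variables (e0 : edge n) (t0 : triple n).
Hypothesis d12 : forall x, x \in V1 -> x \in V2 -> False.
Hypothesis d13 : forall x, x \in V1 -> x \in V3 -> False.
Hypothesis d23 : forall x, x \in V2 -> x \in V3 -> False.
Implicit Types (G H : {set edge n}) (a b c : 'I_n).

(** The default [e0] is taken only when [a = b], which cannot happen for vertices of different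
    parts; [t0] has the same purpose in [t3]. *)
Definition ed a b : edge n := insubd e0 [set a; b]%SET.

Lemma val_ed a b : a != b -> val (ed a b) = [set a; b]%SET.
Proof. by move=> ab; rewrite val_insubd cards2 ab. Qed.

Let E13 : {set edge n} := [set ed x.1 x.2 | x in finset.setX V1 V3]%SET.
Let E12 : {set edge n} := [set ed x.1 x.2 | x in finset.setX V1 V2]%SET.

Let n12 a b : a \in V1 -> b \in V2 -> a != b.
Proof. by move=> ha hb; apply/eqP => ab; apply: (d12 ha); rewrite ab. Qed.
Let n13 a c : a \in V1 -> c \in V3 -> a != c.
Proof. by move=> ha hb; apply/eqP => ab; apply: (d13 ha); rewrite ab. Qed.
Let n23 b c : b \in V2 -> c \in V3 -> b != c.
Proof. by move=> ha hb; apply/eqP => ab; apply: (d23 ha); rewrite ab. Qed.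

Lemma ed_inj (U W : {set 'I_n}) a b a' b' :
  (forall x, x \in U -> x \in W -> False) ->
  a \in U -> b \in W -> a' \in U -> b' \in W -> ed a b = ed a' b' -> a = a' /\ b = b'.
Proof.
move=> dUW aU bW aU' bW'.
have ab : a != b by apply/eqP => ab; apply: (dUW a) => //; rewrite ab.
have ab' : a' != b' by apply/eqP => ab'; apply: (dUW a') => //; rewrite ab'.
move=> /(congr1 val); rewrite !val_ed // => /setP S; split.
  have := S a; rewrite !inE eqxx /= => /esym/orP[/eqP //|/eqP aB].
  by exfalso; apply: (dUW a) => //; rewrite aB.
have := S b; rewrite !inE eqxx orbT /= => /esym/orP[/eqP aB|/eqP //].
by exfalso; apply: (dUW b) => //; rewrite aB.
Qed.

Lemma in_E13 a c : a \in V1 -> c \in V3 -> ed a c \in E13.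
Proof. by move=> ha hc; apply/imsetP; exists (a, c); rewrite // finset.in_setX ha hc. Qed.

Lemma in_E12 a b : a \in V1 -> b \in V2 -> ed a b \in E12.
Proof. by move=> ha hc; apply/imsetP; exists (a, b); rewrite // finset.in_setX ha hc. Qed.

Lemma E12_notin13 a b : a \in V1 -> b \in V2 -> ed a b \notin E13.
Proof.
move=> ha hb; apply/imsetP => -[[a' c]]; rewrite finset.in_setX /= => /andP[ha' hc].
move=> /(congr1 val); rewrite (val_ed (n12 ha hb)) (val_ed (n13 ha' hc)) => /setP/(_ c).
rewrite !inE eqxx orbT => /orP[]/eqP ec; [apply: (d13 ha)|apply: (d23 hb)]; by rewrite -ec.
Qed.

Lemma E23_notin13 b c : b \in V2 -> c \in V3 -> ed b c \notin E13.
Proof.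
move=> hb hc; apply/imsetP => -[[a' c']]; rewrite finset.in_setX /= => /andP[ha' hc'].
move=> /(congr1 val); rewrite (val_ed (n23 hb hc)) (val_ed (n13 ha' hc')) => /setP/(_ a').
rewrite !inE eqxx /= => /orP[]/eqP ec; [apply: (d12 ha')|apply: (d13 ha')]; by rewrite ec.
Qed.

Lemma E23_notin12 b c : b \in V2 -> c \in V3 -> ed b c \notin E12.
Proof.
move=> hb hc; apply/imsetP => -[[a' b']]; rewrite finset.in_setX /= => /andP[ha' hc'].
move=> /(congr1 val); rewrite (val_ed (n23 hb hc)) (val_ed (n12 ha' hc')) => /setP/(_ a').
rewrite !inE eqxx /= => /orP[]/eqP ec; [apply: (d12 ha')|apply: (d13 ha')]; by rewrite ec.
Qed.

Definition t3 (x : 'I_n * 'I_n * 'I_n) : triple n :=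
  insubd t0 (x.1.1 |: [set x.1.2; x.2])%SET.

Let V123 := finset.setX (finset.setX V1 V2) V3.

Lemma val_t3 a b c : a \in V1 -> b \in V2 -> c \in V3 ->
  val (t3 (a, b, c)) = (a |: [set b; c])%SET.
Proof.
move=> ha hb hc; rewrite /t3 val_insubd /= cardsU1 cards2 !inE.
by rewrite (negbTE (n12 ha hb)) (negbTE (n13 ha hc)) (n23 hb hc).
Qed.

Lemma tri_t3 a b c : a \in V1 -> b \in V2 -> c \in V3 ->
  tri (t3 (a, b, c)) = [set ed a b; ed a c; ed b c]%SET.
Proof.
move=> ha hb hc.
have eb : ed a b != ed a c.
  by apply: contraNneq (E12_notin13 ha hb) => ->; apply: in_E13.
have ec : ed a b != ed b c.
  by apply: contraNneq (E23_notin12 hb hc) => <-; apply: in_E12.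
have ed' : ed a c != ed b c.
  by apply: contraNneq (E23_notin13 hb hc) => <-; apply: in_E13.
apply/esym/eqP; rewrite eqEcard card_tri.
rewrite -finset.setUA cardsU1 cards2 !inE (negbTE eb) (negbTE ec) ed' andbT.
rewrite !finset.subUset !finset.sub1set !inE val_t3 //.
rewrite (val_ed (n12 ha hb)) (val_ed (n13 ha hc)) (val_ed (n23 hb hc)) !finset.subUset !finset.sub1set !inE !eqxx.
by rewrite ?orbT.
Qed.

Lemma t3_inj : {in V123 &, injective t3}.
Proof.
move=> [[a b] c] [[a' b'] c']; rewrite !finset.in_setX /= => /andP[/andP[ha hb] hc] /andP[/andP[ha' hb'] hc'].
move=> /(congr1 val); rewrite !val_t3 // => /setP S.
have := S a; rewrite !inE eqxx /= => /esym/or3P[/eqP ->|/eqP E|/eqP E]; last 2 first.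
- by exfalso; apply: (d12 ha); rewrite E.
- by exfalso; apply: (d13 ha); rewrite E.
have := S b; rewrite !inE eqxx orbT /= => /esym/or3P[/eqP E|/eqP ->|/eqP E].
- by exfalso; apply: (d12 _ hb); rewrite E.
- have := S c; rewrite !inE eqxx !orbT /= => /esym/or3P[/eqP E|/eqP E|/eqP -> //].
  + by exfalso; apply: (d13 _ hc); rewrite E.
  + by exfalso; apply: (d23 _ hc); rewrite E.
- by exfalso; apply: (d23 hb); rewrite E.
Qed.

Lemma meets_t3 (T : triple n) :
  (meets (@tri n) E13 T && meets (@tri n) E12 T) = (T \in t3 @: V123).
Proof.
apply/andP/imsetP => [[]|[[[a b] c]]]; last first.
  rewrite !finset.in_setX /= => /andP[/andP[ha hb] hc] ->; rewrite /meets tri_t3 //.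
  by split; rewrite -setI_eq0; apply/set0Pn; [exists (ed a c)|exists (ed a b)];
    rewrite finset.in_setI ?in_E13 ?in_E12 // !inE eqxx ?orbT.
rewrite /meets -!setI_eq0 => /set0Pn[e] /finset.setIP[/imsetP[[a c]]].
rewrite finset.in_setX /= => /andP[ha hc] ->; rewrite inE val_ed ?n13 // => acT.
move=> /set0Pn[f] /finset.setIP[/imsetP[[a' b]]].
rewrite finset.in_setX /= => /andP[ha' hb] ->; rewrite inE val_ed ?n12 // => abT.
exists (a, b, c); first by rewrite !finset.in_setX /= ha hb hc.
apply/val_inj; rewrite val_t3 //; apply/esym/eqP; rewrite eqEcard card_triple.
move: acT abT; rewrite !finset.subUset !finset.sub1set => /andP[-> ->] /andP[_ ->] /=.
by rewrite cardsU1 cards2 !inE (negbTE (n12 ha hb)) (negbTE (n13 ha hc)) (n23 hb hc).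
Qed.

Lemma eq_mono (A G H : {set edge n}) :
  (forall e, e \in A -> (e \in G) = (e \in H)) -> mono (R := R) A G = mono A H.
Proof.
move=> GH; rewrite /mono; congr (_%:R); congr nat_of_bool.
by apply/fintype.subsetP/fintype.subsetP => h e eA; have := h e eA; rewrite GH.
Qed.

Lemma mono3 e1 e2 e3 G :
  mono (R := R) [set e1; e2; e3]%SET G = (e1 \in G)%:R * (e2 \in G)%:R * (e3 \in G)%:R.
Proof.
by rewrite /mono !finset.subUset !finset.sub1set -!mulnb !natrM.
Qed.

Definition wedges G G' H (x : 'I_n * 'I_n) : R :=
  \sum_(c in V3) ((ed x.1 c \in G)%:R - (ed x.1 c \in G')%:R) * (ed x.2 c \in H)%:R.

Let cnt := copies (R := R) (@tri n).

(** Triangles without an edge between [V1] and [V3] cancel in the difference, and those without an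
    edge between [V1] and [V2] do not see [H1]. Each of the others has one vertex in each part and
    contains exactly one edge decided by [H1]. *)
Lemma copies_diff G G' H2 : exists c0 : R, forall H1,
  cnt (mix E13 G (mix E12 H1 H2)) - cnt (mix E13 G' (mix E12 H1 H2)) =
  c0 + \sum_(x in finset.setX V1 V2) (ed x.1 x.2 \in H1)%:R * wedges G G' H2 x.
Proof.
pose D H1 (T : triple n) : R := mono (tri T) (mix E13 G (mix E12 H1 H2)) - mono (tri T) (mix E13 G' (mix E12 H1 H2)).
(* These terms do not depend on [H1], which may therefore be replaced by the empty set. *)
exists (\sum_(T | T \notin t3 @: V123) D finset.set0 T) => H1.
rewrite /cnt /copies -sumrB (bigID (fun T => T \in t3 @: V123)) /= addrC; congr (_ + _).
  apply: eq_bigr => T; rewrite -meets_t3 negb_and => /orP[nA|nB].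
    have DE H : D H T = 0.
      apply/eqP; rewrite /D subr_eq0; apply/eqP/eq_mono => e eT.
      rewrite !in_mix (_ : e \in E13 = false) //.
      by move: nA; rewrite negbK disjoint_sym => /disjointFr/(_ eT).
    by rewrite -/(D H1 T) !DE.
  congr (_ - _); apply: eq_mono => e eT; rewrite !in_mix (_ : e \in E12 = false) //;
    by move: nB; rewrite negbK disjoint_sym => /disjointFr/(_ eT).
rewrite big_imset /=; last exact: t3_inj.
transitivity (\sum_(x in finset.setX V1 V2) \sum_(c in V3) D H1 (t3 (x, c))).
  rewrite pair_big /=; apply: eq_big => [[x c]|[x c] _ //].
  by rewrite finset.in_setX.
apply: eq_bigr => -[a b]; rewrite finset.in_setX /= => /andP[ha hb].
rewrite /wedges mulr_sumr; apply: eq_bigr => c hc.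
rewrite /D tri_t3 // !mono3 !in_mix (in_E13 ha hc) (in_E12 ha hb).
rewrite (negbTE (E12_notin13 ha hb)) (negbTE (E23_notin13 hb hc)) (negbTE (E23_notin12 hb hc)).
by rewrite /=; ring.
Qed.

Section bound.
Variables (p th mu : R) (k : nat).
Hypothesis p01 : 0 <= p <= 1.
Hypothesis k0 : (0 < k)%N.
Hypothesis c1 : #|V1| = k.
Hypothesis c2 : #|V2| = k.
Hypothesis c3 : #|V3| = k.
Hypothesis pk : 1 <= p ^+ 2 * (1 - p) * k%:R.
Local Notation E := (@Ex R (edge n) p).
Local Notation E2 f := (E (fun G => E (fun G' => f G G'))).

Let cosW G G' H a b := 1 - cos (th * wedges G G' H (a, b)).

Lemma Ex_cos_wedges G G' H2 :
  E (fun H1 => cos (th * (cnt (mix E13 G (mix E12 H1 H2)) - cnt (mix E13 G' (mix E12 H1 H2)))))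
  <= expR (- (p * (1 - p) * \sum_(b in V2) \sum_(a in V1) cosW G G' H2 a b)).
Proof.
have [c0 c0E] := copies_diff G G' H2.
pose s := [seq ed x.1 x.2 | x <- enum (finset.setX V1 V2)].
(* Weights are indexed by pairs but needed on edges. As [V1] and [V2] are disjoint, each sum over a
   fibre has at most one term. *)
pose w e : R := \sum_(x in finset.setX V1 V2 | ed x.1 x.2 == e) th * wedges G G' H2 x.
have us : uniq s.
  rewrite map_inj_in_uniq ?enum_uniq // => -[a b] [a' b'].
  rewrite !mem_enum !finset.in_setX /= => /andP[ha hb] /andP[ha' hb'].
  by move=> /(ed_inj d12 ha hb ha' hb')[-> ->].
have wE x : x \in finset.setX V1 V2 -> w (ed x.1 x.2) = th * wedges G G' H2 x.
  case: x => a b; rewrite finset.in_setX /= => /andP[ha hb].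
  rewrite /w (big_pred1 (a, b)) // => -[a' b'] /=; rewrite finset.in_setX /=.
  apply/andP/eqP => [[/andP[ha' hb'] /eqP/(ed_inj d12 ha' hb' ha hb)[-> ->]] //|[-> ->]].
  by rewrite ha hb eqxx.
have sE (F : edge n -> R) : \sum_(e <- s) F e = \sum_(x in finset.setX V1 V2) F (ed x.1 x.2).
  by rewrite big_map big_enum.
have := lin_cos_le p01 w (th * c0) us; rewrite sE.
rewrite (_ : \sum_(x in finset.setX V1 V2) (1 - cos (w (ed x.1 x.2))) = \sum_(b in V2) \sum_(a in V1) cosW G G' H2 a b); last first.
  rewrite exchange_big /= pair_big /=; apply: eq_big => [[a b]|[a b] hab]; first by rewrite finset.in_setX.
  by rewrite (wE (a, b)) //.
apply: le_trans; rewrite le_eqVlt; apply/orP; left; apply/eqP/eq_Ex => H1.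
rewrite c0E mulrDr; congr (cos (_ + _)); rewrite /lin sE mulr_sumr.
by apply: eq_bigr => x hx; rewrite wE //; ring.
Qed.

Lemma prod_le_mean_expr (I : finType) (P : {set I}) (F : I -> R) :
  (0 < #|P|)%N -> (forall i, 0 <= F i) ->
  \prod_(i in P) F i <= (\sum_(i in P) F i ^+ #|P|) / #|P|%:R.
Proof.
move=> P0 F0.
have := leif_AGM (A := mem P) (E := fun i => F i ^+ #|P|) => /(_ (fun i _ => exprn_ge0 _ (F0 i))).
rewrite /= prodrXl => -[+ _]; rewrite ler_pXn2r // ?nnegrE ?prodr_ge0 //.
by rewrite divr_ge0 // sumr_ge0 // => i _; rewrite exprn_ge0.
Qed.

(* AM-GM over [b] reduces the product over all pairs [(a, b)] to an average of
   products over [a] at a fixed [b], to which [star_bound] applies. *)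
Lemma charfun_large : forall z0 z,
  z0 = p ^+ 2 * (1 - p) * (1 - cos th) * k%:R ->
  z = p * (1 - p) * k%:R * (z0 / (1 + z0)) ->
  E (fun G => cos (th * (cnt G - mu))) ^+ 2 + E (fun G => sin (th * (cnt G - mu))) ^+ 2
  <= expR (- (p * k%:R / 12)) + (1 - z / (4 + 40 * z)) ^+ k.
Proof.
move=> z0 z z0E zE.
have [p0 p1] : 0 <= p /\ p <= 1 by apply/andP.
have mixE (f : {set edge n} -> R) : E f = E (fun H => E (fun G => f (mix E13 G H))).
  by rewrite -(Ex_mix p E13) Ex_swap.
rewrite [E (fun G => cos _)]mixE [E (fun G => sin _)]mixE.
apply: (le_trans (cauchy_schwarz_decoupling p01 (fun G H => th * (cnt (mix E13 G H) - mu)))).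
(* The edges outside [E13] are split once more: an inner sample decides those of [E12], and [H2]
   decides the rest. *)
rewrite -(Ex_mix p E12) Ex_swap.
pose K := p * (1 - p) * k%:R.
have K0 : 0 <= K by rewrite /K !mulr_ge0 // subr_ge0.
apply: (@le_trans _ _ (E (fun H2 => E2 (fun G G' =>
   (\sum_(b in V2) \prod_(a <- enum V1) expR (- (K * cosW G G' H2 a b))) / k%:R)))).
  apply: ler_Ex => // H2; rewrite Ex_swap; apply: ler_Ex => // G.
  rewrite Ex_swap; apply: ler_Ex => // G'.
  apply: (@le_trans _ _ (expR (- (p * (1 - p) * \sum_(b in V2) \sum_(a in V1) cosW G G' H2 a b)))).
    apply: le_trans (Ex_cos_wedges G G' H2); rewrite le_eqVlt; apply/orP; left; apply/eqP/eq_Ex => H1.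
    by congr cos; ring.
  rewrite mulr_sumr -sumrN expR_sum.
  have V20 : (0 < #|V2|)%N by rewrite c2.
  apply: (le_trans (prod_le_mean_expr V20 _)); first by move=> b; exact: expR_ge0.
  rewrite c2 le_eqVlt; apply/orP; left; apply/eqP; congr (_ / _); apply: eq_bigr => b _.
  rewrite -expRM_natl big_enum -expR_sum; congr expR.
  by rewrite mulrN sumrN -mulr_sumr /K; congr (- _); ring.
have k0' : 0 < k%:R :> R by rewrite ltr0n.
have -> : E (fun H2 => E2 (fun G G' =>
   (\sum_(b in V2) \prod_(a <- enum V1) expR (- (K * cosW G G' H2 a b))) / k%:R)) =
   (\sum_(b in V2) E (fun H2 => E2 (fun G G' => \prod_(a <- enum V1) expR (- (K * cosW G G' H2 a b))))) / k%:R.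
  rewrite -Ex_sum -ExZr; apply: eq_Ex => H2; rewrite -Ex_sum -ExZr; apply: eq_Ex => G.
  by rewrite -Ex_sum -ExZr.
rewrite ler_pdivrMr //.
set bd := expR _ + _.
rewrite (_ : bd * k%:R = \sum_(b in V2) bd); last by rewrite sumr_const c2 mulr_natr.
apply: ler_sum => b hb.
have := @star_bound R (edge n) p p01 _ V3 ed (ed b) (enum V1) K th (enum_uniq _) K0.
rewrite c3 -cardE c1; apply => //.
- by move=> c c' hc hc' /(ed_inj d23 hb hc hb hc')[].
- by move=> a a' c c'; rewrite !mem_enum => ha ha' hc hc' /(ed_inj d13 ha hc ha' hc').
by rewrite zE z0E.
Qed.

End bound.
End decoupling.

(** * The measure [gnp] as a finite product measure *)

Section gnp_expectation.
Local Open Scope classical_set_scope.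
Context {R : realType} (n : nat) (p : R).
Hypothesis p01 : 0 <= p <= 1.
Let P : probability (graph n) R := @gnp R n p.
Local Notation E := (@Ex R (edge n) p).

Lemma gnp_probE (A : set (graph n)) : P A = (E (fun G => (G \in A)%:R))%:E.
Proof.
rewrite /P /= /gnp p01 /Ex -sumEFin; apply: eq_bigr => G _.
by rewrite diracE EFinM /wt /gnp_pmf.
Qed.

Lemma integral_gnp (f : graph n -> R) : (forall G, 0 <= f G) ->
  (\int[P]_G (f G)%:E = (E f)%:E)%E.
Proof.
move=> f0.
transitivity (\int[P]_G (\sum_(H : graph n) (f H * \1_[set H] G)%:E))%E.
  apply: eq_integral => G _; rewrite sumEFin (bigD1 G) //= big1 ?addr0.
    by rewrite indicE mem_set // mulr1.
  by move=> H HG; rewrite indicE memNset ?mulr0 //= => GH; rewrite GH eqxx in HG.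
rewrite ge0_integral_sum //; last by move=> H G _; rewrite lee_fin mulr_ge0.
rewrite /Ex -sumEFin; apply: eq_bigr => H _.
under eq_integral do rewrite EFinM.
rewrite ge0_integralZl //; last by rewrite lee_fin.
rewrite integral_indic // setIT.
transitivity ((f H)%:E * (E (fun G => (G \in [set H])%:R))%:E)%E.
  by congr (_ * _)%E; exact: gnp_probE.
rewrite -EFinM mulrC; congr (_ * _)%:E.
rewrite /Ex (bigD1 H) //= mem_set // mulr1 big1 ?addr0 // => G GH.
by rewrite memNset ?mulr0 //= => HG; rewrite HG eqxx in GH.
Qed.

Lemma expectation_gnp (f : graph n -> R) : (forall G, 0 <= f G) ->
  ('E_P[f] = (E f)%:E)%E.
Proof. by move=> f0; rewrite unlock integral_gnp. Qed.

Lemma variance_gnp (f : graph n -> R) : (forall G, 0 <= f G) ->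
  ('V_P[f] = (E (fun G => (f G - E f) ^+ 2))%:E)%E.
Proof.
move=> f0; rewrite /variance covariance.unlock (expectation_gnp f0) /=.
rewrite expectation_gnp.
  by congr (_%:E); apply: eq_Ex => G; rewrite expr2.
by move=> G; exact: sqr_ge0.
Qed.

End gnp_expectation.

(** * The differential system for the triangle count *)

Section triangle_ode.
Local Open Scope classical_set_scope.
Context {R : realType} (n : nat) (p : R).
Hypothesis p01 : 0 <= p <= 1.
Local Notation E := (@Ex R (edge n) p).
Local Notation cnt := (copies (R := R) (@tri n)).
Local Notation b := (12 * n%:R * p ^+ 2 + 144).
Local Notation mu := (hmu (@tri n) p).
Local Notation v := (hvar (@tri n) p).
Local Notation kappa := (hkap (@tri n) p).
Local Notation N := (@num_triangles n).

Let tri3 T : (#|@tri n T| <= 3)%N. Proof. by rewrite card_tri. Qed.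
Let hb := @triple_weight12 R n p p01.

Lemma cosEE t : cosE p N mu t = E (fun G => cos (t * (cnt G - mu))).
Proof. by apply: eq_Ex => G; rewrite num_trianglesE. Qed.

Lemma sinEE t : sinE p N mu t = E (fun G => sin (t * (cnt G - mu))).
Proof. by apply: eq_Ex => G; rewrite num_trianglesE. Qed.

Let dC t := E (fun G => - sin (t * (cnt G - mu)) * (cnt G - mu)).
Let dS t := E (fun G => cos (t * (cnt G - mu)) * (cnt G - mu)).

Let hC t : hasd (cosE p N mu) (dC t) t.
Proof.
rewrite (_ : cosE p N mu = fun t => E (fun G => cos (t * (cnt G - mu)))); last first.
  by apply/funext => u; rewrite cosEE.
apply: hasd_Ex => G; apply: hasd_eq (hasd_cos (hasdM (hasd_id t) (hasd_cst _ t))) _.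
by rewrite mulr0 addr0 mul1r.
Qed.

Let hS t : hasd (sinE p N mu) (dS t) t.
Proof.
rewrite (_ : sinE p N mu = fun t => E (fun G => sin (t * (cnt G - mu)))); last first.
  by apply/funext => u; rewrite sinEE.
apply: hasd_Ex => G; apply: hasd_eq (hasd_sin (hasdM (hasd_id t) (hasd_cst _ t))) _.
by rewrite mulr0 addr0 mul1r.
Qed.

Let psi1 t : psi (@tri n) p t (- (t * mu)) = cosE p N mu t.
Proof. by rewrite cosEE; apply: eq_Ex => G; rewrite /chi mulrBr. Qed.

Let psi2 t : psi (@tri n) p t (- (t * mu) + pi / 2) = - sinE p N mu t.
Proof.
by rewrite sinEE -ExN; apply: eq_Ex => G; rewrite /chi addrA cosDpihalf mulrBr.
Qed.

Let psi3 t : psi (@tri n) p t (- (t * mu) + pi / 2 + pi / 2) = - cosE p N mu t.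
Proof.
rewrite cosEE -ExN; apply: eq_Ex => G.
by rewrite /chi !addrA !cosDpihalf sinDpihalf mulrBr.
Qed.

(** This and [eS] are the expansion of [Ex_copies_chi] at the phases $-t\mu+\pi/2$ and $-t\mu$;
    centring removes its term in [hmu]. *)
Let eC t : 0 <= t ->
  `|dC t + t * v * cosE p N mu t - t ^+ 2 * kappa * sinE p N mu t| <= t ^+ 3 * (8 * b ^+ 3 * mu).
Proof.
move=> t0; have := Ex_copies_chi p01 tri3 hb t0 (- (t * mu) + pi / 2).
rewrite psi3 psi2 => h.
have dE : dC t = E (fun G => cnt G * chi (@tri n) t (- (t * mu) + pi / 2) G) + mu * sinE p N mu t.
  rewrite sinEE -ExZ -ExD; apply: eq_Ex => G.
  by rewrite /chi addrA cosDpihalf -mulrBr; ring.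
by apply: norm_le_eq h; rewrite ?dE; ring.
Qed.

Let eS t : 0 <= t ->
  `|dS t + t * v * sinE p N mu t + t ^+ 2 * kappa * cosE p N mu t| <= t ^+ 3 * (8 * b ^+ 3 * mu).
Proof.
move=> t0; have := Ex_copies_chi p01 tri3 hb t0 (- (t * mu)).
rewrite psi1 psi2 => h.
have dE : dS t = E (fun G => cnt G * chi (@tri n) t (- (t * mu)) G) - mu * cosE p N mu t.
  rewrite cosEE -ExZ -ExB; apply: eq_Ex => G.
  by rewrite /chi -mulrBr; ring.
by apply: norm_le_eq h; rewrite ?dE; ring.
Qed.

Lemma charfun_small t : 0 < v -> 0 <= t ->
  `|cosE p N mu t - expR (- (t ^+ 2 * (v / 2)))| <= ode_err v (3 * b ^+ 2 * mu) (8 * b ^+ 3 * mu) t / v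
  /\ `|sinE p N mu t| <= ode_err v (3 * b ^+ 2 * mu) (8 * b ^+ 3 * mu) t / v.
Proof.
move=> v0 t0.
have C0 : cosE p N mu 0 = 1.
  by rewrite -[RHS](Ex_cst (edge n) p 1); apply: eq_Ex => G; rewrite mul0r cos0.
have S0 : sinE p N mu 0 = 0.
  by rewrite -[RHS](Ex_cst (edge n) p 0); apply: eq_Ex => G; rewrite mul0r sin0.
have M0 : 0 <= 8 * b ^+ 3 * mu.
  rewrite mulr_ge0 ?hmu_ge0 // mulr_ge0 // exprn_ge0 // addr_ge0 // mulr_ge0 ?exprn_ge0 //.
  by case/andP: p01.
have kK := hkap_le p01 tri3 hb.
split; first exact: (ode_cos hC hS C0 S0 v0 M0 kK eC eS t0).
exact: (ode_sin hC hS C0 S0 v0 M0 kK eC eS t0).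
Qed.

End triangle_ode.

(** * Rates in terms of x = sqrt n, y = sqrt p, w = n^(eps/4) *)

Section numerics.
Context {R : realType}.

(** Taylor gives $t^2/6$ up to $t=2$. Beyond, monotonicity gives at least $1-\cos2\ge2/3$, which is
    $16/24$, and $t\le4$. *)
Lemma onem_cos_ge (t : R) : 0 <= t <= pi -> t ^+ 2 / 24 <= 1 - cos t.
Proof.
move=> /andP[t0 tpi].
have small (u : R) : 0 <= u <= 2 -> u ^+ 2 / 6 <= 1 - cos u.
  move=> /andP[u0 u2]; have := cos_taylor3 0 u0.
  rewrite add0r cos0 add0r cos_pihalf mulr0 subr0 mulr1 ler_norml => /andP[_ h].
  have : 0 <= u ^+ 2 * (2 - u) by rewrite mulr_ge0 ?sqr_ge0 // subr_ge0.
  lra.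
have [t2|t2] := leP t 2.
  have := small t; rewrite t0 t2 => /(_ isT); have := sqr_ge0 t; lra.
have c2 := small 2; rewrite lexx ler0n in c2; have := c2 isT => {}c2.
have tc : cos t <= cos 2.
  have pi2 := pi_ge2 R.
  by apply: ltW; rewrite ltr_cos ?in_itv /= ?t0 ?tpi ?pi2 ?ler0n.
have pi4 : pi <= 4 :> R by have := pihalf_lt2 R; lra.
have t4 : t <= 4 by lra.
have : t ^+ 2 <= 16 by nra.
lra.
Qed.

Lemma expRN_le_expr (m : nat) (u : R) : 0 < u -> expR (- u) <= (m%:R / u) ^+ m.
Proof.
move=> u0; case: m => [|m].
  by rewrite expr0 -expR0 ler_expR oppr_le0 ltW.
have m0 : 0 < m.+1%:R :> R by rewrite ltr0n.
rewrite (_ : - u = m.+1%:R * - (u / m.+1%:R)); last by field; rewrite gt_eqF.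
have h : expR (- (u / m.+1%:R)) <= m.+1%:R / u.
  rewrite expRN -[m.+1%:R / u]invrK lef_pV2 ?posrE ?expR_gt0 ?invr_gt0 ?divr_gt0 //.
  by rewrite invf_div; apply: le_trans (expR_ge1Dx _); rewrite lerDr.
by rewrite expRM_natl lerXn2r // nnegrE ?expR_ge0 // divr_ge0 // ltW.
Qed.

Lemma ratio_comp (g q : R) : 0 <= g -> 0 < q ->
  g * (q / (1 + q)) / (4 + 40 * (g * (q / (1 + q)))) = g * q / (4 + 4 * q + 40 * (g * q)).
Proof.
move=> g0 q0; have gq := mulr_ge0 g0 (ltW q0).
have d1 : 1 + q != 0 by rewrite gt_eqF //; lra.
have d2 : 4 + 4 * q + 40 * (g * q) != 0 by rewrite gt_eqF //; lra.
have -> : 4 + 40 * (g * (q / (1 + q))) = (4 + 4 * q + 40 * (g * q)) / (1 + q) by field.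
by field; rewrite d1 d2.
Qed.

Variables (x y w s b mu : R).
Hypothesis x8 : 8 <= x.
Hypothesis y0 : 0 < y.
Hypothesis xy4 : 4 <= x * y ^+ 2.
Hypothesis y2 : y ^+ 2 <= 2^-1.
Hypothesis w1 : 1 <= w.
Hypothesis wx : w <= x.
Hypothesis s0 : 0 < s.
Hypothesis bE : b = 12 * x ^+ 2 * (y ^+ 2) ^+ 2 + 144.
Hypothesis mu_le : mu <= (x ^+ 2) ^+ 3 / 6 * (y ^+ 2) ^+ 3.
Hypothesis mu_ge : (x ^+ 2) ^+ 3 / 12 * (y ^+ 2) ^+ 3 <= mu.
Hypothesis v_le : s ^+ 2 <= mu * b.
Hypothesis v_ge : mu * ((x ^+ 2 - 3) * ((y ^+ 2) ^+ 2 - (y ^+ 2) ^+ 3)) <= s ^+ 2.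

Let x0 : 0 < x. Proof. by move: x8; lra. Qed.
Let w0 : 0 < w. Proof. by move: w1; lra. Qed.
(** [D] is $n^2p^{5/2}$, the order of the standard deviation [s]; [eta] is $n^{-1}p^{-1/2}$, the
    order obtained below for the bound on the skewness. *)
Let D := x ^+ 4 * y ^+ 5.
Let eta := (x ^+ 2 * y)^-1.
Let D0 : 0 < D. Proof. by rewrite mulr_gt0 // exprn_gt0. Qed.
Let eta0 : 0 < eta. Proof. by rewrite invr_gt0 mulr_gt0 // exprn_gt0. Qed.
Let np2 : 16 <= x ^+ 2 * y ^+ 4.
Proof.
rewrite (_ : _ * _ = (x * y ^+ 2) ^+ 2); last by ring.
rewrite (_ : 16 = 4 ^+ 2); last by ring.
by rewrite lerXn2r // nnegrE; move: xy4; lra.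
Qed.
(** Here 21 = 12 + 144/16, by $np^2\ge16$. *)
Let b_le : b <= 21 * (x ^+ 2 * y ^+ 4).
Proof. rewrite bE; move: np2; lra. Qed.
Let b0 : 0 < b.
Proof. by rewrite bE ltr_wpDl // !mulr_ge0 ?exprn_ge0 // ltW. Qed.
Let mu0 : 0 < mu.
Proof. by apply: lt_le_trans mu_ge; rewrite !mulr_gt0 ?invr_gt0 ?exprn_gt0. Qed.

Lemma sigma_le : s <= 2 * D.
Proof.
suff h : s ^+ 2 <= (2 * D) ^+ 2.
  by rewrite ler_pXn2r // nnegrE ?mulr_ge0 // ltW in h.
apply: (le_trans v_le); apply: (le_trans (ler_pM (ltW mu0) (ltW b0) mu_le b_le)).
have : 0 <= x ^+ 8 * y ^+ 10 by rewrite mulr_ge0 ?exprn_ge0 // ltW.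
rewrite /D; lra.
Qed.

Lemma sigma_ge : D / 7 <= s.
Proof.
suff h : (D / 7) ^+ 2 <= s ^+ 2.
  by rewrite ler_pXn2r // nnegrE ?divr_ge0 // ltW in h.
apply: le_trans v_ge.
have x64 : 64 <= x ^+ 2 by move: x8; nra.
have h1 : x ^+ 2 * (y ^+ 4 * 61 / 128) <= (x ^+ 2 - 3) * ((y ^+ 2) ^+ 2 - (y ^+ 2) ^+ 3).
  have h2 : x ^+ 2 * 61 / 64 <= x ^+ 2 - 3 by lra.
  have y40 : 0 <= y ^+ 4 by rewrite exprn_ge0 // ltW.
  have h3 : y ^+ 4 / 2 <= (y ^+ 2) ^+ 2 - (y ^+ 2) ^+ 3.
    by have := ler_wpM2l y40 y2; lra.
  have q1 : 0 <= x ^+ 2 * 61 / 64 by lra.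
  have q2 : 0 <= y ^+ 4 / 2 by lra.
  have := ler_pM q1 q2 h2 h3; lra.
have l1 : 0 <= (x ^+ 2) ^+ 3 / 12 * (y ^+ 2) ^+ 3 by rewrite !mulr_ge0 ?invr_ge0 ?exprn_ge0 // ltW.
have l2 : 0 <= x ^+ 2 * (y ^+ 4 * 61 / 128) by rewrite !mulr_ge0 ?invr_ge0 ?exprn_ge0 // ltW.
have h := ler_pM l1 l2 mu_ge h1; apply: le_trans h.
have : 0 <= x ^+ 8 * y ^+ 10 by rewrite mulr_ge0 ?exprn_ge0 // ltW.
rewrite /D; lra.
Qed.

Let K := 3 * b ^+ 2 * mu.
Let M := 8 * b ^+ 3 * mu.
Variables (k1 m1 : R).
Hypothesis hk1 : 221 * 7 ^+ 3 <= k1.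
Hypothesis hm1 : 12348 * 7 ^+ 4 <= m1.

(** The number 221 rounds up $3\cdot21^2/6$, from the bounds on [b] and [mu], and $7^3$ comes from
    [sigma_ge]. Likewise $12348=8\cdot21^3/6$ in [M_le]. *)
Let K_le : K / s ^+ 3 <= k1 * eta.
Proof.
have s3 : 0 < s ^+ 3 by rewrite exprn_gt0.
rewrite ler_pdivrMr //.
have h1 : b ^+ 2 <= (21 * (x ^+ 2 * y ^+ 4)) ^+ 2.
  by rewrite lerXn2r // nnegrE ?mulr_ge0 ?exprn_ge0 // ltW.
have h2 : (D / 7) ^+ 3 <= s ^+ 3.
  by rewrite lerXn2r ?sigma_ge // nnegrE ?divr_ge0 // ltW.
have h3 := ler_wpM2l (ltW (mulr_gt0 (ltr0n R 221) eta0)) h2.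
have h5 := ler_wpM2r (ltW (mulr_gt0 eta0 s3)) hk1.
rewrite /K; apply: (@le_trans _ _ (221 * eta * D ^+ 3)); last by lra.
rewrite (_ : 221 * eta * D ^+ 3 = 221 * x ^+ 10 * y ^+ 14); last first.
  by rewrite /eta /D; field; rewrite !gt_eqF.
have h4 := ler_pM (exprn_ge0 2 (ltW b0)) (ltW mu0) h1 mu_le.
have : 0 <= x ^+ 10 * y ^+ 14 by rewrite mulr_ge0 ?exprn_ge0 // ltW.
lra.
Qed.

Let M_le : M / s ^+ 4 <= m1 * eta ^+ 2.
Proof.
have s4 : 0 < s ^+ 4 by rewrite exprn_gt0.
rewrite ler_pdivrMr //.
have h1 : b ^+ 3 <= (21 * (x ^+ 2 * y ^+ 4)) ^+ 3.
  by rewrite lerXn2r // nnegrE ?mulr_ge0 ?exprn_ge0 // ltW.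
have h2 : (D / 7) ^+ 4 <= s ^+ 4.
  by rewrite lerXn2r ?sigma_ge // nnegrE ?divr_ge0 // ltW.
have h3 := ler_wpM2l (ltW (mulr_gt0 (ltr0n R 12348) (exprn_gt0 2 eta0))) h2.
have h5 := ler_wpM2r (ltW (mulr_gt0 (exprn_gt0 2 eta0) s4)) hm1.
rewrite /M; apply: (@le_trans _ _ (12348 * eta ^+ 2 * D ^+ 4)); last by lra.
rewrite (_ : 12348 * eta ^+ 2 * D ^+ 4 = 12348 * x ^+ 12 * y ^+ 18); last first.
  by rewrite /eta /D; field; rewrite !gt_eqF.
have h4 := ler_pM (exprn_ge0 3 (ltW b0)) (ltW mu0) h1 mu_le.
have : 0 <= x ^+ 12 * y ^+ 18 by rewrite mulr_ge0 ?exprn_ge0 // ltW.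
lra.
Qed.

(** With $T=s\theta_1$ the error is a combination of $TK/s^3$, $T^4KM/s^7$ and $T^3M/s^4$. Each is a
    multiple of $q=yw/x$ by a factor of at most $w^3$, up to constants. *)
Lemma small_err (th1 v : R) : v = s ^+ 2 -> th1 = x * y ^+ 2 * w / s ->
  s * (ode_err v K M th1 / v * th1) <= (2 * k1 + 2 * k1 * m1 + m1) * (w ^+ 4 * (y / x)).
Proof.
move=> vE tE.
have sq : Num.sqrt v = s by rewrite vE sqrtr_sqr gtr0_norm.
pose T := x * y ^+ 2 * w.
have T0 : 0 < T by rewrite /T !mulr_gt0 // exprn_gt0.
have -> : s * (ode_err v K M th1 / v * th1) =
   2 * (T * (K / s ^+ 3)) + 2 * (T ^+ 4 * ((K / s ^+ 3) * (M / s ^+ 4))) + T ^+ 3 * (M / s ^+ 4).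
  by rewrite /ode_err sq vE tE /T; field; rewrite gt_eqF.
have K0 : 0 <= K / s ^+ 3 by rewrite divr_ge0 ?mulr_ge0 ?exprn_ge0 // ltW.
have M0 : 0 <= M / s ^+ 4 by rewrite divr_ge0 ?mulr_ge0 ?exprn_ge0 // ltW.
have k10 : 0 <= k1 by move: hk1; lra.
have m10 : 0 <= m1 by move: hm1; lra.
have h1 := ler_wpM2l (ltW T0) K_le.
have h2 := ler_wpM2l (exprn_ge0 4 (ltW T0)) (ler_pM K0 M0 K_le M_le).
have h3 := ler_wpM2l (exprn_ge0 3 (ltW T0)) M_le.
pose q := y * w / x.
have q0 : 0 < q by rewrite /q !mulr_gt0 // invr_gt0.
have e1 : T * (k1 * eta) = k1 * q by rewrite /T /eta /q; field; rewrite !gt_eqF.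
have e2 : T ^+ 4 * (k1 * eta * (m1 * eta ^+ 2)) = k1 * m1 * (q * (y ^+ 4 * w ^+ 3 / x)).
  by rewrite /T /eta /q; field; rewrite !gt_eqF.
have e3 : T ^+ 3 * (m1 * eta ^+ 2) = m1 * (q * (y ^+ 3 * w ^+ 2)).
  by rewrite /T /eta /q; field; rewrite !gt_eqF.
have e4 : w ^+ 4 * (y / x) = q * w ^+ 3 by rewrite /q; field; rewrite gt_eqF.
rewrite e1 in h1; rewrite e2 in h2; rewrite e3 in h3; rewrite e4.
have y1 : y <= 1.
  by rewrite -(@ler_pXn2r _ 2%N) ?nnegrE // ?expr1n; [move: y2; lra|exact: ltW].
have w31 : 1 <= w ^+ 3 by rewrite exprn_ege1.
have w30 : 0 <= w ^+ 3 by rewrite exprn_ge0 // ltW.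
have g1 : q <= q * w ^+ 3 by rewrite ler_peMr // ltW.
have g2 : y ^+ 4 * w ^+ 3 / x <= w ^+ 3.
  rewrite ler_pdivrMr // mulrC ler_wpM2l //.
  by apply: (@le_trans _ _ 1); [rewrite exprn_ile1 // ltW|move: x8; lra].
have g3 : y ^+ 3 * w ^+ 2 <= w ^+ 3.
  apply: (@le_trans _ _ (1 * w ^+ 2)); last by rewrite mul1r; apply: ler_weXn2l.
  by rewrite ler_wpM2r ?exprn_ge0 ?exprn_ile1 // ltW.
have g2' := ler_wpM2l (mulr_ge0 k10 m10) (ler_wpM2l (ltW q0) g2).
have g3' := ler_wpM2l m10 (ler_wpM2l (ltW q0) g3).
have g1' := ler_wpM2l k10 g1.
lra.
Qed.

Let y1 : y <= 1.
Proof.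
by rewrite -(@ler_pXn2r _ 2%N) ?nnegrE // ?expr1n; [move: y2; lra|exact: ltW].
Qed.

Let xy1 : 1 <= x * y.
Proof.
have : x * y * y <= x * y * 1 by rewrite ler_wpM2l // mulr_ge0 // ltW.
by move: xy4; lra.
Qed.

(** Over the range [z0] may be as small as a multiple of $w^2/(n^2p)$. Multiplied by $np$, this
    gains about $w^2/n$ for each of the [k] stars, hence an exponent of order $w^2$ in all. *)
Lemma large_rate (k : nat) (th z0 z : R) :
  x ^+ 2 / 4 <= k%:R -> x * y ^+ 2 * w / s <= th <= pi ->
  z0 = (y ^+ 2) ^+ 2 * (1 - y ^+ 2) * (1 - cos th) * k%:R ->
  z = y ^+ 2 * (1 - y ^+ 2) * k%:R * (z0 / (1 + z0)) ->
  expR (- (y ^+ 2 * k%:R / 12)) + (1 - z / (4 + 40 * z)) ^+ k <=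
  expR (- (x / 12)) + expR (- (w ^+ 2 / 400 ^+ 2)).
Proof.
move=> hk /andP[th1 thpi] z0E zE.
have y20 : 0 <= y ^+ 2 by rewrite exprn_ge0 // ltW.
have q2 : 2^-1 <= 1 - y ^+ 2 by move: y2; lra.
have th0 : 0 <= th by apply: le_trans th1; rewrite divr_ge0 ?mulr_ge0 ?exprn_ge0 // ltW.
have hc : th ^+ 2 / 24 <= 1 - cos th by apply: onem_cos_ge; rewrite th0.
have x2 : 0 <= x ^+ 2 / 4 by rewrite divr_ge0 ?exprn_ge0 // ltW.
apply: lerD.
  rewrite ler_expR lerN2 ler_pM2r ?invr_gt0 //.
  have := ler_wpM2l y20 hk; have := ler_wpM2l (ltW x0) xy4; lra.
have thl : w / (2 * x ^+ 3 * y ^+ 3) <= th.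
  apply: le_trans th1; rewrite ler_pdivlMr //.
  have h : 0 <= w / (2 * x ^+ 3 * y ^+ 3) by rewrite divr_ge0 ?mulr_ge0 ?exprn_ge0 // ltW.
  apply: (le_trans (ler_wpM2l h sigma_le)).
  by rewrite le_eqVlt; apply/orP; left; apply/eqP; rewrite /D; field; rewrite !gt_eqF.
have th2 : w ^+ 2 / (4 * x ^+ 6 * y ^+ 6) <= th ^+ 2.
  rewrite (_ : _ / _ = (w / (2 * x ^+ 3 * y ^+ 3)) ^+ 2); last by field; rewrite !gt_eqF.
  by rewrite lerXn2r // nnegrE divr_ge0 ?mulr_ge0 ?exprn_ge0 // ltW.
have p46 : 0 < x ^+ 4 * y ^+ 2 := mulr_gt0 (exprn_gt0 4 x0) (exprn_gt0 2 y0).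
pose u2 := w ^+ 2 / (x ^+ 4 * y ^+ 2).
have u20 : 0 < u2 := divr_gt0 (exprn_gt0 2 w0) p46.
(* The constant is $768=2\cdot4\cdot24\cdot4$, from $1-p\ge\frac12$, [sigma_le], [onem_cos_ge] and
   $k\ge n/4$. The factor $192=8\cdot6\cdot4$ collects the losses in [a], in [ha] and again in
   [k]. *)
have [c [c100 cE c192]] : exists c : R, [/\ 100 <= c, c = 3 * 16 ^+ 2 & c * 192 <= 400 ^+ 2].
  by exists (3 * 16 ^+ 2); split; lra.
have c0 : 0 < c by lra.
have ci0 : 0 < c^-1 by rewrite invr_gt0.
have ci1 : c^-1 <= 100^-1 by rewrite lef_pV2 ?posrE.
pose ze := u2 / c.
have ze0 : 0 < ze by rewrite /ze divr_gt0.
have zeE : ze = (y ^+ 2) ^+ 2 * 2^-1 * (w ^+ 2 / (4 * x ^+ 6 * y ^+ 6) / 24) * (x ^+ 2 / 4).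
  by rewrite /ze /u2 cE; field; rewrite !gt_eqF.
have zz : ze <= z0.
  have t0 : 0 <= w ^+ 2 / (4 * x ^+ 6 * y ^+ 6) by rewrite divr_ge0 ?mulr_ge0 ?exprn_ge0 // ltW.
  have t1 : 0 <= (y ^+ 2) ^+ 2 by rewrite exprn_ge0.
  have t2 : 0 <= (y ^+ 2) ^+ 2 * 2^-1 by lra.
  have t3 : 0 <= w ^+ 2 / (4 * x ^+ 6 * y ^+ 6) / 24 by lra.
  have t4 : (y ^+ 2) ^+ 2 * 2^-1 <= (y ^+ 2) ^+ 2 * (1 - y ^+ 2) by rewrite ler_wpM2l.
  have t5 : w ^+ 2 / (4 * x ^+ 6 * y ^+ 6) / 24 <= 1 - cos th by apply: le_trans hc; lra.
  by rewrite zeE z0E; exact: (ler_pM (mulr_ge0 t2 t3) x2 (ler_pM t2 t3 t4 t5) hk).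
have k0 : x ^+ 2 * y ^+ 2 / 8 <= y ^+ 2 * (1 - y ^+ 2) * k%:R.
  rewrite [leLHS](_ : _ = y ^+ 2 * 2^-1 * (x ^+ 2 / 4)); last by field.
  have t1 : 0 <= y ^+ 2 * 2^-1 by lra.
  exact: (ler_pM t1 x2 (ler_wpM2l y20 q2) hk).
have k00 : 0 <= x ^+ 2 * y ^+ 2 / 8 by rewrite divr_ge0 ?mulr_ge0 ?exprn_ge0 // ltW.
pose z' := x ^+ 2 * y ^+ 2 / 8 * (ze / (1 + ze)).
have rz : ze / (1 + ze) <= z0 / (1 + z0).
  by have := @ratio_mono _ 1 1 ze z0 ltr01 ler01 (ltW ze0) zz; rewrite !mul1r.
have ze1 : 0 <= ze / (1 + ze) by rewrite divr_ge0 ?addr_ge0 // ltW.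
have z'0 : 0 <= z' by rewrite /z' mulr_ge0.
have z'z : z' <= z by rewrite zE; apply: ler_pM.
have h := @ratio_mono R 4 40 z' z _ _ z'0 z'z.
have {h} : z' / (4 + 40 * z') <= z / (4 + 40 * z) by apply: h.
set rho := z / (4 + 40 * z) => hrho.
have z0' : 0 <= z by apply: le_trans z'z.
have rho1 : rho <= 1 by rewrite /rho ler_pdivrMr; lra.
pose u := w ^+ 2 / x ^+ 2.
have u0 : 0 < u := divr_gt0 (exprn_gt0 2 w0) (exprn_gt0 2 x0).
pose a := u / c / 8.
have aE : z' / (4 + 40 * z') = a / (4 + 4 * ze + 40 * a).
  have -> : a = x ^+ 2 * y ^+ 2 / 8 * ze by rewrite /a /u /ze /u2; field; rewrite !gt_eqF.
  exact: ratio_comp.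
have wx2 : w ^+ 2 <= x ^+ 2 by rewrite lerXn2r ?nnegrE // ltW.
have a0 : 0 < a by rewrite /a divr_gt0 // divr_gt0.
have u1 : u <= 1 by rewrite /u ler_pdivrMr ?exprn_gt0 // mul1r.
have u21 : u2 <= 1.
  rewrite /u2 ler_pdivrMr // mul1r (_ : x ^+ 4 * y ^+ 2 = x ^+ 2 * (x * y) ^+ 2); last by ring.
  by apply: (le_trans wx2); rewrite ler_peMr ?exprn_ge0 ?exprn_ege1 // ltW.
have ha : a / 6 <= rho.
  apply: le_trans hrho; rewrite aE ler_pM2l // lef_pV2 ?posrE //.
    have b1 : u / c <= 1 * 100^-1 by apply: ler_pM => //; apply: ltW.
    have b2 : ze <= 1 * 100^-1 by apply: ler_pM => //; apply: ltW.
    by rewrite /a; lra.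
  by move: ze0 a0; lra.
have rho0 : 0 <= rho by apply: le_trans ha; rewrite divr_ge0 // ltW.
apply: (@le_trans _ _ (expR (- rho) ^+ k)).
  by rewrite lerXn2r ?nnegrE ?expR_ge0 ?subr_ge0 // expR_ge1Dx.
rewrite -expRM_natl ler_expR mulrN lerN2.
have a6 : 0 <= a / 6 by rewrite divr_ge0 // ltW.
apply: le_trans (ler_pM x2 a6 hk ha).
rewrite (_ : x ^+ 2 / 4 * (a / 6) = w ^+ 2 / (c * 192)); last first.
  by rewrite /a /u; field; rewrite !gt_eqF.
rewrite ler_wpM2l ?exprn_ge0 //; first exact: ltW.
have c1 : 0 < c * 192 by lra.
have c2 : 0 < 400 ^+ 2 :> R by lra.
by rewrite lef_pV2.
Qed.

(** Multiplied by $\sigma=O(n^2p^{5/2})$, a bound $O(n^{-5/2})$ on the far range becomes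
    $O(n^{-1/2}p^{5/2})$; this is the origin of the exponents 5 and 10 of [x]. *)
Lemma final_rate (m : nat) (A th1 r e2 : R) :
  x ^+ 10 <= (w ^+ 2) ^+ m ->
  s * (A * th1) <= (2 * k1 + 2 * k1 * m1 + m1) * (w ^+ 4 * (y / x)) ->
  0 <= r -> e2 <= expR (- (w ^+ 2 / 400 ^+ 2)) ->
  s * (A * th1 + 2 * (r / x ^+ 5)) + (2 + 2 * expR 1) * e2 <=
  (2 * k1 + 2 * k1 * m1 + m1 + 4 * r + (2 + 2 * expR 1) * (m%:R * 400 ^+ 2) ^+ m) *
  (w ^+ 4 * (y / x)).
Proof.
move=> hm hA r0 he2.
have yx0 : 0 < y / x by rewrite divr_gt0.
have w41 : 1 <= w ^+ 4 by rewrite exprn_ege1.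
have tgt : y / x <= w ^+ 4 * (y / x) by rewrite ler_peMl // ltW.
have e1 : 0 < expR 1 :> R := expR_gt0 1.
have hB : s * (2 * (r / x ^+ 5)) <= 4 * r * (w ^+ 4 * (y / x)).
  have rx : 0 <= 2 * (r / x ^+ 5) by rewrite mulr_ge0 ?divr_ge0 ?exprn_ge0 // ltW.
  apply: (le_trans (ler_wpM2r rx sigma_le)).
  rewrite [leLHS](_ : _ = 4 * r * (y ^+ 4 * (y / x))); last by rewrite /D; field; rewrite gt_eqF.
  rewrite ler_wpM2l ?mulr_ge0 //; apply: le_trans tgt.
  by rewrite ler_piMl ?exprn_ile1 // ltW.
have w20 : 0 < w ^+ 2 by rewrite exprn_gt0.
have c0 : 0 < 400 ^+ 2 :> R by lra.
move: he2; set c := 400 ^+ 2 in c0 * => he2.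
have hE : e2 <= (m%:R * c) ^+ m * (w ^+ 4 * (y / x)).
  apply: (le_trans he2).
  apply: (le_trans (expRN_le_expr m (divr_gt0 w20 c0))).
  have -> : m%:R / (w ^+ 2 / c) = m%:R * c * (w ^+ 2)^-1 by field; rewrite !gt_eqF.
  rewrite exprMn exprVn ler_wpM2l ?(exprn_ge0 _ (mulr_ge0 (ler0n _ m) (ltW c0))) //.
  apply: (@le_trans _ _ (x ^+ 10)^-1).
    by rewrite lef_pV2 ?posrE ?exprn_gt0.
  apply: le_trans tgt; rewrite ler_pdivlMr // mulrC ler_pdivrMr ?exprn_gt0 //.
  rewrite (_ : y * x ^+ 10 = x * (x ^+ 8 * (x * y))); last by ring.
  rewrite ler_peMr //; first exact: ltW.
  by rewrite mulr_ege1 // exprn_ege1 //; move: x8; lra.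
rewrite mulrDr !mulrDl -!addrA; rewrite -!mulrDl.
have e0 : 0 <= 2 + 2 * expR 1 :> R by rewrite addr_ge0 // mulr_ge0 // ltW.
have := ler_wpM2l e0 hE; rewrite !mulrA in hA hB *; lra.
Qed.

End numerics.

(** * The local limit theorem *)

Local Open Scope classical_set_scope.
Local Open Scope ring_scope.

(** * Disjoint blocks of consecutive vertices *)

Section blocks.
Variables (n k : nat).

Definition block (j : nat) : {set 'I_n} := [set i : 'I_n | (j * k <= i < j.+1 * k)%N]%SET.

Lemma block_disj j j' i : i \in block j -> i \in block j' -> j = j'.
Proof.
rewrite !inE => /andP[h1 h2] /andP[h3 h4].
have a1 : (j * k < j'.+1 * k)%N by apply: leq_ltn_trans h4.
have a2 : (j' * k < j.+1 * k)%N by apply: leq_ltn_trans h2.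
by move: a1 a2; rewrite !ltn_mul2r => /andP[_ b1] /andP[_ b2]; lia.
Qed.

Hypothesis kn : (3 * k <= n)%N.

Lemma card_block j : (j < 3)%N -> #|block j| = k.
Proof.
move=> j3; have jk (i : 'I_k) : (j * k + i < n)%N.
  by apply: leq_trans kn; have := ltn_ord i; nia.
pose f (i : 'I_k) := Ordinal (jk i).
rewrite -[RHS](card_ord k) -cardsT -(card_imset [set: 'I_k]%SET (f := f)); last first.
  by move=> a b /(congr1 val) /= /addnI /val_inj.
apply: eq_card => i; rewrite inE; apply/idP/imsetP => [/andP[h1 h2]|[a _ ->]].
  have ik : (i - j * k < k)%N by move: h2; rewrite mulSn; lia.
  by exists (Ordinal ik) => //; apply: val_inj => /=; rewrite subnKC.
by rewrite /= leq_addr mulSn addnC ltn_add2r ltn_ord.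
Qed.

End blocks.

(** * Mean and variance of the triangle count *)

Section triangle_moments.
Context {R : realType} (n : nat) (p : R).
Hypothesis p01 : 0 <= p <= 1.

Lemma hmu_tri : hmu (@tri n) p = 'C(n, 3)%:R * p ^+ 3.
Proof.
rewrite /hmu; under eq_bigr => T _ do rewrite card_tri.
by rewrite sumr_const -[LHS]mulr_natl card_triples.
Qed.

Lemma hvar_tri_ge :
  hmu (@tri n) p * ((n%:R - 3) * (p ^+ 2 - p ^+ 3)) <= hvar (@tri n) p.
Proof.
rewrite /hmu mulr_suml; apply: ler_sum => T _; rewrite ler_wpM2l ?Ex_gain_tri_ge //.
by rewrite exprn_ge0 //; case/andP: p01.
Qed.

Lemma hvar_tri_le :
  hvar (@tri n) p <= hmu (@tri n) p * (12 * n%:R * p ^+ 2 + 144).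
Proof.
apply: (hvar_le p01); last exact: triple_weight12.
by move=> T; rewrite card_tri.
Qed.

Lemma bin3_bounds : (64 < n)%N ->
  n%:R ^+ 3 / 12 <= ('C(n, 3))%:R :> R /\ ('C(n, 3))%:R <= n%:R ^+ 3 / 6 :> R.
Proof.
move=> n64.
have E6 : ('C(n, 3))%:R * 6 = n%:R * (n%:R - 1) * (n%:R - 2) :> R.
  transitivity (('C(n, 3) * 3`!)%N%:R : R); first by rewrite natrM.
  rewrite bin_ffact !ffactnS ffactn0 muln1 -!subn1 -subnDA !natrM !natrB ?mulrA //;
    by apply: leq_trans n64.
have n0 : 64 <= n%:R :> R by rewrite (ler_nat R 64); apply: ltnW.
move: E6 n0; move: (n%:R : R) (('C(n, 3))%:R : R) => a c E6 a0.
split.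
  have : 0 <= a * (a * (a - 64)) by rewrite !mulr_ge0 ?subr_ge0 //; lra.
  nra.
nra.
Qed.

End triangle_moments.

Lemma ode_err_mono (R : realType) (v K M t u : R) :
  0 < v -> 0 <= K -> 0 <= M -> 0 <= t <= u -> ode_err v K M t <= ode_err v K M u.
Proof.
move=> v0 K0 M0 /andP[t0 tu]; rewrite /ode_err.
have u0 : 0 <= u by apply: le_trans tu.
have h2 : t ^+ 2 <= u ^+ 2 by rewrite lerXn2r.
have h3 : t ^+ 3 <= u ^+ 3 by rewrite lerXn2r.
rewrite -!addrA lerD2l; apply: lerD; last by rewrite ler_wpM2r.
by rewrite ler_pM2r ?invr_gt0 // ler_wpM2r // ler_wpM2r // ler_pM2l.
Qed.

Lemma leq_divn3 n : (64 < n)%N -> (n <= n %/ 3 * 4)%N.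
Proof.
have := divn_eq n 3; have := ltn_pmod n (isT : (0 < 3)%N).
by move: (n %/ 3)%N (n %% 3)%N => q r; lia.
Qed.

Section rate.
Context {R : realType}.

Lemma triangles_charfun_large (n k : nat) (p th : R) :
  0 <= p <= 1 -> (0 < k)%N -> (3 * k <= n)%N ->
  1 <= p ^+ 2 * (1 - p) * k%:R ->
  forall z0 z, z0 = p ^+ 2 * (1 - p) * (1 - cos th) * k%:R ->
  z = p * (1 - p) * k%:R * (z0 / (1 + z0)) ->
  cosE p (@num_triangles n) (hmu (@tri n) p) th ^+ 2 +
  sinE p (@num_triangles n) (hmu (@tri n) p) th ^+ 2
  <= expR (- (p * k%:R / 12)) + (1 - z / (4 + 40 * z)) ^+ k.
Proof.
move=> p01 k0 kn pk z0 z z0E zE.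
have [t0 _] : exists t0 : triple n, true.
  have : (0 < #|{: triple n}|)%N.
    by rewrite card_triples bin_gt0; apply: leq_trans kn; rewrite -[X in (X <= _)%N]muln1 leq_mul2l.
  by move=> /card_gt0P[t0 _]; exists t0.
have [e0 _] : exists e0 : edge n, true.
  have : (0 < #|tri t0|)%N by rewrite card_tri.
  by move=> /card_gt0P[e0 _]; exists e0.
have dis i j x : i != j -> x \in @block n k i -> x \in @block n k j -> False.
  by move=> ij hi hj; move: ij; rewrite (block_disj hi hj) eqxx.
rewrite cosEE sinEE.
exact: (@charfun_large R n (block n k 0) (block n k 1) (block n k 2) e0 t0
  (fun x => dis 0%N 1%N x isT) (fun x => dis 0%N 2%N x isT) (fun x => dis 1%N 2%N x isT)
  p th (hmu (@tri n) p) k p01 k0 (@card_block n k kn 0 isT) (@card_block n k kn 1 isT) (@card_block n k kn 2 isT)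
  pk z0 z z0E zE).
Qed.

(** The constant [r] is chosen so that $r^2/x^{10}$ dominates both exponentials of [large_rate], by
    $e^{-u}\le(j/u)^j$ with $j=10$ for the first and $j=m$ for the second. *)
Lemma triangles_llt (n : nat) (p x y w k1 m1 : R) (m : nat) :
  8 < x -> 0 < y -> 4 < x * y ^+ 2 -> y ^+ 2 < 2^-1 -> 1 <= w -> w <= x ->
  n%:R = x ^+ 2 -> p = y ^+ 2 -> x ^+ 10 <= (w ^+ 2) ^+ m ->
  let mu := hmu (@tri n) p in
  let v := hvar (@tri n) p in
  let r := Num.sqrt ((10 * 12) ^+ 10 + (m%:R * 400 ^+ 2) ^+ m) in
  0 < v /\
  forall k : nat, forall u : R, u = (k%:R - mu) / Num.sqrt v ->
  221 * 7 ^+ 3 <= k1 -> 12348 * 7 ^+ 4 <= m1 ->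
  `|(Num.sqrt (2 * pi))^-1 * expR (- u ^+ 2 / 2) -
    Num.sqrt v * Ex p (fun G : {set edge n} => (num_triangles G == k)%:R)|
  <= (2 * k1 + 2 * k1 * m1 + m1 + 4 * r + (2 + 2 * expR 1) * (m%:R * 400 ^+ 2) ^+ m) *
     (w ^+ 4 * (y / x)).
Proof.
move=> x8' y0 xy4' y2' w1 wx nE pE hm mu v r.
have x8 := ltW x8'; have xy4 := ltW xy4'; have y2 := ltW y2'.
have x0 : 0 < x by lra.
have w0 : 0 < w by lra.
have p01 : 0 <= p <= 1 by rewrite pE exprn_ge0 ?ltW //=; lra.
have n64 : (64 < n)%N.
  by rewrite -(ltr_nat R) nE; nra.
pose b : R := 12 * n%:R * p ^+ 2 + 144.
have bE : b = 12 * x ^+ 2 * (y ^+ 2) ^+ 2 + 144 by rewrite /b nE pE.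
have [c1 c2] := @bin3_bounds R n n64.
have p30 : 0 <= p ^+ 3 by rewrite exprn_ge0 //; case/andP: p01.
have mu_le : mu <= (x ^+ 2) ^+ 3 / 6 * (y ^+ 2) ^+ 3.
  by rewrite /mu hmu_tri -nE -pE ler_wpM2r.
have mu_ge : (x ^+ 2) ^+ 3 / 12 * (y ^+ 2) ^+ 3 <= mu.
  by rewrite /mu hmu_tri -nE -pE ler_wpM2r.
have mu0 : 0 < mu.
  by apply: lt_le_trans mu_ge; rewrite mulr_gt0 ?divr_gt0 ?exprn_gt0.
have v_ge : mu * ((x ^+ 2 - 3) * ((y ^+ 2) ^+ 2 - (y ^+ 2) ^+ 3)) <= v.
  by rewrite -nE -pE; exact: hvar_tri_ge.
have v0 : 0 < v.
  apply: lt_le_trans v_ge; rewrite mulr_gt0 // mulr_gt0 //; first by nra.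
  have y4 : 0 < y ^+ 4 by rewrite exprn_gt0.
  by have := ler_wpM2l (ltW y4) y2; lra.
split => // k u uE.
pose s := Num.sqrt v.
have s0 : 0 < s by rewrite sqrtr_gt0.
have sv : v = s ^+ 2 by rewrite sqr_sqrtr // ltW.
have v_le : s ^+ 2 <= mu * b by rewrite -sv; exact: hvar_tri_le.
rewrite {1}sv in v_ge.
have b0 : 0 <= b by rewrite /b nE pE addr_ge0 // !mulr_ge0 ?exprn_ge0 // ltW.
have Dge := sigma_ge x8 y0 y2 s0 mu_ge v_ge.
pose K := 3 * b ^+ 2 * mu; pose M := 8 * b ^+ 3 * mu.
have K0 : 0 <= K by rewrite /K mulr_ge0 ?hmu_ge0 // mulr_ge0 ?exprn_ge0.
have M0 : 0 <= M by rewrite /M mulr_ge0 ?hmu_ge0 // mulr_ge0 ?exprn_ge0.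
pose th1 := x * y ^+ 2 * w / s.
have th0 : 0 <= th1 by rewrite /th1 divr_ge0 ?mulr_ge0 ?exprn_ge0 // ltW.
have xy2 : 4 <= x * y.
  have : x * y * y <= x * y * 1.
    rewrite ler_wpM2l // ?mulr_ge0 // ?ltW //.
    by nra.
  lra.
have th1pi : th1 <= pi.
  apply: le_trans (pi_ge2 R); rewrite /th1 ler_pdivrMr //.
  apply: (@le_trans _ _ (2 * (x ^+ 4 * y ^+ 5 / 7))); last by rewrite ler_pM2l.
  have h1 : 16 <= (x * y ^+ 2) * (x * y) by nra.
  have xyy : 0 <= x ^+ 2 * y ^+ 2 by rewrite mulr_ge0 ?exprn_ge0 // ltW.
  have h2 : x * y ^+ 2 * w <= x * y ^+ 2 * x by rewrite ler_wpM2l // ltW // mulr_gt0 ?exprn_gt0.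
  have := ler_wpM2l xyy h1; lra.
have thv : th1 ^+ 2 * (v / 2) = (x * y ^+ 2) ^+ 2 * w ^+ 2 / 2.
  by rewrite /th1 sv; field; rewrite gt_eqF.
have xyq : 16 <= (x * y ^+ 2) ^+ 2 by nra.
have w21 : 1 <= w ^+ 2 by rewrite exprn_ege1.
have thv1 : 8 * w ^+ 2 <= th1 ^+ 2 * (v / 2).
  by have := ler_wpM2r (le_trans ler01 w21) xyq; rewrite thv; lra.
pose A := ode_err v K M th1 / v.
have small t : 0 <= t <= th1 ->
    `|cosE p (@num_triangles n) mu t - expR (- (t ^+ 2 * (v / 2)))| <= A /\
    `|sinE p (@num_triangles n) mu t| <= A.
  move=> /andP[t0 tt]; have [h1 h2] := charfun_small p01 v0 t0.
  have h3 : ode_err v K M t / v <= A.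
    by rewrite /A ler_pM2r ?invr_gt0 // ode_err_mono // t0.
  by split; [exact: (le_trans h1 h3)|exact: (le_trans h2 h3)].
have A0 : 0 <= A.
  have [|h _] := small th1; first by rewrite th0 lexx.
  by apply: le_trans h.
pose kk := (n %/ 3)%N.
have kk3 : (3 * kk <= n)%N by rewrite mulnC leq_trunc_div.
have kk4 : x ^+ 2 / 4 <= kk%:R.
  rewrite -nE ler_pdivrMr // -natrM ler_nat.
  exact: leq_divn3.
have kk0 : (0 < kk)%N by rewrite divn_gt0 //; apply: leq_trans n64.
(* The product is at least $16\cdot\frac12\cdot\frac14=2$, by $np^2\ge16$, $1-p\ge\frac12$ and
   [kk4]. *)
have pk : 1 <= p ^+ 2 * (1 - p) * kk%:R.
  have q1 : 2^-1 <= 1 - p by rewrite pE; lra.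
  have q2 : 0 <= p ^+ 2 by rewrite exprn_ge0 //; case/andP: p01.
  have q3 : 0 <= x ^+ 2 / 4 by rewrite divr_ge0 ?exprn_ge0 // ltW.
  have q4 : 0 <= p ^+ 2 * 2^-1 by lra.
  apply: le_trans (ler_pM q4 q3 (ler_wpM2l q2 q1) kk4).
  by rewrite pE; move: xyq; lra.
have c10 : 0 <= (10 * 12 : R) ^+ 10 by rewrite exprn_ge0 // mulr_ge0.
have c20 : 0 <= (m%:R * 400 ^+ 2 : R) ^+ m by exact: exprn_ge0 _ (mulr_ge0 (ler0n _ m) (exprn_ge0 2 (ler0n _ 400))).
have large t : th1 <= t <= pi ->
    cosE p (@num_triangles n) mu t ^+ 2 + sinE p (@num_triangles n) mu t ^+ 2 <= (r / x ^+ 5) ^+ 2.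
  move=> tt; apply: (le_trans (triangles_charfun_large (th := t) p01 kk0 kk3 pk erefl erefl)).
  rewrite pE; apply: (le_trans (large_rate x8 y0 xy4 y2 w1 wx s0 bE mu_le mu_ge v_le kk4 tt erefl erefl)).
  rewrite expr_div_n sqr_sqrtr ?addr_ge0 // -exprM mulrDl; apply: lerD.
    have := expRN_le_expr 10 (divr_gt0 x0 (ltr0n R 12)).
    by rewrite (_ : 10 / (x / 12) = 10 * 12 / x) ?expr_div_n //; field; rewrite gt_eqF.
  have w20 : 0 < w ^+ 2 by rewrite exprn_gt0.
  have d0 : 0 < 400 ^+ 2 :> R by lra.
  apply: (le_trans (expRN_le_expr m (divr_gt0 w20 d0))).
  move: (400 ^+ 2 : R) d0 c20 => c d0 c20.
  have -> : m%:R / (w ^+ 2 / c) = m%:R * c / w ^+ 2 by field; rewrite !gt_eqF.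
  by rewrite expr_div_n ler_wpM2l // lef_pV2 ?posrE ?exprn_gt0.
have thv2 : 1 <= th1 ^+ 2 * (v / 2) by lra.
have thv3 : w ^+ 2 / 400 ^+ 2 <= th1 ^+ 2 * (v / 2) by lra.
have r0 : 0 <= r / x ^+ 5 by rewrite divr_ge0 ?sqrtr_ge0 ?exprn_ge0 // ltW.
have th01 : 0 <= th1 <= pi by rewrite th0.
move=> hk1 hm1; have := fourier_inversion v0 A0 r0 th01 thv2 small large uE.
move/le_trans; apply; rewrite -/s.
apply: (final_rate x8 y0 xy4 y2 w1 s0 bE mu_le mu_ge v_le hm).
- exact: (small_err x8 y0 xy4 y2 w1 s0 bE mu_le mu_ge v_ge hk1 hm1 sv (erefl th1)).
- exact: sqrtr_ge0.
- by rewrite ler_expR lerN2.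
Qed.

End rate.

(** In these scales all the powers that occur have natural exponents. The two bounds on [p] together
    force $\sqrt n>8$, so that there is nothing to prove for small [n]. *)
Lemma rate_scales (R : realType) (eps p : R) (n m : nat) : 0 < eps < 1 ->
  10 <= m%:R * eps -> (0 < n)%N -> 4 * n%:R `^ (- (1 / 2)) < p -> p < 1 / 2 ->
  exists x y w : R,
    ([/\ 8 < x, 0 < y, 4 < x * y ^+ 2 & y ^+ 2 < 2^-1] /\
     [/\ 1 <= w, w <= x & x ^+ 10 <= (w ^+ 2) ^+ m]) /\
    [/\ n%:R = x ^+ 2, p = y ^+ 2 &
        n%:R `^ (- (1 / 2) + eps) * p `^ (1 / 2) = w ^+ 4 * (y / x)].
Proof.
move=> /andP[e0 e1] hm n0 p4 p2.
have N0 : 0 < n%:R :> R by rewrite ltr0n.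
have N1 : 1 <= n%:R :> R by rewrite ler1n.
pose x : R := Num.sqrt n%:R; pose y : R := Num.sqrt p; pose w := n%:R `^ (eps / 4).
have x0 : 0 < x by rewrite sqrtr_gt0.
have nx : n%:R = x ^+ 2 by rewrite sqr_sqrtr // ltW.
have xE : n%:R `^ (1 / 2) = x by rewrite mul1r powR12_sqrt // ltW.
rewrite powRN xE in p4.
have p0 : 0 < p by apply: lt_trans p4; rewrite mulr_gt0 // invr_gt0.
have y0 : 0 < y by rewrite sqrtr_gt0.
have py : p = y ^+ 2 by rewrite sqr_sqrtr // ltW.
have yE : p `^ (1 / 2) = y by rewrite mul1r powR12_sqrt // ltW.
have xy4 : 4 < x * y ^+ 2 by rewrite -py mulrC -ltr_pdivrMr.
have y2 : y ^+ 2 < 2^-1 by rewrite -py -[2^-1]mul1r.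
have x8 : 8 < x.
  have : x * y ^+ 2 < x * 2^-1 by rewrite ltr_pM2l.
  lra.
have w1 : 1 <= w by rewrite -(powRr0 n%:R) ler_powR // divr_ge0 // ltW.
have wx : w <= x by rewrite -xE /w ler_powR //; lra.
have w4 : w ^+ 4 = n%:R `^ eps.
  rewrite -powR_mulrn ?powR_ge0 // /w -powRrM; congr (_ `^ _); lra.
have wm : x ^+ 10 <= (w ^+ 2) ^+ m.
  rewrite -exprM -xE /w -!powR_mulrn ?powR_ge0 // -!powRrM ler_powR // natrM.
  by move: hm; lra.
exists x, y, w; split; first by [].
split => //.
rewrite powRD; last by apply/implyP => _; rewrite gt_eqF.
by rewrite powRN xE yE w4; ring.
Qed.

Theorem theorem1p1 (R : realType) (eps : R) (eps01 : 0 < eps < 1) :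
  exists C : R, 0 < C /\
  forall (n : nat) (p : R), (0 < n)%N ->
    4 * n%:R `^ (- (1 / 2)) < p -> p < 1 / 2 ->
  let P : probability (graph n) R := @gnp R n p in
  let X : graph n -> R := fun G => (num_triangles G)%:R in
  let mu : R := fine 'E_P[X] in
  let sigma : R := Num.sqrt (fine 'V_P[X]) in
  let Xstar : graph n -> R := fun G => (X G - mu) / sigma in
  let L : set R := [set x | (0 < P [set G | Xstar G = x])%E] in
  (ereal_sup
     [set (`| (Num.sqrt (2 * pi))^-1 * expR (- x ^+ 2 / 2)
              - sigma * fine (P [set G | Xstar G = x]) |)%:E | x in L]
   <= (C * n%:R `^ (- (1 / 2) + eps) * p `^ (1 / 2))%:E)%E.
Proof.
have /andP[e0 e1] := eps01.
pose m := Num.bound (10 / eps).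
have hm : 10 <= m%:R * eps.
  rewrite -ler_pdivrMr //; apply: ltW; apply: archi_boundP.
  by rewrite divr_ge0 // ltW.
(* [k1] and [m1] are known only through lower bounds, which keeps the large numerals out of the
   arithmetic. *)
have [k1 [k10 hk1]] : exists k1 : R, 0 <= k1 /\ (221 * 7 ^+ 3 <= k1 /\ True).
  exists (221 * 7 ^+ 3); split; last by split; first exact: lexx.
  exact: mulr_ge0 (ler0n R 221) (exprn_ge0 3 (ler0n R 7)).
have [m1 [m10 hm1]] : exists m1 : R, 0 <= m1 /\ (12348 * 7 ^+ 4 <= m1 /\ True).
  exists (12348 * 7 ^+ 4); split; last by split; first exact: lexx.
  exact: mulr_ge0 (ler0n R 12348) (exprn_ge0 4 (ler0n R 7)).
pose r : R := Num.sqrt ((10 * 12) ^+ 10 + (m%:R * 400 ^+ 2) ^+ m).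
have r0 : 0 <= r by exact: sqrtr_ge0.
pose C : R := 2 * k1 + 2 * k1 * m1 + m1 + 4 * r + (2 + 2 * expR 1) * (m%:R * 400 ^+ 2) ^+ m.
have C0 : 0 <= C.
  have := exprn_ge0 m (mulr_ge0 (ler0n R m) (exprn_ge0 2 (ler0n R 400))).
  rewrite /C; move: (_ ^+ m) => c c0.
  have := mulr_ge0 k10 m10; have := mulr_ge0 (expR_ge0 (1 : R)) c0.
  by move: k10 m10 r0 c0; clear; lra.
exists (C + 1); split; first by rewrite ltr_wpDl.
move=> n p n0 p4 p2; cbv zeta.
pose P : probability (graph n) R := @gnp R n p.
pose X : graph n -> R := fun G => (num_triangles G)%:R.
pose mu : R := fine 'E_P[X].
pose sigma : R := Num.sqrt (fine 'V_P[X]).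
pose Xstar : graph n -> R := fun G => (X G - mu) / sigma.
have [x [y [w [[[x8 y0 xy4 y2] [w1 wx wm]] [nx py bE]]]]] :=
  rate_scales eps01 hm n0 p4 p2.
have p01 : 0 <= p <= 1.
  by rewrite py exprn_ge0 ?(ltW y0) //= (le_trans (ltW y2)) // invf_le1 ?ler1n.
have X0 G : 0 <= X G by rewrite ler0n.
have EX : Ex p X = hmu (@tri n) p.
  by rewrite -Ex_copies; apply: eq_Ex => G; rewrite /X num_trianglesE.
have muE : mu = hmu (@tri n) p by rewrite /mu /P expectation_gnp //= EX.
have varE : fine 'V_P[X] = hvar (@tri n) p.
  rewrite /P variance_gnp //= EX -Ex_copies2; apply: eq_Ex => G.
  by rewrite /X num_trianglesE.
have [v0 main] := @triangles_llt R n p x y w k1 m1 m x8 y0 xy4 y2 w1 wx nx py wm.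
have sE : sigma = Num.sqrt (hvar (@tri n) p) by rewrite /sigma varE.
have s0 : 0 < sigma by rewrite sE sqrtr_gt0.
apply: ge_ereal_sup => _ [u Lu <-]; rewrite lee_fin.
have {}Lu : (0 < P [set G | Xstar G = u])%E := Lu.
rewrite -/P -/X -/mu -/sigma -/Xstar.
(* A value of positive probability is attained, so [u] is the standardization of an integer [k], as
   Fourier inversion requires. *)
have [G uG] : exists G, Xstar G = u.
  move: Lu => /=; case: (pselect (exists G, Xstar G = u)) => // nG.
  rewrite (_ : [set G | Xstar G = u] = set0) ?measure0 ?ltxx //.
  by apply/seteqP; split => // G /= GE; apply: nG; exists G.
have PE : fine (P [set G | Xstar G = u]) =
    Ex p (fun H : {set edge n} => (num_triangles H == num_triangles G)%:R).
  rewrite /P gnp_probE //=; apply: eq_Ex => H; congr (_%:R); congr nat_of_bool.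
  apply/idP/idP; rewrite inE /= -uG /Xstar.
    move=> /(mulIf (invr_neq0 (lt0r_neq0 s0))) /addIr /eqP.
    by rewrite eqr_nat.
  by rewrite /X => /eqP ->.
rewrite PE sE -mulrA bE.
have uE : u = ((num_triangles G)%:R - hmu (@tri n) p) / Num.sqrt (hvar (@tri n) p).
  by rewrite -uG /Xstar muE sE.
apply: (le_trans (main (num_triangles G) u uE hk1.1 hm1.1)).
rewrite ler_wpM2r ?lerDl //.
have x0 : 0 <= x by rewrite ltW // (lt_trans _ x8).
by rewrite mulr_ge0 ?divr_ge0 // ?(ltW y0) // exprn_ge0 // (le_trans ler01).
Qed.
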